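(* Let $1<p<\infty$, let $w\in L^1_{\rm loc}(\mathbb{R}^n)$ be a function with $w>0$, and let $\mu$ be the measure on $\mathbb{R}^n$ given by $d\mu=w\,dx$. Then $w$ is a $p$-admissible weight if and only if there exist $q\in(p,\infty)$, $C\in[1,\infty)$ and $\sigma\in[1,\infty)$ such that $$\left(\frac{1}{\mu(B)}\int_B|u-u_B|^q\,d\mu\right)^{1/q}\leq C\,r\left(\frac{1}{\mu(\sigma B)}\int_{\sigma B}|\nabla u|^p\,d\mu\right)^{1/p}$$ whenever $B\subset\mathbb{R}^n$ is a ball of radius $r\in(0,\infty)$ and $u\in C^\infty(\sigma B)$.
   Context: Balls are open Euclidean balls $B=B(x,r)$, with $\tau B:=B(x,\tau r)$, and $u_B:=\frac{1}{\mu(B)}\int_B u\,d\mu$. The inequality is understood for those $u$ for which $u_B$ is defined, i.e. $u$ is $\mu$-integrable on $B$ (automatic if $\sigma>1$). A weight $w$ (a nonnegative locally integrable function on $\mathbb{R}^n$), with associated measure $d\mu=w\,dx$, is called $p$-admissible, $1<p<\infty$, in the sense of Heinonen–Kilpeläinen–Martio (Nonlinear Potential Theory of Degenerate Elliptic Equations) if the following four conditions hold: (I) $0<w<\infty$ almost everywhere in $\mathbb{R}^n$ and $\mu$ is doubling: there is a constant $C_1>0$ such that $\mu(2B)\le C_1\mu(B)$ for every ball $B\subset\mathbb{R}^n$. (II) If $D\subset\mathbb{R}^n$ is open and $\varphi_i\in C^\infty(D)$ is a sequence such that $\int_D|\varphi_i|^p\,d\mu\to0$ and $\int_D|\nabla\varphi_i-v|^p\,d\mu\to0$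 as $i\to\infty$, where $v$ is a vector-valued measurable function in $L^p(D,\mu;\mathbb{R}^n)$, then $v=0$ (almost everywhere). (III) There are constants $\kappa>1$ and $C_3>0$ such that $$\left(\frac{1}{\mu(B)}\int_B|\varphi|^{\kappa p}\,d\mu\right)^{1/(\kappa p)}\le C_3\,r\left(\frac{1}{\mu(B)}\int_B|\nabla\varphi|^p\,d\mu\right)^{1/p}$$ whenever $B=B(x,r)$ is a ball in $\mathbb{R}^n$ and $\varphi\in C_0^\infty(B)$. (IV) There is a constant $C_4>0$ such that $$\int_B|\varphi-\varphi_B|^p\,d\mu\le C_4\,r^p\int_B|\nabla\varphi|^p\,d\mu$$ whenever $B=B(x,r)$ is a ball in $\mathbb{R}^n$ and $\varphi\in C^\infty(B)$ is bounded. *)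

(* Defs.v *)
From HB Require Import structures.
From mathcomp Require Import all_boot all_order all_algebra.
From mathcomp Require Import all_classical all_reals all_analysis.
From mathcomp Require Import measurable_realfun.

Set Implicit Arguments.
Unset Strict Implicit.
Unset Printing Implicit Defensive.

Import Order.TTheory GRing.Theory Num.Theory.
Import numFieldNormedType.Exports.

Local Open Scope classical_set_scope.
Local Open Scope ring_scope.

(* Lebesgue measure on the Borel sets of the space of n-tuples, as an iterated
   product.  The sigma-finiteness is reproved here because the instance of the
   library for product measures is only found for (sub)probabilities. *)
Section lebesgue_tuple.
Variable R : realType.
Local Notation mR := (measurableTypeR R).

Definition tcons n (z : mR * n.-tuple mR) : n.+1.-tuple mR :=
  [tuple of z.1 :: z.2].

Lemma measurable_tcons n : measurable_fun [set: mR * n.-tuple mR] (@tcons n).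
Proof. exact: measurable_cons. Qed.

Section step.
Variables (n : nat) (m : {sigma_finite_measure set (n.-tuple mR) -> \bar R}).

Definition lebesgue_tcons : set (n.+1.-tuple mR) -> \bar R :=
  pushforward (@lebesgue_measure R \x m)%E (@tcons n).

Let lebesgue_tcons0 : lebesgue_tcons set0 = 0%E.
Proof. by rewrite /lebesgue_tcons /pushforward preimage_set0 measure0. Qed.

Let lebesgue_tcons_ge0 A : (0 <= lebesgue_tcons A)%E.
Proof. by rewrite /lebesgue_tcons /pushforward measure_ge0. Qed.

Let lebesgue_tcons_sigma_additive : semi_sigma_additive lebesgue_tcons.
Proof.
by apply: (@measure_semi_sigma_additive _ _ _ (pushforward _ (@tcons n)));
  exact: measurable_tcons.
Qed.

HB.instance Definition _ := isMeasure.Build _ _ _ lebesgue_tcons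
  lebesgue_tcons0 lebesgue_tcons_ge0 lebesgue_tcons_sigma_additive.

Let lebesgue_tcons_sigma_finite : sigma_finite setT lebesgue_tcons.
Proof.
have /sigma_finiteP[F [TF ndF Foo]] := sigma_finiteT (@lebesgue_measure R).
have /sigma_finiteP[G [TG ndG Goo]] := sigma_finiteT m.
pose g (t : n.+1.-tuple mR) : mR * n.-tuple mR := (thead t, [tuple of behead t]).
have mg : measurable_fun setT g.
  apply/measurable_fun_pairP; split; last exact: measurable_behead.
  exact: measurable_tnth.
have tg z : g (tcons z) = z by case: z => x t; congr pair; exact/val_inj.
exists (fun k => g @^-1` (F k `*` G k)).
  rewrite -preimage_bigcup -(@preimage_setT _ _ g); congr (_ @^-1` _).
  rewrite -setXTT TF TG predeqE => -[x y]; split.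
    move=> [/= [k _ Fkx] [l _ Gly]]; exists (maxn k l) => //; split.
    - by move: x Fkx; exact/subsetPset/ndF/leq_maxl.
    - by move: y Gly; exact/subsetPset/ndG/leq_maxr.
  by move=> [k _ []/= ? ?]; split; exists k.
move=> k; have [mF Fk] := Foo k; have [mG Gk] := Goo k.
have mFG : measurable (F k `*` G k) by exact: measurableX.
split; first by rewrite -[X in measurable X]setTI; exact: mg.
rewrite /lebesgue_tcons /pushforward -comp_preimage (_ : _ \o _ = id); last exact/funext.
by rewrite preimage_id product_measure1E// lte_mul_pinfty// ge0_fin_numE.
Qed.

HB.instance Definition _ := Measure_isSigmaFinite.Build _ _ _ lebesgue_tcons
  lebesgue_tcons_sigma_finite.

End step.

Fixpoint lebesgue_tuple n : {sigma_finite_measure set (n.-tuple mR) -> \bar R} :=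
  if n is n'.+1 then lebesgue_tcons (lebesgue_tuple n')
  else \d_([tuple] : 0.-tuple mR).

End lebesgue_tuple.

(* R^n is 'rV[R]_n.  Its measurable sets are all the Lebesgue measurable sets:
   the product measure above is completed by Caratheodory's construction. *)
Definition row_of_tuple (R : realType) n
    (t : n.-tuple (measurableTypeR R)) : 'rV[R]_n := \row_i tnth t i.

Section lebesgue_measure_rV.
Variables (R : realType) (n : nat).

Definition lebesgue_outer (A : set 'rV[R]_n) : \bar R :=
  mu_ext (lebesgue_tuple R n) (@row_of_tuple R n @^-1` A).

Let lebesgue_outer0 : lebesgue_outer set0 = 0%E.
Proof. by rewrite /lebesgue_outer preimage_set0 outer_measure0. Qed.

Let lebesgue_outer_ge0 A : (0 <= lebesgue_outer A)%E.
Proof. exact: outer_measure_ge0. Qed.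

Let le_lebesgue_outer :
  {homo lebesgue_outer : A B / A `<=` B >-> (A <= B)%E}.
Proof. by move=> A B AB; apply: le_outer_measure; exact: preimage_subset. Qed.

Let lebesgue_outer_sigma_subadditive : sigma_subadditive lebesgue_outer.
Proof.
move=> F; rewrite /lebesgue_outer preimage_bigcup.
exact: outer_measure_sigma_subadditive.
Qed.

HB.instance Definition _ := isOuterMeasure.Build R 'rV[R]_n lebesgue_outer
  lebesgue_outer0 lebesgue_outer_ge0 le_lebesgue_outer
  lebesgue_outer_sigma_subadditive.

Let setC_cara A : lebesgue_outer.-caratheodory A ->
  lebesgue_outer.-caratheodory (~` A).
Proof. exact: caratheodory_measurable_setC. Qed.

Let bigcup_cara (F : (set 'rV[R]_n)^nat) :
  (forall i, lebesgue_outer.-caratheodory (F i)) ->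
  lebesgue_outer.-caratheodory (\bigcup_i F i).
Proof. exact: caratheodory_measurable_bigcup. Qed.

HB.instance Definition _ :=
  @isMeasurable.Build (caratheodory_display lebesgue_outer) 'rV[R]_n
    lebesgue_outer.-caratheodory
    (caratheodory_measurable_set0 lebesgue_outer) setC_cara bigcup_cara.

Definition lebesgue_rV : set 'rV[R]_n -> \bar R := lebesgue_outer.

Let lebesgue_rV_sigma_additive : semi_sigma_additive lebesgue_rV.
Proof.
move=> F mF tF mUF.
exact: (@caratheodory_measure_sigma_additive _ _ lebesgue_outer).
Qed.

HB.instance Definition _ := isMeasure.Build _ 'rV[R]_n R lebesgue_rV
  lebesgue_outer0 lebesgue_outer_ge0 lebesgue_rV_sigma_additive.

End lebesgue_measure_rV.
Arguments lebesgue_rV {R n}.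

Section euclidean.
Context {R : realType} {n : nat}.
Implicit Types (x : 'rV[R]_n) (u : 'rV[R]_n -> R) (D : set 'rV[R]_n).

(* The library's norm on 'rV[R]_n is the sup norm, which induces the same
   topology but not the same balls. *)
Definition enorm x : R := Num.sqrt (\sum_(i < n) x 0 i ^+ 2).

Definition eball x (r : R) : set 'rV[R]_n := [set y | enorm (y - x) < r].

Definition partial (i : 'I_n) u : 'rV[R]_n -> R := 'D_(delta_mx 0 i) u.

Definition grad u x : 'rV[R]_n := \row_i partial i u x.

(* u is in C^oo(D), for D open: every iterated partial derivative of u exists
   and is continuous at the points of D.  The values of u outside of D are
   irrelevant. *)
Definition smooth_on D u :=
  forall (s : seq 'I_n) x, D x ->
    {for x, continuous (foldr partial u s)} /\
    forall i, derivable (foldr partial u s) x (delta_mx 0 i).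

Definition supp u : set 'rV[R]_n := closure [set x | u x != 0].

(* u is in C_0^oo(D), functions being extended by 0 outside of D. *)
Definition smooth_compact_supp D u :=
  [/\ smooth_on setT u, compact (supp u) & supp u `<=` D].

End euclidean.

Section weights.
Context {R : realType} {n : nat}.
Implicit Types (w : 'rV[R]_n -> \bar R) (mu : set 'rV[R]_n -> \bar R).
Implicit Types (u phi : 'rV[R]_n -> R) (B D : set 'rV[R]_n).
Local Open Scope ereal_scope.

Definition locally_integrable_rV w :=
  measurable_fun [set: 'rV[R]_n] w /\
  forall K : set 'rV[R]_n, compact K ->
    \int[lebesgue_rV]_(x in K) `|w x| < +oo.

(* d mu = w dx *)
Definition weighted w : set 'rV[R]_n -> \bar R :=
  fun A => \int[lebesgue_rV]_(x in A) w x.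

Definition emean mu B (f : 'rV[R]_n -> \bar R) : \bar R :=
  (mu B)^-1 * \int[mu]_(x in B) f x.

(* u_B *)
Definition mean mu B u : R := fine (emean mu B (EFin \o u)).

Definition weight w := locally_integrable_rV w /\ forall x, 0 <= w x.

Definition doubling mu :=
  exists2 C : R, (0 < C)%R & forall (x : 'rV[R]_n) (r : R), (0 < r)%R ->
    mu (eball x (2 * r)) <= C%:E * mu (eball x r).

Definition unique_gradient (p : R) mu :=
  forall (D : set 'rV[R]_n) (phi : nat -> 'rV[R]_n -> R)
      (v : 'rV[R]_n -> 'rV[R]_n),
    open D ->
    (forall k, smooth_on D (phi k)) ->
    (forall i, measurable_fun D (fun x => v x ord0 i)) ->
    \int[mu]_(x in D) (enorm (v x) `^ p)%:E < +oo ->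
    (fun k => \int[mu]_(x in D) (`|phi k x| `^ p)%:E) @ \oo --> 0 ->
    (fun k => \int[mu]_(x in D) (enorm (grad (phi k) x - v x) `^ p)%:E)
      @ \oo --> 0 ->
    {ae mu, forall x, D x -> v x = 0%R}.

Definition sobolev_ineq (p : R) mu :=
  exists kappa C : R, [/\ (1 < kappa)%R, (0 < C)%R &
    forall (x : 'rV[R]_n) (r : R) (phi : 'rV[R]_n -> R), (0 < r)%R ->
      smooth_compact_supp (eball x r) phi ->
      emean mu (eball x r) (fun y => (`|phi y| `^ (kappa * p))%:E)
          `^ (kappa * p)^-1
        <= (C * r)%:E *
           emean mu (eball x r) (fun y => (enorm (grad phi y) `^ p)%:E)
             `^ p^-1].

Definition poincare_ineq (p : R) mu :=
  exists2 C : R, (0 < C)%R &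
    forall (x : 'rV[R]_n) (r : R) (phi : 'rV[R]_n -> R), (0 < r)%R ->
      smooth_on (eball x r) phi ->
      (exists M : R, forall y, eball x r y -> (`|phi y| <= M)%R) ->
      \int[mu]_(y in eball x r) (`|phi y - mean mu (eball x r) phi| `^ p)%:E
        <= (C * r `^ p)%:E *
           \int[mu]_(y in eball x r) (enorm (grad phi y) `^ p)%:E.

Definition p_admissible (p : R) w :=
  weight w /\
  [/\ {ae lebesgue_rV, forall x, 0 < w x < +oo} /\ doubling (weighted w),
      unique_gradient p (weighted w),
      sobolev_ineq p (weighted w) &
      poincare_ineq p (weighted w)].

Definition sobolev_poincare_ineq (p q C sigma : R) mu :=
  forall (x : 'rV[R]_n) (r : R) (u : 'rV[R]_n -> R), (0 < r)%R ->
    smooth_on (eball x (sigma * r)) u ->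
    mu.-integrable (eball x r) (EFin \o u) ->
    emean mu (eball x r)
        (fun y => (`|u y - mean mu (eball x r) u| `^ q)%:E) `^ q^-1
      <= (C * r)%:E *
         emean mu (eball x (sigma * r))
           (fun y => (enorm (grad u y) `^ p)%:E) `^ p^-1.

End weights.

(* Main.v *)
(** Doubling: applied to cutoffs [u_j] between shrinking concentric balls [B_j],
    the inequality gives [a_{j+1} <= H b^j a_j^(q/p)] for the relative masses
    [a_j] of [B_j] in [B]; as [q > p], a small [a_0] would force [a_j -> 0], while
    all the [B_j] contain a common ball.

    (III): apply the inequality on [2B], where [phi] vanishes on a ball of
    comparable mass.

    (IV): join [x] in [B] to the center of [B] by balls [B_l] whose radii decay
    geometrically and whose dilations stay in [B]; the means over the [B_l]
    telescope to [u x]. The [L^1] norm of an average of [|grad u|^p] over balls of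
    a fixed radius is controlled, by Tonelli and doubling, uniformly in the radius.

    (II): if [phi_k -> 0] and [grad phi_k -> v], the inequality for
    [phi_i - phi_j], [j -> oo], shows that [grad phi_i - v] bounds the oscillation
    of [phi_i] on small balls. As [phi_i] is differentiable, this yields
    [\int |grad phi_i|^p <= K \int |grad phi_i - v|^p], hence [v = 0].

    Conversely, (III) for [eta (u - u_{2B})] with a cutoff [eta], together with
    (IV) on [2B], gives the inequality with [q = kappa p] and [sigma = 3]. *)
Require Import Defs.
From HB Require Import structures.
From mathcomp Require Import all_boot all_order all_algebra.
From mathcomp Require Import all_classical all_reals all_analysis.
From mathcomp Require Import measurable_realfun.
From mathcomp Require Import ring lra.
Import Order.TTheory GRing.Theory Num.Theory.
Import numFieldNormedType.Exports.
Local Open Scope classical_set_scope.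
Local Open Scope ring_scope.

Set Implicit Arguments.
Unset Strict Implicit.
Unset Printing Implicit Defensive.

(** * Euclidean norm and balls *)

Section euclidean_norm.
Context {R : realType} {n : nat}.
Implicit Types (x y z : 'rV[R]_n) (r s : R).

(** The gradient is controlled on [sigma * r], while (IV) allows only the ball itself. This shapes
    the chains: a link at scale [th ^+ l * rho] may use only balls whose [sigma]-dilation still fits
    in B, so its balls are shrunk by a factor [c], and consecutive centers are kept close by a ratio
    [th] near 1. The averages of |grad u|^p met along a chain suggest a maximal function, but that
    operator is not bounded on L^1. Since only one radius occurs for each l, the bound for averages
    at a fixed radius suffices, with geometric weights to sum over l. The same bound serves (II),
    where the radius tends to 0 and Fatou's lemma is applied.

    Inequalities between normalized norms are handled through a parameter lam: an energy of at most
    lam^p * mass yields a deviation of at most (C * r * lam)^q * mass. Sums are then estimated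
    without roots, and infinite energies never enter. The strict inequality p < q is what makes the
    iteration for doubling superlinear, and it provides kappa = q / p > 1 in (III); in (II) and (IV)
    the exponent q is lowered by means of t^p <= 1 + t^q. *)

Definition dot x y : R := \sum_i x 0 i * y 0 i.

Lemma enorm_ge0 x : 0 <= enorm x.
Proof. exact: sqrtr_ge0. Qed.

Lemma sqr_enorm x : enorm x ^+ 2 = \sum_i x 0 i ^+ 2.
Proof. by rewrite sqr_sqrtr// sumr_ge0// => i _; rewrite sqr_ge0. Qed.

Lemma enorm_coord x i : `|x 0 i| <= enorm x.
Proof.
rewrite -(ler_pXn2r (_ : (0 < 2)%N))// ?nnegrE ?normr_ge0 ?enorm_ge0//.
rewrite sqr_enorm real_normK ?num_real// (bigD1 i)//= lerDl.
by rewrite sumr_ge0// => j _; rewrite sqr_ge0.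
Qed.

Lemma enormZ r x : enorm (r *: x) = `|r| * enorm x.
Proof.
rewrite /enorm -sqrtr_sqr -sqrtrM ?sqr_ge0// mulr_sumr.
by congr Num.sqrt; apply: eq_bigr => i _; rewrite mxE exprMn.
Qed.

Lemma enormN x : enorm (- x) = enorm x.
Proof. by rewrite -scaleN1r enormZ normrN1 mul1r. Qed.

Lemma enormB x y : enorm (x - y) = enorm (y - x).
Proof. by rewrite -enormN opprB. Qed.

Lemma enorm0 : enorm (0 : 'rV[R]_n) = 0.
Proof. by rewrite -(scale0r 0) enormZ normr0 mul0r. Qed.

Lemma enorm_eq0 x : enorm x = 0 -> x = 0.
Proof.
move=> x0; apply/rowP => i; rewrite mxE; apply/eqP; rewrite -normr_eq0 eq_le.
by rewrite normr_ge0 andbT -x0 enorm_coord.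
Qed.

Lemma dot_le x y : dot x y <= enorm x * enorm y.
Proof.
have [x0|x0] := eqVneq (enorm x) 0.
  rewrite x0 mul0r (enorm_eq0 x0) /dot big1// => i _.
  by rewrite mxE mul0r.
have [y0|y0] := eqVneq (enorm y) 0.
  rewrite y0 mulr0 (enorm_eq0 y0) /dot big1// => i _.
  by rewrite mxE mulr0.
have a0 : 0 < enorm x by rewrite lt_neqAle eq_sym x0 enorm_ge0.
have b0 : 0 < enorm y by rewrite lt_neqAle eq_sym y0 enorm_ge0.
rewrite -(ler_pM2l (mulr_gt0 a0 b0)).
rewrite (_ : _ * _ * (_ * _) = 2^-1 * (enorm y ^+ 2 * (\sum_i x 0 i ^+ 2)
   + enorm x ^+ 2 * (\sum_i y 0 i ^+ 2))); last by rewrite -!sqr_enorm; field.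
rewrite !mulr_sumr -big_split/= mulr_sumr.
apply: ler_sum => i _; have := sqr_ge0 (enorm y * x 0 i - enorm x * y 0 i).
nra.
Qed.

Lemma dotrr x : dot x x = enorm x ^+ 2.
Proof. by rewrite sqr_enorm; apply: eq_bigr => i _; rewrite expr2. Qed.

Lemma dotZr r x y : dot x (r *: y) = r * dot x y.
Proof. by rewrite /dot mulr_sumr; apply: eq_bigr => i _; rewrite mxE; ring. Qed.

Lemma dotDr x y z : dot x (y + z) = dot x y + dot x z.
Proof.
by rewrite /dot -big_split; apply: eq_bigr => i _; rewrite mxE mulrDr.
Qed.

Lemma dotNr x y : dot x (- y) = - dot x y.
Proof. by rewrite -scaleN1r dotZr mulN1r. Qed.

Lemma normr_dot_le x y : `|dot x y| <= enorm x * enorm y.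
Proof.
by rewrite ler_norml dot_le andbT lerNl -dotNr (le_trans (dot_le _ _))// enormN.
Qed.

Lemma enormD x y : enorm (x + y) <= enorm x + enorm y.
Proof.
rewrite -(ler_pXn2r (_ : (0 < 2)%N))// ?nnegrE ?addr_ge0 ?enorm_ge0//.
have -> : enorm (x + y) ^+ 2 = enorm x ^+ 2 + 2 * dot x y + enorm y ^+ 2.
  rewrite !sqr_enorm /dot mulr_sumr -!big_split/=.
  by apply: eq_bigr => i _; rewrite mxE; ring.
by have := dot_le x y; nra.
Qed.

Lemma enorm_triangle z x y : enorm (x - y) <= enorm (x - z) + enorm (z - y).
Proof. by rewrite (le_trans _ (enormD _ _))// addrA subrK. Qed.

Lemma enorm_delta i : enorm (delta_mx 0 i : 'rV[R]_n) = 1.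
Proof.
rewrite /enorm (bigD1 i)//= mxE !eqxx expr1n big1 ?addr0 ?sqrtr1//.
by move=> j /negPf ji; rewrite mxE ji expr0n.
Qed.

Lemma enorm_le_sum x : enorm x <= \sum_i `|x 0 i|.
Proof.
have -> : x = \sum_i x 0 i *: delta_mx 0 i :> 'rV[R]_n by exact: row_sum_delta.
apply: (@le_trans _ _ (\sum_i enorm (x 0 i *: delta_mx 0 i : 'rV[R]_n))).
  elim/big_rec2: _ => [|i y z _ zy]; first by rewrite enorm0.
  by rewrite (le_trans (enormD _ _))// lerD2l.
rewrite -row_sum_delta; apply: ler_sum => i _.
by rewrite enormZ enorm_delta mulr1.
Qed.

Lemma normr_le_enorm x : `|x| <= enorm x.
Proof.
rewrite /Num.norm/= mx_normrE; apply/bigmax_leP; split; first exact: enorm_ge0.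
by move=> [i j] _ /=; rewrite ord1 enorm_coord.
Qed.

Lemma enorm_le_normr x : enorm x <= n%:R * `|x|.
Proof.
rewrite (le_trans (enorm_le_sum _))//.
rewrite mulr_natl -[X in _ *+ X]card_ord -sumr_const; apply: ler_sum => i _.
by rewrite {2}/Num.norm/= mx_normrE; apply: le_bigmax (ord0, i).
Qed.

Lemma continuous_enorm : continuous (@enorm R n).
Proof.
move=> x; apply/(@cvgrPdist_le _ _ _ (nbhs x)) => e e0.
have d0 : 0 < e / (n%:R + 1) by rewrite divr_gt0// ltr_wpDl.
apply/nbhs_ballP; exists (e / (n%:R + 1)) => // y.
rewrite -ball_normE /ball_/= => /ltW xy.
rewrite (@le_trans _ _ (enorm (x - y)))//.
  rewrite ler_norml; apply/andP; split.
    have := enormD (y - x) x; rewrite subrK enormB; lra.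
  by have := enormD (x - y) y; rewrite subrK; lra.
rewrite (le_trans (enorm_le_normr _))//.
rewrite (@le_trans _ _ (n%:R * (e / (n%:R + 1))))//.
  by rewrite ler_wpM2l.
by rewrite mulrA ler_pdivrMr ?ltr_wpDl// mulrC ler_pM2l// lerDl.
Qed.

Lemma continuous_dist x : continuous (fun y => enorm (y - x)).
Proof.
move=> y; apply: (@continuous_comp _ _ _ (fun y => y - x) (@enorm R n)).
  by apply: (@continuousB _ _ _ id (cst x)); [exact: cvg_id|exact: cst_continuous].
exact: continuous_enorm.
Qed.

Lemma open_eball x r : open (eball x r).
Proof.
rewrite (_ : eball x r = (fun y => enorm (y - x)) @^-1` [set t | t < r])//.
apply: open_comp; last exact: open_lt.
by move=> y _; exact: continuous_dist.
Qed.

Lemma subset_eball x y r s : enorm (x - y) + r <= s -> eball x r `<=` eball y s.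
Proof.
move=> xys z; rewrite /eball/= => zx.
by rewrite (le_lt_trans (enorm_triangle x _ _))//; lra.
Qed.

Lemma le_eball x r s : r <= s -> eball x r `<=` eball x s.
Proof. by move=> rs; apply: subset_eball; rewrite subrr enorm0 add0r. Qed.

Lemma nbhs_eball x (A : set 'rV[R]_n) :
  nbhs x A -> exists2 r, 0 < r & eball x r `<=` A.
Proof.
move=> /nbhs_ballP[r /= r0 xA]; exists r => // y yx; apply: xA.
by rewrite -ball_normE /ball_/= (le_lt_trans (normr_le_enorm _))// enormB.
Qed.

Definition ecball x r : set 'rV[R]_n := [set y | enorm (y - x) <= r].

Lemma eball_ecball x r : eball x r `<=` ecball x r.
Proof. by move=> y /ltW. Qed.

Lemma ecball_eball x r s : r < s -> ecball x r `<=` eball x s.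
Proof. by move=> rs y yx; rewrite /eball/= (le_lt_trans yx). Qed.

Lemma closed_ecball x r : closed (ecball x r).
Proof.
rewrite (_ : ecball x r = (fun y => enorm (y - x)) @^-1` [set t | t <= r])//.
apply: closed_comp; last exact: closed_le.
by move=> y _; exact: continuous_dist.
Qed.

Lemma compact_ecball x r : compact (ecball x r).
Proof.
apply: bounded_closed_compact; last exact: closed_ecball.
exists (`|x| + r); split; first exact: num_real.
move=> M M1 y xy; apply: le_trans (ltW M1).
rewrite -[y](subrK x) addrC (le_trans (ler_normD _ _))// lerD2l.
by rewrite (le_trans (normr_le_enorm _)).
Qed.

End euclidean_norm.

(** * Calculus of smooth functions *)

Section derivative_along_line.
Context {R : realType} {V : normedModType R}.
Implicit Types (x w : V) (f : V -> R).

(** Together with [line_is_derive], this reduces a derivative along [w] to a derivative in one real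
    variable, so that the chain rule and the mean value theorem apply to functions known only to
    have a derivative in that direction. *)
Lemma is_derive_line (f : V -> R) x w t (df : R) :
  is_derive (t *: w + x) w f df -> is_derive t 1 (fun h => f (h *: w + x)) df.
Proof.
move=> [df1 <-].
have e : (fun h : R => h^-1 *: (f (h *: w + (t *: w + x)) - f (t *: w + x))) =
  (fun h : R => h^-1 *: (f ((h *: (1 : R) + t : R) *: w + x) - f (t *: w + x))).
  by apply/funext => h; rewrite addrA -scalerDl [h *: 1]mulr1.
split; first by move: df1; rewrite /derivable e.
by rewrite /derive e.
Qed.

Lemma line_is_derive (f : V -> R) x w (df : R) :
  is_derive (0 : R) 1 (fun h => f (h *: w + x)) df -> is_derive x w f df.
Proof.
move=> [d e]; split; first by apply/(derivable1P f x w).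
rewrite -e /derive.
have -> // : (fun h : R => h^-1 *: (f (h *: w + x) - f x)) =
  (fun h : R => h^-1 *: (f ((h *: (1 : R) + 0 : R) *: w + x) - f ((0 : R) *: w + x))).
by apply/funext => h /=; rewrite addr0 scale0r add0r [h *: 1]mulr1.
Qed.

Lemma is_derive_comp1 (u : V -> R) (F : R -> R) x w (du dF : R) :
  is_derive x w u du -> is_derive (u x) 1 F dF ->
  is_derive x w (fun y => F (u y)) (dF * du).
Proof.
move=> hu [F1 F2]; apply: line_is_derive.
have [d1 d2] : is_derive (0 : R) 1 (fun h => u (h *: w + x)) du.
  by apply: is_derive_line; rewrite scale0r add0r.
have u0 : u ((0 : R) *: w + x) = u x by rewrite scale0r add0r.
have dF1 : derivable F (u ((0 : R) *: w + x)) 1 by rewrite u0; exact: F1.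
split.
  apply/derivable1_diffP.
  apply: (@differentiable_comp _ _ _ _ (fun h : R => u (h *: w + x)) F).
    exact/derivable1_diffP.
  exact/derivable1_diffP.
rewrite -derive1E (@derive1_comp _ (fun h : R => u (h *: w + x)) F _ d1 dF1).
by rewrite !derive1E u0 F2 d2.
Qed.

End derivative_along_line.

Section smooth_calculus.
Context {R : realType} {n : nat}.
Implicit Types (x w : 'rV[R]_n) (D : set 'rV[R]_n) (u v : 'rV[R]_n -> R) (k : nat).

(** Smoothness of finite order, made for induction in the product and chain rules. The recursion
    peels off the derivative applied first, whereas [foldr partial u s] exposes the one applied
    last; [foldr_rcons] reconciles the two. *)
Fixpoint Ck k D u : Prop :=
  (forall x, D x -> {for x, continuous u} /\
    forall i, derivable u x (delta_mx 0 i)) /\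
  if k is k'.+1 then forall i, Ck k' D (partial i u) else True.

Lemma Ck0 k D u : Ck k D u -> forall x, D x -> {for x, continuous u} /\
    forall i, derivable u x (delta_mx 0 i).
Proof. by case: k => [|k] []. Qed.

Lemma smooth_onP D u : smooth_on D u <-> forall k, Ck k D u.
Proof.
split => [+ k|].
  elim: k u => [|k IH] u su; split=> //.
  - by move=> x Dx; apply: (su [::]).
  - by move=> x Dx; apply: (su [::]).
  - by move=> i; apply: IH => s x Dx; have := su (rcons s i) x Dx; rewrite foldr_rcons.
move=> + s; elim/last_ind: s u => [|s i IH] u Cu x Dx.
  by have [+ _] := Cu 0%N; exact.
by rewrite foldr_rcons; apply: IH => // k; have [_] := Cu k.+1; exact.
Qed.

Lemma smooth_on_sub D D' u : D' `<=` D -> smooth_on D u -> smooth_on D' u.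
Proof. by move=> DD' su s x /DD'; exact: su. Qed.

Lemma CkW k D u : Ck k.+1 D u -> Ck k D u.
Proof.
by elim: k u => [|k IH] u [Cu Ku]; split => // i; exact/IH/Ku.
Qed.

Lemma eq_on_partial D u v : open D -> (forall x, D x -> u x = v x) ->
  forall x, D x -> [/\ {for x, continuous u} -> {for x, continuous v},
    forall w, derivable u x w -> derivable v x w &
    forall w, 'D_w u x = 'D_w v x].
Proof.
move=> oD uv x Dx.
have nuv : {near x, u =1 v}.
  by apply: (filterS _ (open_nbhs_nbhs (conj oD Dx))) => y /uv.
split=> [cu|w|w].
- rewrite /prop_for /continuous_at -(uv _ Dx).
  exact: cvg_trans (@near_eq_cvg _ _ (nbhs x) _ u v nuv) cu.
- by apply: near_eq_derivable.
- exact: near_eq_derive.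
Qed.

(** The formulas for [partial i] of a sum, product or composite hold only on D: elsewhere the
    functions may fail to be derivable and [partial] has arbitrary values. As D is open, agreement
    on D is enough. *)
Lemma Ck_eq k D u v : open D -> (forall x, D x -> u x = v x) ->
  Ck k D u -> Ck k D v.
Proof.
move=> oD; elim: k u v => [|k IH] u v uv [Cu Ku].
  split; last exact: I.
  move=> x Dx; have [c d _] := eq_on_partial oD uv Dx.
  by have [cu du] := Cu _ Dx; split=> [|i]; [exact: c|exact/d/du].
split.
  move=> x Dx; have [c d _] := eq_on_partial oD uv Dx.
  by have [cu du] := Cu _ Dx; split=> [|i]; [exact: c|exact/d/du].
move=> i; apply: (IH (partial i u)); last exact: Ku.
move=> x Dx.
by have [_ _ e] := eq_on_partial oD uv Dx; exact: e.
Qed.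

Lemma partialD i u v x : derivable u x (delta_mx 0 i) ->
  derivable v x (delta_mx 0 i) ->
  partial i (fun y => u y + v y) x = partial i u x + partial i v x.
Proof. exact: deriveD. Qed.

Lemma partialM i u v x : derivable u x (delta_mx 0 i) ->
  derivable v x (delta_mx 0 i) ->
  partial i (fun y => u y * v y) x = u x * partial i v x + v x * partial i u x.
Proof. exact: deriveM. Qed.

Lemma partial_cst i (c : R) x : partial i (fun=> c) x = 0.
Proof. exact: derive_cst. Qed.

Lemma CkD k D u v : open D -> Ck k D u -> Ck k D v ->
  Ck k D (fun x => u x + v x).
Proof.
move=> oD; elim: k u v => [|k IH] u v [Cu Ku] [Cv Kv].
  split; last exact: I.
  move=> x Dx; have [cu du] := Cu _ Dx; have [cv dv] := Cv _ Dx.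
  by split=> [|i]; [exact: continuousD|exact: derivableD].
split.
  move=> x Dx; have [cu du] := Cu _ Dx; have [cv dv] := Cv _ Dx.
  by split=> [|i]; [exact: continuousD|exact: derivableD].
move=> i; apply: (Ck_eq oD _ (IH _ _ (Ku i) (Kv i))) => x Dx.
have [cu du] := Cu _ Dx; have [cv dv] := Cv _ Dx.
by rewrite partialD.
Qed.

Lemma CkM k D u v : open D -> Ck k D u -> Ck k D v ->
  Ck k D (fun x => u x * v x).
Proof.
move=> oD; elim: k u v => [|k IH] u v Su Sv;
  (split; first by move=> x Dx; have [cu du] := Ck0 Su Dx;
   have [cv dv] := Ck0 Sv Dx;
  split=> [|i]; [exact: continuousM|exact: derivableM]) => //.
move=> i; have [Cu Ku] := Su; have [Cv Kv] := Sv.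
apply: (Ck_eq oD _ (CkD oD (IH _ _ (CkW Su) (Kv i))
  (IH _ _ (CkW Sv) (Ku i)))) => x Dx.
have [cu du] := Cu _ Dx; have [cv dv] := Cv _ Dx.
by rewrite partialM.
Qed.

Lemma Ck_cst k D (c : R) : Ck k D (fun=> c).
Proof.
elim: k c => [|k IH] c; split=> //.
1,2: by move=> x Dx; split=> [|i]; [exact: cst_continuous|exact: derivable_cst].
move=> i; rewrite (_ : partial i _ = fun=> 0)//.
by apply/funext => x; rewrite partial_cst.
Qed.

Lemma smooth_onD D u v : open D -> smooth_on D u -> smooth_on D v ->
  smooth_on D (fun x => u x + v x).
Proof.
by move=> oD /smooth_onP su /smooth_onP sv; apply/smooth_onP => k; exact: CkD.
Qed.

Lemma smooth_onM D u v : open D -> smooth_on D u -> smooth_on D v ->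
  smooth_on D (fun x => u x * v x).
Proof.
by move=> oD /smooth_onP su /smooth_onP sv; apply/smooth_onP => k; exact: CkM.
Qed.

Lemma smooth_on_cst D (c : R) : smooth_on D (fun=> c).
Proof. by apply/smooth_onP => k; exact: Ck_cst. Qed.

Lemma smooth_on_eq D u v : open D -> (forall x, D x -> u x = v x) ->
  smooth_on D u -> smooth_on D v.
Proof.
by move=> oD uv /smooth_onP su; apply/smooth_onP => k; exact: Ck_eq (su k).
Qed.

Lemma smooth_onB D u v : open D -> smooth_on D u -> smooth_on D v ->
  smooth_on D (fun x => u x - v x).
Proof.
move=> oD su sv; have := smooth_onM oD (@smooth_on_cst D (-1)) sv.
by move=> /(smooth_onD oD su)/(smooth_on_eq oD); apply => x _; rewrite mulN1r.
Qed.

Lemma smooth_onU D D' u : smooth_on D u -> smooth_on D' u ->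
  smooth_on (D `|` D') u.
Proof. by move=> su su' s x [/su|/su']; exact. Qed.

Lemma is_derive_coord j x w : is_derive x w (fun y : 'rV[R]_n => y 0 j) (w 0 j).
Proof.
apply: line_is_derive.
rewrite (_ : (fun _ => _) = fun h : R => h * w 0 j + x 0 j); last first.
  by apply/funext => h; rewrite !mxE.
have -> : w 0 j = w 0 j * 1 + 0 by rewrite mulr1 addr0.
apply: is_deriveD.
rewrite (_ : (fun _ => _) = fun h : R => w 0 j *: h); last first.
  by apply/funext => h; rewrite /GRing.scale/= mulr1 addr0 mulrC.
apply: is_deriveZ.
Qed.

Lemma partial_coord i j x :
  partial i (fun y : 'rV[R]_n => y 0 j) x = (delta_mx 0 i : 'rV[R]_n) 0 j.
Proof. by have [_ <-] := is_derive_coord j x (delta_mx 0 i). Qed.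

Lemma smooth_on_coord D j : smooth_on D (fun x => x 0 j).
Proof.
apply/smooth_onP => k.
suff H : (forall x : 'rV[R]_n, D x -> {for x, continuous (fun y : 'rV[R]_n => y 0 j)} /\
    forall i, derivable (fun y : 'rV[R]_n => y 0 j) x (delta_mx 0 i)).
  case: k => [|k]; split => // i.
  rewrite (_ : partial i _ = fun=> (delta_mx 0 i : 'rV[R]_n) 0 j); first exact: Ck_cst.
  by apply/funext => x; exact: partial_coord.
move=> x _; split; first exact: coord_continuous.
by move=> i; have [] := is_derive_coord j x (delta_mx 0 i).
Qed.

Lemma smooth_on_sum D (I : Type) (r : seq I) (u : I -> 'rV[R]_n -> R) :
  open D -> (forall i, smooth_on D (u i)) ->
  smooth_on D (fun x => \sum_(i <- r) u i x).
Proof.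
move=> oD su; elim: r => [|i r IH].
  by apply: (smooth_on_eq oD _ (@smooth_on_cst D 0)) => x _; rewrite big_nil.
by apply: (smooth_on_eq oD _ (smooth_onD oD (su i) IH)) => x _; rewrite big_cons.
Qed.

Section composition.
(** A smooth function of one variable is given with the tower of its derivatives: [F m] is the m-th
    derivative of [F 0]. Each differentiation in [Ck_comp] raises m by one. *)
Variable F : nat -> R -> R.
Hypothesis dF : forall (m : nat) (t : R), is_derive t 1 (F m) (F m.+1 t).

Lemma continuous_of_derivatives m : continuous (F m).
Proof.
by move=> t; apply/differentiable_continuous/derivable1_diffP; have [] := dF m t.
Qed.

Lemma partial_comp i u m x : derivable u x (delta_mx 0 i) ->
  partial i (fun y => F m (u y)) x = F m.+1 (u x) * partial i u x.
Proof.
move=> /derivableP du.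
by have [_] := is_derive_comp1 du (dF m (u x)); rewrite /partial.
Qed.

Lemma Ck_comp k D u m : open D -> Ck k D u -> Ck k D (fun x => F m (u x)).
Proof.
move=> oD; elim: k u m => [|k IH] u m Su;
  (split; first by move=> x Dx; have [cu du] := Ck0 Su Dx;
   split=> [|i]; [apply: (@continuous_comp _ _ _ u (F m)) => //; exact: continuous_of_derivatives|
   have /derivableP du' := du i;
   have [] := is_derive_comp1 du' (dF m (u x))]) => //.
move=> i; have [Cu Ku] := Su.
apply: (Ck_eq oD _ (CkM oD (IH _ m.+1 (CkW Su)) (Ku i))) => x Dx.
by have [_ du] := Cu _ Dx; rewrite partial_comp.
Qed.

Lemma smooth_on_comp D u m : open D -> smooth_on D u ->
  smooth_on D (fun x => F m (u x)).
Proof.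
by move=> oD /smooth_onP su; apply/smooth_onP => k; exact: Ck_comp.
Qed.

End composition.

End smooth_calculus.

(** * Smooth cutoffs *)

Section smooth_step.
Context {R : realType}.
Implicit Types (t s : R) (P : {poly R}).

(** Each monomial satisfies s^i <= i! * e^s, by the exponential series. *)
Lemma poly_expN_bounded P :
  exists C : R, forall s, 0 < s -> `|P.[s]| * expR (- s) <= C.
Proof.
exists (\sum_(i < size P) `|P`_i| * i`!%:R) => s s0.
rewrite horner_coef (le_trans (ler_wpM2r (expR_ge0 _) (ler_norm_sum _ _ _)))//.
rewrite mulr_suml; apply: ler_sum => i _.
rewrite normrM normrX (gtr0_norm s0) -mulrA ler_wpM2l// expRN.
rewrite ler_pdivrMr ?expR_gt0//; case: i => -[|i] _ /=.
  by rewrite expr0 fact0 mul1r -expR0 ler_expR ltW.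
have := expR_ge1Dxn i (ltW s0); rewrite -ler_pdivrMl ?ltr0n ?fact_gt0// mulrC.
by apply: le_trans; rewrite lerDr.
Qed.

(** The k-th derivative of exp (- 1 / t) for t > 0 has the form P (1 / t) * exp (- 1 / t).
    Differentiating once more turns P into X^2 * (P - P'), because 1 / t has derivative - 1 /
    t^2. *)
Fixpoint flat_poly k : {poly R} :=
  if k is k'.+1 then 'X^2 * (flat_poly k' - (flat_poly k')^`()) else 1.

Definition flat k t : R :=
  if 0 < t then (flat_poly k).[t^-1] * expR (- t^-1) else 0.

(** The factor t^2 is gained by bounding ['X^2 * flat_poly k]. It makes the difference quotients at
    0 tend to 0, which joins the two pieces of [flat] smoothly. *)
Lemma flat_sqr_bound k : exists C : R, forall t, `|flat k t| <= C * t ^+ 2.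
Proof.
have [C CP] := poly_expN_bounded ('X^2 * flat_poly k).
have C0 : 0 <= C by apply: le_trans (CP 1 ltr01); rewrite mulr_ge0// expR_ge0.
exists C => t; rewrite /flat; case: ifPn => [t0|_]; last first.
  by rewrite normr0 mulr_ge0// sqr_ge0.
have := CP _ (_ : 0 < t^-1); rewrite invr_gt0 => /(_ t0).
rewrite hornerM hornerXn normrM normrX gtr0_norm ?invr_gt0// -mulrA.
rewrite exprVn ler_pdivrMl ?exprn_gt0// [leRHS]mulrC.
by rewrite normrM (ger0_norm (expR_ge0 _)).
Qed.

Lemma is_derive_flat k t : is_derive t 1 (flat k) (flat k.+1 t).
Proof.
have [t0|t0|<-] := ltgtP 0 t.
- apply: (@near_eq_is_derive _ _ _
    (fun s => (flat_poly k).[s^-1] * expR (- s^-1))).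
  + near=> s; rewrite /flat ifT//; near: s; exact: lt_nbhsr.
  + have tn0 : t != 0 by rewrite gt_eqF.
    have dV : is_derive t 1 (fun s : R => s^-1) (- t ^- 2).
      have := @is_deriveV R id t 1 1 tn0 (is_derive_id _ _).
      by rewrite [_ *: _]mulr1.
    have de : is_derive t 1 (fun s : R => expR (- s^-1)) (expR (- t^-1) * t ^- 2).
      apply: (@is_derive_comp1 _ _ (fun s : R => - s^-1) expR).
      by have := is_deriveN dV; rewrite opprK.
    have dp := is_derive_comp1 dV (is_derive_poly (flat_poly k) t^-1).
    have := is_deriveM dp de; set d := (X in is_derive _ _ _ X).
    have -> // : d = flat k.+1 t.
    rewrite /d /flat t0 /= !hornerE /GRing.scale/= exprVn; ring.
- have -> : flat k.+1 t = 0 by rewrite /flat ltNge (ltW t0).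
  apply: (@near_eq_is_derive _ _ _ (cst 0)).
  near=> s; rewrite /flat ifF//; apply/negbTE; rewrite -leNgt ltW//; near: s.
  exact: lt_nbhsl.
have -> : flat k.+1 0 = 0 by rewrite /flat ltxx.
have [C CP] := flat_sqr_bound k.
have C0 : 0 <= C by have := CP 1; rewrite expr1n mulr1; apply: le_trans.
have f0 : flat k 0 = 0 by rewrite /flat ltxx.
suff cv : (h^-1 *: (flat k (h *: 1 + 0) - flat k 0) @[h --> 0^'] --> (0 : R)).
  by split; [apply: cvgP cv|exact: cvg_lim].
apply/cvgrPdist_le => e e0; near=> h.
rewrite sub0r normrN f0 subr0 addr0 [h *: 1]mulr1 normrZ normfV.
have h0 : h != 0 by near: h; exact: nbhs_dnbhs_neq.
rewrite ler_pdivrMl ?normr_gt0// (le_trans (CP h))//.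
rewrite -real_normK ?num_real// expr2 mulrCA ler_pM2l ?normr_gt0//.
rewrite (@le_trans _ _ (C * (e / (C + 1))))//.
  rewrite ler_wpM2l//; near: h; apply: dnbhs0_le.
  by rewrite divr_gt0// ltr_wpDl.
by rewrite mulrA ler_pdivrMr ?ltr_wpDl// mulrC ler_pM2l// lerDl.
Unshelve. all: by end_near. Qed.

Lemma flat_bounded k : exists2 C : R, 0 < C & forall t, `|flat k t| <= C.
Proof.
have [C CP] := poly_expN_bounded (flat_poly k).
exists (`|C| + 1) => [|t]; first by rewrite ltr_wpDl.
rewrite /flat; case: ifPn => [t0|_]; last by rewrite normr0 addr_ge0.
rewrite normrM (ger0_norm (expR_ge0 _)) (le_trans (CP _ _)) ?invr_gt0//.
by rewrite (le_trans (ler_norm _))// lerDl.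
Qed.

Lemma flat0E t : 0 < t -> flat 0 t = expR (- t^-1).
Proof. by rewrite /flat => -> /=; rewrite hornerC mul1r. Qed.

Lemma flat_le0 k t : t <= 0 -> flat k t = 0.
Proof. by rewrite /flat ltNge => ->. Qed.

Lemma flat0_gt0 t : 0 < t -> 0 < flat 0 t.
Proof. by move=> t0; rewrite flat0E// expR_gt0. Qed.

Lemma flat0_ge0 t : 0 <= flat 0 t.
Proof. by have [/flat_le0 ->|/flat0_gt0/ltW] := leP t 0. Qed.

Lemma flat0_le s t : s <= t -> flat 0 s <= flat 0 t.
Proof.
move=> st; have [/flat_le0 ->|s0] := leP s 0; first exact: flat0_ge0.
have t0 := lt_le_trans s0 st; rewrite !flat0E// ler_expR lerN2.
by rewrite lef_pV2.
Qed.

(** A smooth transition from 0 to 1 on [0, 1]. With f = [flat 0], t <= 0 gives 1 - f (1) / f (1),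
    and t >= 1 makes the argument of the outer f nonpositive. Nesting f, instead of dividing f (t)
    by f (t) + f (1 - t), leaves only constant denominators, so the sum, product and composition
    rules cover it. *)
Definition step t : R := 1 - flat 0 (1 - flat 0 t / flat 0 1) / flat 0 1.

Lemma step_le0 t : t <= 0 -> step t = 0.
Proof.
move=> t0; rewrite /step (flat_le0 _ t0) mul0r subr0 divff ?subrr//.
by rewrite gt_eqF// flat0_gt0.
Qed.

Lemma step_ge1 t : 1 <= t -> step t = 1.
Proof.
move=> t1; rewrite /step [flat 0 (1 - _)]flat_le0 ?mul0r ?subr0//.
by rewrite subr_le0 ler_pdivlMr ?flat0_gt0// mul1r flat0_le.
Qed.

Lemma step_ge0 t : 0 <= step t.
Proof.
rewrite subr_ge0 ler_pdivrMr ?flat0_gt0// mul1r flat0_le// gerBl.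
by rewrite divr_ge0 ?flat0_ge0.
Qed.

Lemma step_le1 t : step t <= 1.
Proof. by rewrite gerBl divr_ge0 ?flat0_ge0. Qed.

End smooth_step.

Section cutoff.
Context {R : realType} {n : nat}.
Implicit Types (x : 'rV[R]_n) (u : 'rV[R]_n -> R).

Lemma smooth_on_step D u : open D -> smooth_on D u ->
  smooth_on D (fun y => step (u y)).
Proof.
move=> oD su.
have sf := smooth_on_comp (@is_derive_flat R) 0 oD su.
have s1 := smooth_onB oD (@smooth_on_cst _ _ D 1)
  (smooth_onM oD sf (@smooth_on_cst _ _ D (flat 0 1)^-1)).
have s2 := smooth_on_comp (@is_derive_flat R) 0 oD s1.
exact: smooth_onB oD (@smooth_on_cst _ _ D 1)
  (smooth_onM oD s2 (@smooth_on_cst _ _ D (flat 0 1)^-1)).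
Qed.

(** M is the derivative of [step] at [u x], and it is bounded because [flat 1] is. That it vanishes
    for [u x <= 0] makes the gradient of a cutoff vanish on the bounding sphere as well as outside
    it. *)
Lemma partial_step : exists2 K : R, 0 < K &
  forall u x, exists2 M : R, `|M| <= K /\ (u x <= 0 -> M = 0) &
    forall i, derivable u x (delta_mx 0 i) ->
    partial i (fun y => step (u y)) x = M * partial i u x.
Proof.
have [K K0 KP] := @flat_bounded R 1.
have f1 : 0 < flat 0 (1 : R) by exact: flat0_gt0.
exists (K ^+ 2 / flat 0 1 ^+ 2).
  by rewrite divr_gt0// exprn_gt0.
move=> u x; pose v := fun y => 1 - flat 0 (u y) / flat 0 1.
exists (flat 1 (v x) * flat 1 (u x) / flat 0 1 ^+ 2).
  split; last by move=> ux; rewrite (flat_le0 _ ux) mulr0 mul0r.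
  rewrite normrM normfV normrX (gtr0_norm f1) ler_pM2r ?invr_gt0 ?exprn_gt0//.
  by rewrite normrM expr2 ler_pM.
move=> i /derivableP du.
have d1 := is_derive_comp1 du (is_derive_flat 0 (u x)).
have d2 : is_derive x (delta_mx 0 i) v (- ((flat 1 (u x) * 'D_(delta_mx 0 i) u x) / flat 0 1)).
  have := is_deriveB (is_derive_cst (1 : R) x (delta_mx 0 i))
    (is_deriveM d1 (is_derive_cst (flat 0 1)^-1 x (delta_mx 0 i))).
  by rewrite sub0r /GRing.scale/= mulr0 add0r [_^-1 * _]mulrC.
have d3 := is_derive_comp1 d2 (is_derive_flat 0 (v x)).
have d4 : is_derive x (delta_mx 0 i) (fun y => step (u y))
   (- ((flat 1 (v x) * - (flat 1 (u x) * 'D_(delta_mx 0 i) u x / flat 0 1)) / flat 0 1)).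
  have := is_deriveB (is_derive_cst (1 : R) x (delta_mx 0 i))
    (is_deriveM d3 (is_derive_cst (flat 0 1)^-1 x (delta_mx 0 i))).
  by rewrite sub0r /GRing.scale/= mulr0 add0r [_^-1 * _]mulrC.
case: d4 => _; rewrite /partial => ->; field.
by rewrite gt_eqF.
Qed.

Lemma partial_sqdist x i y :
  is_derive y (delta_mx 0 i) (fun z : 'rV[R]_n => \sum_j (z 0 j - x 0 j) ^+ 2)
   (2 * (y 0 i - x 0 i)).
Proof.
have := @is_derive_sum R _ _ n (fun j (z : 'rV[R]_n) => (z 0 j - x 0 j) ^+ 2) y (delta_mx 0 i)
  (fun j => 2 * (y 0 j - x 0 j) * (delta_mx 0 i : 'rV[R]_n) 0 j).
rewrite (_ : \sum_j (2 * _ * _) = 2 * (y 0 i - x 0 i)); last first.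
  rewrite (bigD1 i)//= mxE !eqxx mulr1 big1 ?addr0// => j /negPf ji.
  by rewrite mxE ji mulr0.
rewrite (_ : (\sum_j _) = fun z : 'rV[R]_n => \sum_j (z 0 j - x 0 j) ^+ 2); last first.
  by apply/funext => z; rewrite fct_sumE.
apply => j.
have d : is_derive y (delta_mx 0 i) (fun z : 'rV[R]_n => z 0 j - x 0 j)
   ((delta_mx 0 i : 'rV[R]_n) 0 j).
  rewrite -[X in is_derive _ _ _ X]subr0; apply: is_deriveB.
  exact: is_derive_coord.
have := is_deriveM d d; rewrite /GRing.scale/=; set l := (X in is_derive _ _ _ X).
by have -> // : l = 2 * (y 0 j - x 0 j) * (delta_mx 0 i : 'rV[R]_n) 0 j; rewrite /l; ring.
Qed.

Lemma cutoff_exists : exists2 K : R, 0 < K & forall x (a b : R), 0 < b -> b < a ->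
  exists eta : 'rV[R]_n -> R,
  [/\ smooth_on setT eta, (forall y, 0 <= eta y <= 1),
     (forall y, enorm (y - x) <= b -> eta y = 1),
     (forall y, a <= enorm (y - x) -> eta y = 0 /\ grad eta y = 0) &
     (forall y, enorm (grad eta y) <= K / (a - b))].
Proof.
have [K K0 KP] := partial_step; exists (2 * K); first by rewrite mulr_gt0.
move=> x a b b0 ba.
have ab : 0 < a ^+ 2 - b ^+ 2 by nra.
(* The squared distance is used because the norm is not smooth at the center. [g] is at least 1 on
   the closed ball of radius b and at most 0 outside the open ball of radius a; where |y - x| < a,
   the gradient of the cutoff is at most 2 K a / (a^2 - b^2) <= 2 K / (a - b). *)
pose g := fun z : 'rV[R]_n => (a ^+ 2 - \sum_j (z 0 j - x 0 j) ^+ 2) / (a ^+ 2 - b ^+ 2).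
have gE z : g z = (a ^+ 2 - enorm (z - x) ^+ 2) / (a ^+ 2 - b ^+ 2).
  rewrite sqr_enorm; congr ((_ - _) / _); apply: eq_bigr => j _.
  by rewrite !mxE.
have oT := @openT 'rV[R]_n.
have sg : smooth_on setT g.
  apply: smooth_onM => //; last exact: smooth_on_cst.
  apply: smooth_onB => //; first exact: smooth_on_cst.
  apply: smooth_on_sum => // j.
  have sj : smooth_on [set: 'rV[R]_n] (fun z => z 0 j - x 0 j).
    by apply: smooth_onB; [|exact: smooth_on_coord|exact: smooth_on_cst].
  exact: smooth_onM.
have dg i y : is_derive y (delta_mx 0 i) g (- (2 * (y 0 i - x 0 i)) / (a ^+ 2 - b ^+ 2)).
  rewrite /g.
  have d := is_deriveB (is_derive_cst (a ^+ 2 : R) y (delta_mx 0 i)) (partial_sqdist x i y).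
  have := is_deriveM d (is_derive_cst (a ^+ 2 - b ^+ 2)^-1 y (delta_mx 0 i)).
  rewrite /GRing.scale/=; set l := (X in is_derive _ _ _ X).
  by have -> // : l = - (2 * (y 0 i - x 0 i)) / (a ^+ 2 - b ^+ 2); rewrite /l; ring.
exists (fun z => step (g z)).
have g0 y : a <= enorm (y - x) -> g y <= 0.
  move=> ay; rewrite gE mulr_le0_ge0 ?invr_ge0 ?(ltW ab)//.
  by have := enorm_ge0 (y - x); nra.
have gradE y : exists2 M : R, `|M| <= K /\ (g y <= 0 -> M = 0) &
   grad (fun z => step (g z)) y = - (2 * M / (a ^+ 2 - b ^+ 2)) *: (y - x).
  have [M MK ME] := KP g y; exists M => //.
  apply/rowP => i; have [di ei] := dg i y.
  by rewrite !mxE ME// /partial ei; field; rewrite gt_eqF.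
split.
- exact: smooth_on_step.
- by move=> y; rewrite step_ge0 step_le1.
- move=> y yb; apply: step_ge1; rewrite gE ler_pdivlMr// mul1r.
  by have := enorm_ge0 (y - x); nra.
- move=> y /g0 gy; split; first exact: step_le0.
  by have [M [_ /(_ gy) ->] ->] := gradE y; rewrite mulr0 mul0r oppr0 scale0r.
move=> y; have [M [MK M0] ->] := gradE y.
have [ay|ya] := leP a (enorm (y - x)).
  rewrite M0 ?g0// mulr0 mul0r oppr0 scale0r enorm0.
  by rewrite divr_ge0 ?mulr_ge0 ?subr_ge0// ltW.
rewrite enormZ normrN !normrM normfV (gtr0_norm ab) (ger0_norm (_ : 0 <= 2 :> R))//.
rewrite mulrAC ler_pdivrMr// subr_sqr -!mulrA.
rewrite [_^-1 * _]mulrA mulVf ?subr_eq0 ?gt_eqF// mul1r ler_pM2l//.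
by rewrite ler_pM ?enorm_ge0//; lra.
Qed.

End cutoff.

Section first_order_expansion.
Context {R : realType} {n : nat}.
Implicit Types (x y : 'rV[R]_n) (u : 'rV[R]_n -> R).

Lemma enorm_le x y : (forall i, `|x 0 i| <= `|y 0 i|) -> enorm x <= enorm y.
Proof.
move=> xy; rewrite ler_sqrt; last by rewrite sumr_ge0// => i _; rewrite sqr_ge0.
apply: ler_sum => i _; rewrite -(real_normK (num_real (x 0 i))).
by rewrite -(real_normK (num_real (y 0 i))) lerXn2r ?nnegrE.
Qed.

Lemma mean_value_partial u x (k : 'I_n) (h : R) :
  (forall t : R, 0 <= t <= 1 -> derivable u ((t * h) *: delta_mx 0 k + x) (delta_mx 0 k)) ->
  exists2 t, 0 <= t <= 1 &
    u (h *: delta_mx 0 k + x) - u x = h * partial k u ((t * h) *: delta_mx 0 k + x).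
Proof.
move=> du; pose g t := u ((t * h) *: delta_mx 0 k + x).
have dg (t : R) : 0 <= t <= 1 ->
    is_derive t 1 g (partial k u ((t * h) *: delta_mx 0 k + x) * h).
  move=> /du/derivableP dt.
  have dh : is_derive t 1 (fun s : R => s * h) h.
    have := is_deriveM (is_derive_id t (1 : R)) (is_derive_cst h t 1).
    by rewrite /GRing.scale/= mulr0 add0r mulr1.
  exact: (@is_derive_comp1 _ _ (fun s : R => s * h) _ _ _ _ _ dh (is_derive_line dt)).
have [t] : exists2 c, c \in `]0, 1[%R & g 1 - g 0 =
    (partial k u ((c * h) *: delta_mx 0 k + x) * h) * (1 - 0).
  apply: MVT => //.
    move=> t; rewrite in_itv/= => /andP[t0 t1]; apply: dg; rewrite !ltW//.
  apply: derivable_within_continuous => t; rewrite in_itv/= => t01.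
  by have [] := dg t t01.
rewrite in_itv/= => /andP[t0 t1].
rewrite /g mul1r mul0r scale0r add0r subr0 mulr1 => ->.
by exists t; [rewrite !ltW|rewrite mulrC].
Qed.

(** Continuous partial derivatives imply differentiability: y is reached from x by changing one
    coordinate at a time, and the mean value theorem treats each change. All intermediate points
    stay as close to x as y is. *)
Lemma first_order_expansion D u x e : open D -> D x -> smooth_on D u -> 0 < e ->
  exists2 d, 0 < d & forall y, enorm (y - x) < d ->
    `|u y - u x - dot (grad u x) (y - x)| <= e * enorm (y - x).
Proof.
move=> oD Dx su e0.
have e1 : 0 < e / (n%:R + 1) by rewrite divr_gt0// ltr_wpDl.
have : \forall y \near x, D y /\ forall k, `|partial k u x - partial k u y| <= e / (n%:R + 1).
  apply: filterS2 (open_nbhs_nbhs (conj oD Dx)) _; first by move=> y Dy P; split; [exact: Dy|exact: P].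
  apply: (@filter_forall _ _ _ (nbhs x)) => k.
  have [ck _] := su [:: k] x Dx.
  exact: (@cvgr_dist_le _ _ _ (nbhs x) _ _ _ ck).
move=> /nbhs_eball[d d0 dP]; exists d => // y yx.
pose z k : 'rV[R]_n := \row_i (if (i < k)%N then y 0 i else x 0 i).
have z0 : z 0%N = x by apply/rowP => i; rewrite mxE ltn0.
have zn : z n = y by apply/rowP => i; rewrite mxE ltn_ord.
have zS (k : 'I_n) : z k.+1 = (y 0 k - x 0 k) *: delta_mx 0 k + z k.
  apply/rowP => i; rewrite !mxE eqxx/= ltnS leq_eqVlt.
  have [/val_inj->|ik] /= := eqVneq (val i) (val k).
    by rewrite eqxx ltnn/= mulr1 subrK.
  by rewrite (_ : i == k = false) ?mulr0 ?add0r//; apply/negbTE; apply: contra ik => /eqP->.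
have zd (k : 'I_n) (t : R) : 0 <= t <= 1 ->
    eball x d ((t * (y 0 k - x 0 k)) *: delta_mx 0 k + z k).
  move=> /andP[t0 t1]; apply: le_lt_trans yx; apply: enorm_le => i.
  rewrite !mxE eqxx/=; have [->|ik] := eqVneq i k.
    rewrite ltnn mulr1 addrK normrM ger0_norm// ler_piMl//.
  by rewrite mulr0 add0r; case: ifP => // _; rewrite subrr normr0.
have step (k : 'I_n) :
    `|u (z k.+1) - u (z k) - partial k u x * (y 0 k - x 0 k)| <=
    e / (n%:R + 1) * enorm (y - x).
  have [t t01|t t01] := @mean_value_partial u (z k) k (y 0 k - x 0 k).
    have [Dz _] := dP _ (zd k t t01).
    by have [_] := su [::] _ Dz; exact.
  have [Dz zP] := dP _ (zd k t t01).
  rewrite -zS => ->; rewrite [X in _ - X]mulrC -mulrBr normrM mulrC.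
  rewrite ler_pM//; first by rewrite distrC.
  by have := enorm_coord (y - x) k; rewrite !mxE.
have -> : u y - u x - dot (grad u x) (y - x) =
    \sum_(k < n) (u (z k.+1) - u (z k) - partial k u x * (y 0 k - x 0 k)).
  rewrite sumrB; congr (_ - _).
    transitivity (u (z n) - u (z 0%N)); first by rewrite zn z0.
    by rewrite -(telescope_sumr (u \o z))// big_mkord.
  by apply: eq_bigr => i _; rewrite !mxE.
rewrite (le_trans (ler_norm_sum _ _ _))//.
rewrite (@le_trans _ _ (\sum_(k < n) e / (n%:R + 1) * enorm (y - x)))//.
  by apply: ler_sum.
rewrite sumr_const card_ord -[leLHS]mulr_natl mulrA ler_wpM2r ?enorm_ge0//.
by rewrite mulrA ler_pdivrMr ?ltr_wpDl// mulrC ler_pM2l// lerDl.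
Qed.

End first_order_expansion.

(** * Powers and integrals *)

Section powers.
Context {R : realType}.
Implicit Types (x y a b c p q : R) (X Y : \bar R).

Lemma powR_invK x p : 0 < p -> 0 <= x -> (x `^ p^-1) `^ p = x.
Proof. by move=> p0 x0; rewrite -powRrM mulVf ?gt_eqF// powRr1. Qed.

Lemma powRK_inv x p : 0 < p -> 0 <= x -> (x `^ p) `^ p^-1 = x.
Proof. by move=> p0 x0; rewrite -powRrM mulfV ?gt_eqF// powRr1. Qed.

Lemma powR_le x y p : 0 <= p -> 0 <= x -> x <= y -> x `^ p <= y `^ p.
Proof.
by move=> p0 x0 xy; rewrite ge0_ler_powR// nnegrE// (le_trans x0).
Qed.

Lemma powR_inv_le x y p : 0 < p -> 0 <= x -> 0 <= y ->
  (x `^ p^-1 <= y) = (x <= y `^ p).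
Proof.
move=> p0 x0 y0; apply/idP/idP => xy.
  by rewrite -(powR_invK p0 x0) powR_le ?powR_ge0// ltW.
by rewrite -(powRK_inv p0 y0) powR_le// invr_ge0 ltW.
Qed.

Lemma inve_EFin_gt0 a : 0 < a -> ((a%:E)^-1 = (a^-1)%:E)%E.
Proof. by move=> a0; rewrite inver gt_eqF. Qed.

(* The two-sided norm inequality, freed of the roots and of the value +oo. *)
Lemma norm_ineqP a b c p q X Y : 0 < a -> 0 < b -> 0 < c -> 0 < p -> 0 < q ->
  (0 <= X)%E -> (0 <= Y)%E ->
  ((((b%:E)^-1 * Y) `^ q^-1 <= c%:E * ((a%:E)^-1 * X) `^ p^-1)%E <->
   forall lam, 0 < lam -> (X <= (lam `^ p * a)%:E)%E ->
     (Y <= ((c * lam) `^ q * b)%:E)%E).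
Proof.
move=> a0 b0 c0 p0 q0 X0 Y0; rewrite !inve_EFin_gt0//; split=> [H lam lam0|H].
  move=> Xlam; have Xfin : X \is a fin_num.
    by rewrite ge0_fin_numE// (le_lt_trans Xlam)// ltry.
  move: X0 Xlam H; rewrite -(fineK Xfin) !lee_fin -EFinM => X0 Xlam.
  have Xl : (a^-1 * fine X) `^ p^-1 <= lam.
    rewrite powR_inv_le ?mulr_ge0 ?invr_ge0 ?(ltW a0) ?(ltW lam0)//.
    by rewrite ler_pdivrMl// mulrC.
  move=> H; have {}H : (((b^-1)%:E * Y) `^ q^-1 <= (c * lam)%:E)%E.
    by apply: le_trans H _; rewrite lee_fin ler_pM2l.
  have Yfin : Y \is a fin_num.
    rewrite ge0_fin_numE// ltey; apply/eqP => Yy; move: H.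
    by rewrite Yy gt0_muley ?lte_fin ?invr_gt0// poweRyr ?invr_eq0 ?gt_eqF.
  move: Y0 H; rewrite -(fineK Yfin) -EFinM poweR_EFin !lee_fin => Y0.
  rewrite powR_inv_le ?mulr_ge0 ?invr_ge0 ?(ltW b0) ?(ltW lam0) ?(ltW c0)//.
  by rewrite ler_pdivrMl// mulrC.
have [Xy|Xfin] := eqVneq X +oo%E.
  rewrite Xy gt0_muley ?lte_fin ?invr_gt0// poweRyr ?invr_eq0 ?gt_eqF//.
  by rewrite gt0_muley ?lte_fin// leey.
have {}Xfin : X \is a fin_num by rewrite ge0_fin_numE// ltey.
move: X0 H; rewrite -(fineK Xfin) lee_fin -EFinM => X0 H.
have X1 : 0 <= a^-1 * fine X by rewrite mulr_ge0 // invr_ge0 ltW.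
apply/lee_addgt0Pr => e e0.
have lam0 : 0 < (a^-1 * fine X) `^ p^-1 + e / c.
  by rewrite ltr_wpDl ?powR_ge0// divr_gt0.
have := H _ lam0; rewrite lee_fin => /(_ _)H'.
have {H'}YH : (Y <= ((c * ((a^-1 * fine X) `^ p^-1 + e / c)) `^ q * b)%:E)%E.
  apply: H'; rewrite -ler_pdivrMr// mulrC -powR_inv_le// ?(ltW lam0)//.
  by rewrite lerDl divr_ge0 ?ltW.
have Yfin : Y \is a fin_num.
  by rewrite ge0_fin_numE// (le_lt_trans YH)// ltry.
move: Y0 YH; rewrite -(fineK Yfin) -EFinM poweR_EFin -EFinD !lee_fin => Y0.
rewrite -ler_pdivrMr// mulrC -powR_inv_le//; last 2 first.
  by rewrite mulr_ge0// invr_ge0 ltW.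
  by rewrite mulr_ge0 ?(ltW c0) ?(ltW lam0).
by rewrite mulrDr [c * (e / c)]mulrCA divff ?gt_eqF// mulr1.
Qed.

Lemma powRD_le x y p : 0 <= p -> 0 <= x -> 0 <= y ->
  (x + y) `^ p <= 2 `^ p * (x `^ p + y `^ p).
Proof.
move=> p0; wlog xy : x y / x <= y => [H x0 y0|x0 y0].
  have [xy|/ltW yx] := leP x y; first exact: H.
  by rewrite addrC [X in _ * X]addrC H.
rewrite (@le_trans _ _ ((2 * y) `^ p))//.
  by rewrite powR_le ?addr_ge0//; lra.
by rewrite powRM// ler_wpM2l ?powR_ge0// lerDr powR_ge0.
Qed.

Lemma powR_le1D x p q : 0 < p -> p <= q -> 0 <= x -> x `^ p <= 1 + x `^ q.
Proof.
move=> p0 pq x0; have [x1|x1] := leP 1 x.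
  by rewrite (le_trans (ler_powR _ pq))// lerDr.
rewrite (@le_trans _ _ (1 `^ p))//; last by rewrite powR1 lerDl powR_ge0.
by rewrite powR_le// ltW.
Qed.

End powers.

Section nonneg_integrals.
Context (d : measure_display) (T : measurableType d) (R : realType).
Variable mu : {measure set T -> \bar R}.
Implicit Types (D : set T) (f g h : T -> R) (a b c p q lam : R).

Lemma le_integral_EFin D f g : measurable D ->
  measurable_fun D f -> measurable_fun D g ->
  (forall x, D x -> 0 <= f x <= g x) ->
  (\int[mu]_(x in D) (f x)%:E <= \int[mu]_(x in D) (g x)%:E)%E.
Proof.
move=> mD mf mg fg; apply: ge0_le_integral.
- exact: mD.
- by move=> x /fg /andP[].
- exact/measurable_EFinP.
- exact/measurable_EFinP.
- by move=> x /fg /andP[].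
Qed.

Lemma integral_affine D f a b : measurable D -> measurable_fun D f ->
  (forall x, D x -> 0 <= f x) -> 0 <= a -> 0 <= b ->
  (\int[mu]_(x in D) (a + b * f x)%:E =
   a%:E * mu D + b%:E * \int[mu]_(x in D) (f x)%:E)%E.
Proof.
move=> mD mf f0 a0 b0.
under eq_integral do rewrite EFinD EFinM.
rewrite ge0_integralD//; last 2 first.
- by move=> x Dx; rewrite mule_ge0// lee_fin f0.
- by apply/measurable_EFinP; apply: measurable_funM.
rewrite integral_cst// ge0_integralZl_EFin//.
exact/measurable_EFinP.
Qed.

Lemma integral_lincomb D f g a b : measurable D ->
  measurable_fun D f -> measurable_fun D g ->
  (forall x, D x -> 0 <= f x) -> (forall x, D x -> 0 <= g x) -> 0 <= a -> 0 <= b ->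
  (\int[mu]_(x in D) (a * f x + b * g x)%:E =
   a%:E * \int[mu]_(x in D) (f x)%:E + b%:E * \int[mu]_(x in D) (g x)%:E)%E.
Proof.
move=> mD mf mg f0 g0 a0 b0.
under eq_integral do rewrite EFinD !EFinM.
rewrite ge0_integralD//; last 4 first.
- by move=> x Dx; rewrite mule_ge0// lee_fin f0.
- by apply/measurable_EFinP; apply: measurable_funM.
- by move=> x Dx; rewrite mule_ge0// lee_fin g0.
- by apply/measurable_EFinP; apply: measurable_funM.
rewrite !ge0_integralZl_EFin//; exact/measurable_EFinP.
Qed.

Lemma measurable_fun_normB D f c : measurable_fun D f ->
  measurable_fun D (fun y => `|f y - c|).
Proof. by move=> mf; apply: measurableT_comp => //; exact: measurable_funB. Qed.

Lemma measurable_fun_powR D f p : measurable_fun D f ->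
  measurable_fun D (fun y => f y `^ p).
Proof. by move=> mf; apply: (measurableT_comp (measurable_powR p)). Qed.

Lemma le_integral_affine D f g a b : measurable D -> measurable_fun D f ->
  measurable_fun D g -> 0 <= a -> 0 <= b ->
  (forall x, D x -> 0 <= f x) ->
  (forall x, D x -> 0 <= g x <= a + b * f x) ->
  (\int[mu]_(x in D) (g x)%:E <= a%:E * mu D + b%:E * \int[mu]_(x in D) (f x)%:E)%E.
Proof.
move=> mD mf mg a0 b0 f0 fg; rewrite -integral_affine//.
by apply: le_integral_EFin => //; apply: measurable_funD => //; apply: measurable_funM.
Qed.

Lemma le_integral_lincomb D f g h a b : measurable D -> measurable_fun D f ->
  measurable_fun D g -> measurable_fun D h -> 0 <= a -> 0 <= b ->
  (forall x, D x -> 0 <= f x) -> (forall x, D x -> 0 <= g x) ->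
  (forall x, D x -> 0 <= h x <= a * f x + b * g x) ->
  (\int[mu]_(x in D) (h x)%:E <=
   a%:E * \int[mu]_(x in D) (f x)%:E + b%:E * \int[mu]_(x in D) (g x)%:E)%E.
Proof.
move=> mD mf mg mh a0 b0 f0 g0 fg; rewrite -integral_lincomb//.
apply: le_integral_EFin => //; apply: measurable_funD.
  exact: measurable_funM.
exact: measurable_funM.
Qed.

(** Hölder's inequality up to a factor 2: t^p <= 1 + t^q is applied to t = f y / lam and
    integrated. *)
Lemma integral_powR_exponent_le D f p q lam m :
  measurable D -> mu D = m%:E -> measurable_fun D f ->
  (forall y, D y -> 0 <= f y) -> 0 < p -> p <= q -> 0 < lam ->
  (\int[mu]_(y in D) (f y `^ q)%:E <= (lam `^ q * m)%:E)%E ->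
  (\int[mu]_(y in D) (f y `^ p)%:E <= (2 * lam `^ p * m)%:E)%E.
Proof.
move=> mD mDm mf f0 p0 pq lam0 H.
apply: (@le_trans _ _ ((lam `^ p)%:E * mu D +
  (lam `^ (p - q))%:E * \int[mu]_(y in D) (f y `^ q)%:E)%E).
  apply: le_integral_affine; [by []| | |exact: powR_ge0|exact: powR_ge0| |].
  - exact: measurable_fun_powR.
  - exact: measurable_fun_powR.
  - by move=> y _; exact: powR_ge0.
  - move=> y By; rewrite powR_ge0/=.
    have [t t0 ->] : exists2 t, 0 <= t & f y = t * lam.
      by exists (f y / lam); [rewrite divr_ge0 ?f0// ltW|rewrite divfK// gt_eqF].
    have := powR_le1D p0 pq t0; rewrite !powRM ?(ltW lam0)//.
    have -> : lam `^ (p - q) * (t `^ q * lam `^ q) = t `^ q * lam `^ p.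
      by rewrite mulrCA -powRD ?subrK// (gt_eqF lam0) implybT.
    by have := powR_gt0 p lam0; nra.
rewrite mDm (@le_trans _ _ ((lam `^ p)%:E * m%:E +
    (lam `^ (p - q))%:E * (lam `^ q * m)%:E)%E)//.
  by rewrite leeD2l// lee_wpmul2l// lee_fin powR_ge0.
rewrite -!EFinM -EFinD lee_fin [_ `^ (p - q) * _]mulrA -powRD; last first.
  by rewrite (gt_eqF lam0) implybT.
by rewrite subrK -mulrDl mulr_natl mulr2n.
Qed.

End nonneg_integrals.

Section mean_value.
Context (d : measure_display) (T : measurableType d) (R : realType).
Variables (mu : {measure set T -> \bar R}) (D : set T) (m : R).
Hypotheses (mD : measurable D) (m_gt0 : 0 < m) (mDm : mu D = m%:E).
Implicit Types (f : T -> R) (a c q lam M : R).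

(** Convertible to [mean] for a measure on R^n, so that the lemmas of this section, valid on any
    measure space, apply to [mean] directly. *)
Definition average f : R := fine ((mu D)^-1 * \int[mu]_(x in D) (EFin \o f) x)%E.

Lemma bounded_integrable f M : measurable_fun D f ->
  (forall y, D y -> `|f y| <= M) -> mu.-integrable D (EFin \o f).
Proof.
move=> mf fM; apply: measurable_bounded_integrable => //; first by rewrite mDm ltry.
exists M; split; first exact: num_real.
by move=> N /ltW MN y /= yB; apply: le_trans MN; exact: fM.
Qed.

Lemma average_mass f : mu.-integrable D (EFin \o f) ->
  (average f * m)%:E = (\int[mu]_(y in D) (f y)%:E)%E.
Proof.
move=> fi; have mf := integrable_fin_num mD fi.
rewrite /average mDm inve_EFin_gt0// -(fineK mf)/= mulrAC mulVf ?mul1r//.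
by rewrite gt_eqF.
Qed.

Lemma average_dev f c : mu.-integrable D (EFin \o f) ->
  ((`|average f - c| * m)%:E <= \int[mu]_(y in D) (`|f y - c|)%:E)%E.
Proof.
move=> fi.
have ci : mu.-integrable D (EFin \o cst c) by apply: (@bounded_integrable _ `|c|).
have fci : mu.-integrable D (EFin \o (fun y => f y - c)).
  exact: (integrableB mD fi ci).
have -> : ((`|average f - c| * m)%:E = `| \int[mu]_(y in D) ((f y - c)%:E) |)%E.
  under eq_integral do rewrite EFinB.
  rewrite integralB_EFin// -average_mass// integral_cst// mDm -EFinM -EFinB.
  by rewrite -mulrBl abse_EFin normrM (gtr0_norm m_gt0).
by apply: le_abse_integral => //; exact: measurable_int fci.
Qed.

Lemma average_near f a q lam : mu.-integrable D (EFin \o f) ->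
  1 <= q -> 0 < lam ->
  (\int[mu]_(y in D) (`|f y - a| `^ q)%:E <= (lam `^ q * m)%:E)%E ->
  `|average f - a| <= 2 * lam.
Proof.
move=> fi q1 lam0 H.
have mf : measurable_fun D f by apply/measurable_EFinP/measurable_int/fi.
have := integral_powR_exponent_le mD mDm (measurable_fun_normB a mf)
  (fun _ _ => normr_ge0 _) ltr01 q1 lam0 H.
under eq_integral do rewrite powRr1//.
move=> /(le_trans (average_dev a fi)); rewrite lee_fin ler_pM2r// powRr1//.
exact: ltW.
Qed.

(** An estimate around any constant a passes to the mean, since the mean is within 2 * lam of a. The
    8 comes from 2^q * ((2 lam)^q + lam^q) <= (8 lam)^q, which holds because 2^q >= 2. *)
Lemma average_deviation f a q lam : mu.-integrable D (EFin \o f) ->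
  1 <= q -> 0 < lam ->
  (\int[mu]_(y in D) (`|f y - a| `^ q)%:E <= (lam `^ q * m)%:E)%E ->
  (\int[mu]_(y in D) (`|f y - average f| `^ q)%:E <=
    ((8 * lam) `^ q * m)%:E)%E.
Proof.
move=> fi q1 lam0 H.
have q0 : 0 < q by exact: lt_le_trans q1.
have mf : measurable_fun D f by apply/measurable_EFinP/measurable_int/fi.
have ma := average_near fi q1 lam0 H.
set M := average f in ma *.
apply: (@le_trans _ _ ((2 `^ q * (2 * lam) `^ q)%:E * mu D +
  (2 `^ q)%:E * \int[mu]_(y in D) (`|f y - a| `^ q)%:E)%E).
  apply: le_integral_affine; [by []| | | |exact: powR_ge0| |].
  - exact/measurable_fun_powR/measurable_fun_normB.
  - exact/measurable_fun_powR/measurable_fun_normB.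
  - by rewrite mulr_ge0 ?powR_ge0.
  - by move=> y _; exact: powR_ge0.
  - move=> y By; rewrite powR_ge0/= -mulrDr.
    apply: (@le_trans _ _ ((2 * lam + `|f y - a|) `^ q)); last first.
      by rewrite powRD_le ?(ltW q0)// mulr_ge0// ltW.
    rewrite powR_le ?(ltW q0)// -[f y - M](subrKA a).
    by rewrite (le_trans (ler_normD _ _))// addrC lerD2r distrC.
rewrite mDm (@le_trans _ _ ((2 `^ q * (2 * lam) `^ q)%:E * m%:E +
    (2 `^ q)%:E * (lam `^ q * m)%:E)%E)//.
  by rewrite leeD2l// lee_wpmul2l// lee_fin powR_ge0.
rewrite -!EFinM -EFinD lee_fin [2 `^ q * (_ `^ q * _)]mulrA -mulrDl ler_pM2r//.
rewrite (_ : 8 = 2 * 2 * 2 :> R); last by ring.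
rewrite !powRM ?(ltW lam0)//.
have q2 : 2 <= 2 `^ q :> R by apply: le1r_powR => //; rewrite ler1n.
have l0 := powR_ge0 lam q.
move: q2 l0; set t := 2 `^ q; set L := lam `^ q => t2 L0.
have t0 : 0 <= t by apply: le_trans t2.
have tL0 : 0 <= t * L by exact: mulr_ge0.
have : 0 <= (t - 2) * (t * (t * L)) by rewrite !mulr_ge0// subr_ge0.
have : 0 <= (t - 1) * (t * L) by rewrite mulr_ge0// subr_ge0 (le_trans _ t2)// ler1n.
lra.
Qed.

End mean_value.

(** * Lebesgue measurability *)

Section lebesgue_measurability.
Context {R : realType} {n : nat}.
Implicit Types (x : 'rV[R]_n) (A D : set 'rV[R]_n).

Lemma measurable_row_of_tuple A :
  measurable (@row_of_tuple R n @^-1` A) -> measurable A.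
Proof.
move=> mA; suff : (@lebesgue_outer R n).-caratheodory A by [].
move=> X; exact: (caratheodory_measurable_mu_ext (lebesgue_tuple R n) mA).
Qed.

Lemma measurable_coord (i : 'I_n) :
  measurable_fun [set: 'rV[R]_n] (fun x => x 0 i).
Proof.
move=> _ Y mY; rewrite setTI; apply: measurable_row_of_tuple.
have := measurable_tnth i (T := measurableTypeR R) measurableT mY.
rewrite setTI; congr measurable; apply/seteqP.
by split => t; rewrite /preimage/= mxE.
Qed.

(** A is the union of the boxes with rational center and half-width that it contains; any other box
    is replaced by the empty set, so that the union runs over a countable type. *)
Lemma open_measurable_rV A : open A -> measurable A.
Proof.
move=> oA.
pose box (c : 'rV[rat]_n * rat) : set 'rV[R]_n :=
  \bigcap_(i in [set: 'I_n]) [set y | `|y 0 i - ratr (c.1 0 i)| < ratr c.2].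
pose F c := if `[< box c `<=` A >] then box c else set0.
have mbox c : measurable (box c).
  apply: fin_bigcap_measurable => // i _.
  have mi : measurable_fun [set: 'rV[R]_n] (fun y => `|y 0 i - ratr (c.1 0 i)|).
    exact: measurable_fun_normB (measurable_coord i).
  by have := mi measurableT _ (measurable_itv `]-oo, (ratr c.2 : R)[); rewrite setTI.
have -> : A = \bigcup_c F c.
  apply/seteqP; split => [x Ax|x [c _]]; last first.
    by rewrite /F; case: asboolP => // + Fx; exact.
  have [r r0 rA] := nbhs_eball (open_nbhs_nbhs (conj oA Ax)).
  (* Two points of a box of half-width below d differ by less than 2 d in each coordinate, hence by
     at most n * 2 d < r in norm. The summand 1 covers n = 0. *)
  pose d := r / (2 * (n%:R + 1)).
  have n1 : 0 < n%:R + 1 :> R by rewrite ltr_wpDl.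
  have d0 : 0 < d by rewrite divr_gt0// mulr_gt0.
  have [e] := rat_in_itvoo d0; rewrite in_itv/= => /andP[e0 ed].
  have /choice[q qP] : forall i, exists q : rat, x 0 i - ratr e < ratr q < x 0 i.
    move=> i; have /rat_in_itvoo[q] : x 0 i - ratr e < x 0 i.
      by rewrite ltrBlDr ltrDl.
    by rewrite in_itv/= => qi; exists q.
  have bx : box (\row_i q i, e) x.
    move=> i _ /=; rewrite mxE ltr_norml; have := qP i; lra.
  exists (\row_i q i, e) => //; rewrite /F; case: asboolP => // -[] y yb.
  apply: rA; apply: le_lt_trans (enorm_le_sum _) _.
  apply: (@le_lt_trans _ _ (\sum_(i < n) 2 * d)).
    apply: ler_sum => i _; have := yb i Logic.I; have := bx i Logic.I.
    rewrite /= !mxE distrC => xi yi.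
    by rewrite (le_trans (ler_distD (ratr (q i)) _ _))//; lra.
  rewrite sumr_const card_ord -[ltLHS]mulr_natl /d.
  rewrite [2 * _](_ : _ = r / (n%:R + 1)); last by field; rewrite gt_eqF.
  by rewrite mulrA ltr_pdivrMr// mulrC ltr_pM2l// ltrDl.
apply: countable_bigcupT_measurable => [|c]; first exact: countableP.
by rewrite /F; case: ifP.
Qed.

Lemma measurable_eball x r : measurable (eball x r).
Proof. exact/open_measurable_rV/open_eball. Qed.

Lemma continuous_on_measurable_fun D (u : 'rV[R]_n -> R) : open D ->
  (forall x, D x -> {for x, continuous u}) -> measurable_fun D u.
Proof.
move=> oD cu mD; apply: (measurability _ (RGenOpens.measurableE R)) => //.
move=> _ [_ [a [b ->] <-]]; apply: open_measurable_rV.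
rewrite openE => x [Dx /= xab].
apply: filterI; first exact: open_nbhs_nbhs.
by apply: (cu x Dx); apply: open_nbhs_nbhs; split => //; exact: interval_open.
Qed.

Lemma smooth_on_measurable_fun D (u : 'rV[R]_n -> R) : open D ->
  smooth_on D u -> measurable_fun D u.
Proof.
by move=> oD su; apply: continuous_on_measurable_fun => // x /(su [::])[].
Qed.

Lemma measurable_fun_enorm (d : measure_display) (T : measurableType d) (D : set T) (f : T -> 'rV[R]_n) :
  (forall i, measurable_fun D (fun t => f t 0 i)) ->
  measurable_fun D (fun t => enorm (f t)).
Proof.
move=> mf; have ms : measurable_fun [set: R] (@Num.sqrt R).
  by apply: continuous_measurable_fun => x; exact: sqrt_continuous.
apply: (measurableT_comp ms).
by apply: measurable_sum => i; exact: measurable_funX.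
Qed.

End lebesgue_measurability.

(** The center is a sequence and not a tuple, so that induction on n can pass to [c \o succn]. *)
Definition tuple_box (R : realType) n (c : nat -> R) (d : R) :=
  [set t : n.-tuple (measurableTypeR R) | forall i : 'I_n, `|tnth t i - c i| < d].

Lemma measurable_tuple_box (R : realType) n (c : nat -> R) (d : R) :
  measurable (@tuple_box R n c d).
Proof.
rewrite (_ : tuple_box _ _ = \bigcap_(i in [set: 'I_n])
    [set t : n.-tuple (measurableTypeR R) | `|tnth t i - c i| < d]).
  apply: fin_bigcap_measurable => // i _.
  have mi : measurable_fun [set: n.-tuple (measurableTypeR R)] (fun t => `|tnth t i - c i| : R).
    exact: measurable_fun_normB (measurable_tnth i).
  by have := mi measurableT _ (measurable_itv `]-oo, d[); rewrite setTI.
by apply/seteqP; split => t tB i; [move=> _; exact: tB|exact: tB].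
Qed.

Lemma lebesgue_tuple_box_gt0 (R : realType) n (c : nat -> R) (d : R) : 0 < d ->
  (0 < lebesgue_tuple R n (tuple_box c d))%E.
Proof.
move=> d0; elim: n c => [|n IH] c.
  by rewrite /= diracE mem_set ?lte01//= => -[].
rewrite /= /lebesgue_tcons /pushforward.
rewrite (_ : _ @^-1` _ = `]c 0%N - d, c 0%N + d[%classic `*` tuple_box (c \o succn) d).
  rewrite product_measure1E//; last exact: measurable_tuple_box.
  have l0 : (0 < lebesgue_measure [set` `](c 0%N - d)%R, (c 0%N + d)%R[])%E.
    by rewrite lebesgue_measure_itv/= lte_fin ifT; [rewrite -EFinB lte_fin; lra|lra].
  by apply: mule_gt0; [exact: l0|exact: IH].
apply/seteqP; split => -[y t] /=.
  move=> tB; split => /=.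
    by have := tB ord0; rewrite (tnth_nth 0)/= in_itv/= ltr_norml; lra.
  by move=> i; have := tB (lift ord0 i); rewrite !(tnth_nth 0).
rewrite in_itv/= => -[/= yc tB] i; rewrite (tnth_nth 0); case: i => -[|i] ilt /=.
  by rewrite ltr_norml; lra.
by have := tB (Ordinal (ilt : (i < n)%N)); rewrite (tnth_nth 0).
Qed.

Lemma lebesgue_eball_gt0 (R : realType) n (x : 'rV[R]_n) (r : R) : 0 < r ->
  (0 < lebesgue_rV (eball x r))%E.
Proof.
move=> r0; pose d := r / (n%:R + 1).
have n1 : 0 < n%:R + 1 :> R by rewrite ltr_wpDl.
have d0 : 0 < d by rewrite divr_gt0.
pose c i := if insub i is Some j then x 0 j else 0 : R.
apply: lt_le_trans (lebesgue_tuple_box_gt0 n c d0) _.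
rewrite -(measurable_mu_extE (lebesgue_tuple R n) (measurable_tuple_box c d)).
apply: le_mu_ext => t tB; rewrite /preimage/= /eball/=.
apply: le_lt_trans (enorm_le_sum _) _.
apply: (@le_lt_trans _ _ (\sum_(i < n) d)).
  by apply: ler_sum => i _; rewrite !mxE; have := tB i; rewrite /c valK => /ltW.
rewrite sumr_const card_ord -[ltLHS]mulr_natl /d.
by rewrite mulrA ltr_pdivrMr// mulrC ltr_pM2l// ltrDl.
Qed.

(** * Mass of balls and averages *)

Section ball_mass.
Context {R : realType} {n : nat}.
Variable mu : {measure set 'rV[R]_n -> \bar R}.
Hypothesis mu_gt0 : forall (x : 'rV[R]_n) (r : R), 0 < r -> (0 < mu (eball x r))%E.
Hypothesis mu_fin : forall (x : 'rV[R]_n) (r : R), (mu (eball x r) < +oo)%E.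
Implicit Types (x y z : 'rV[R]_n) (r s C : R).

Definition mass x r : R := fine (mu (eball x r)).

Lemma massE x r : mu (eball x r) = (mass x r)%:E.
Proof. by rewrite fineK// ge0_fin_numE. Qed.

Lemma mass_gt0 x r : 0 < r -> 0 < mass x r.
Proof. by move=> r0; rewrite -lte_fin -massE mu_gt0. Qed.

Lemma mass_le x y r s : eball x r `<=` eball y s -> mass x r <= mass y s.
Proof.
move=> rs; rewrite -lee_fin -!massE.
by apply: le_measure rs; rewrite inE; exact: measurable_eball.
Qed.

Lemma doublingP : doubling mu <-> exists2 C : R, 0 < C &
  forall x r, 0 < r -> mass x (2 * r) <= C * mass x r.
Proof.
split=> -[C C0 CP]; exists C => // x r r0; have := CP x r r0.
  by rewrite !massE -EFinM lee_fin.
by rewrite !massE -EFinM lee_fin.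
Qed.

(** Take k with L <= 2^k. Then k doublings lead from radius s to radius 2^k * s, and the ball at y
    of that radius contains the ball at x. *)
Lemma mass_comparable C : 0 < C ->
  (forall x r, 0 < r -> mass x (2 * r) <= C * mass x r) ->
  forall L : R, exists2 K : R, 0 < K & forall x y r s, 0 < s ->
    enorm (x - y) + r <= L * s -> mass x r <= K * mass y s.
Proof.
move=> C0 dbl L; pose k := (Num.truncn L).+1.
have Lk : L <= 2 ^+ k.
  apply: le_trans (ltW (truncnS_gt L)) _; rewrite -natrX ler_nat.
  exact/ltnW/ltn_expl.
have iter y s j : 0 < s -> mass y (2 ^+ j * s) <= C ^+ j * mass y s.
  move=> s0; elim: j => [|j IH]; first by rewrite !expr0 !mul1r.
  rewrite !exprS -!mulrA (le_trans (dbl _ _ _)) ?mulr_gt0 ?exprn_gt0//.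
  by rewrite ler_pM2l.
exists (C ^+ k) => [|x y r s s0 xr]; first by rewrite exprn_gt0.
apply: le_trans (iter _ _ _ s0); apply/mass_le/subset_eball.
by rewrite (le_trans xr)// ler_pM2r.
Qed.

End ball_mass.

(** [G x] dominates the mean of g over every ball of radius s whose center is within s of x. The
    supremum over all radii, which is a maximal function, would not be bounded on L^1; here s is
    fixed, and what matters is that K does not depend on it. *)
Definition averaging_bound {R : realType} {n : nat}
    (mu : {measure set 'rV[R]_n -> \bar R}) (K : R) :=
  forall (g : 'rV[R]_n -> \bar R) (s : R), 0 < s ->
  measurable_fun [set: 'rV[R]_n] g -> (forall x, 0 <= g x)%E ->
  exists G : 'rV[R]_n -> \bar R,
  [/\ measurable_fun [set: 'rV[R]_n] G, (forall x, 0 <= G x)%E,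
     (\int[mu]_x G x <= K%:E * \int[mu]_x g x)%E &
     forall x z, enorm (z - x) <= s ->
       (\int[mu]_(y in eball z s) g y <= (mass mu z s)%:E * G x)%E].

Section averaging.
Context {R : realType} {n : nat}.
Variable nu : {sigma_finite_measure set 'rV[R]_n -> \bar R}.
Let mu : {measure set 'rV[R]_n -> \bar R} := nu.
Hypothesis mu_gt0 : forall (x : 'rV[R]_n) (r : R), 0 < r -> (0 < mu (eball x r))%E.
Hypothesis mu_fin : forall (x : 'rV[R]_n) (r : R), (mu (eball x r) < +oo)%E.
Implicit Types (x y z : 'rV[R]_n) (r s : R).

Let near_diag s : set ('rV[R]_n * 'rV[R]_n) := [set z | enorm (z.2 - z.1) < s].

Lemma measurable_near_diag s : measurable (near_diag s).
Proof.
have mf : measurable_fun [set: 'rV[R]_n * 'rV[R]_n] (fun z : 'rV[R]_n * 'rV[R]_n => enorm (z.2 - z.1)).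
  apply: measurable_fun_enorm => i.
  rewrite (_ : (fun _ => _) = fun t : 'rV[R]_n * 'rV[R]_n => t.2 0 i - t.1 0 i); last first.
    by apply/funext => t; rewrite !mxE.
  apply: measurable_funB.
    exact: (measurableT_comp (measurable_coord i) measurable_snd).
  exact: (measurableT_comp (measurable_coord i) measurable_fst).
by have := mf measurableT _ (measurable_itv `]-oo, s[); rewrite setTI.
Qed.

Lemma measurable_mass s : measurable_fun setT (mass mu ^~ s).
Proof.
apply/measurable_EFinP.
have H := @measurable_fun_xsection _ _ _ _ _ nu _ (measurable_near_diag s).
apply: eq_measurable_fun H => x _ /=; rewrite -massE//.
by congr (nu _); apply/seteqP; split => y; rewrite /xsection/= inE.
Qed.

(** [G x] is the integral of C * g y / mass y s over |y - x| < 2 s. As the weight sits at y,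
    Tonelli's theorem leaves g y times C * mass y (2 s) / mass y s <= C * C. If y is in B(z, s),
    then B(z, s) lies in B(y, 2 s), so mass z s <= C * mass y s and the weight is at least 1 / mass
    z s. *)
Lemma doubling_averaging (C : R) : 0 < C ->
  (forall x r, 0 < r -> mass mu x (2 * r) <= C * mass mu x r) ->
  averaging_bound mu (C * C).
Proof.
move=> C0 dbl g s s0 mg g0.
pose h y := ((C / mass mu y s)%:E * g y)%E.
have h0 y : (0 <= h y)%E.
  by rewrite mule_ge0// lee_fin divr_ge0 ?(ltW C0)// ltW// mass_gt0.
have mh : measurable_fun setT h.
  apply: emeasurable_funM; last exact: mg.
  apply/measurable_EFinP; apply: measurable_funM; first exact: measurable_cst.
  rewrite (_ : (fun _ => _) = fun y => mass mu y s `^ (-1)); last first.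
    by apply/funext => y; rewrite powR_inv1// ltW// mass_gt0.
  exact/measurable_fun_powR/measurable_mass.
pose F (z : 'rV[R]_n * 'rV[R]_n) := ((\1_(near_diag (2 * s)) z)%:E * h z.2)%E.
have F0 ab : (0 <= F ab)%E by rewrite mule_ge0// lee_fin.
have mF : measurable_fun setT F.
  apply: emeasurable_funM.
    by apply/measurable_EFinP; apply: measurable_indic; exact: measurable_near_diag.
  exact: (measurableT_comp mh measurable_snd).
exists (fubini_F nu F); split.
- exact: (measurable_fun_fubini_tonelli_F F mF F0).
- by move=> x; apply: integral_ge0.
- rewrite [leLHS](fubini_tonelli F mF F0).
  rewrite -ge0_integralZl_EFin; [|exact: measurableT|by move=> y _; exact: g0|exact: mg|exact/ltW/mulr_gt0].
  apply: ge0_le_integral; [exact: measurableT| | | |].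
  + by move=> y _; apply: integral_ge0.
  + exact: (measurable_fun_fubini_tonelli_G F mF F0).
  + by apply: emeasurable_funM; [exact: measurable_cst|exact: mg].
  move=> y _.
  have -> : (\int[nu]_x F (x, y) = (mass mu y (2 * s))%:E * h y)%E.
    rewrite (eq_integral (fun x => (\1_(eball y (2 * s)) x)%:E * h y)%E); last first.
      move=> x _; congr (_%:E * _)%E; rewrite !indicE; congr (nat_of_bool _)%:R.
      by apply/idP/idP; rewrite !inE /near_diag /eball/= enormB.
    rewrite ge0_integralZr; [|exact: measurableT| | |exact: h0].
    - rewrite integral_indic; [|exact: measurableT|exact: measurable_eball].
      by rewrite setIT -massE.
    - apply/measurable_EFinP; apply: measurable_indic; exact: measurable_eball.
    - by move=> x _; rewrite lee_fin.
  rewrite /h muleA -EFinM; apply: lee_wpmul2r; first exact: g0.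
  rewrite lee_fin mulrCA ler_pM2l// ler_pdivrMr ?mass_gt0//.
  exact: dbl.
move=> x z zx.
have mB := measurable_eball z s.
have mGx : measurable_fun setT (fun y => F (x, y)).
  exact: (measurableT_comp mF (measurable_pair1 _)).
have F0' y : (0 <= F (x, y))%E by [].
rewrite /fubini_F -ge0_integralZl_EFin; [|exact: measurableT|by move=> y _; exact: F0'|exact: mGx|exact/ltW/mass_gt0].
apply: (@le_trans _ _ (\int[mu]_(y in eball z s) ((mass mu z s)%:E * F (x, y)))%E); last first.
  apply: ge0_subset_integral; [exact: mB|exact: measurableT| | |exact: subsetT].
  - by apply: emeasurable_funM; [exact: measurable_cst|exact: mGx].
  - by move=> y _; rewrite mule_ge0// lee_fin ltW// mass_gt0.
apply: ge0_le_integral; [exact: mB|by move=> y _; exact: g0|exact: measurable_funTS|  | ].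
  by apply: measurable_funTS; apply: emeasurable_funM; [exact: measurable_cst|exact: mGx].
move=> y yz; rewrite /F/= indicE mem_set; last first.
  rewrite /near_diag/= (le_lt_trans (enorm_triangle z _ _))// mulr_natl mulr2n.
  exact: ltr_leD.
rewrite mul1e /h muleA -EFinM; apply: lee_pemull; first exact: g0.
rewrite lee_fin mulrA ler_pdivlMr ?mass_gt0// mul1r mulrC.
apply: le_trans (dbl _ _ s0); apply/(mass_le mu_fin)/subset_eball.
by have := ltW yz; lra.
Qed.

End averaging.

(** * Doubling *)

Lemma powRX (R : realType) (x s : R) j : 0 <= x -> (x ^+ j) `^ s = (x `^ s) ^+ j.
Proof.
move=> x0; rewrite -(powR_mulrn j x0) -(powR_mulrn j (powR_ge0 x s)).
exact: powRAC.
Qed.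

(** Fast geometric convergence, as in De Giorgi's iteration. [tau] solves b * tau^(g - 1) = 1, so
    that the decay absorbs the growth of b^j, and H * eps^(g - 1) <= tau closes the induction.
    Having eps <= 1/2 keeps every [a j] in the range where the recursion is assumed. *)
Lemma iteration_small (R : realType) (H b g : R) : 0 < H -> 1 < b -> 1 < g ->
  exists eps tau : R, [/\ 0 < eps, eps <= 2^-1, 0 < tau < 1 &
    forall a : nat -> R, (forall j, 0 <= a j) ->
      (forall j, a j <= 2^-1 -> a j.+1 <= H * b ^+ j * a j `^ g) ->
      a 0%N <= eps -> forall j, a j <= eps * tau ^+ j].
Proof.
move=> H0 b1 g1.
have b0 : 0 < b by exact: lt_trans b1.
have g10 : 0 < g - 1 by rewrite subr_gt0.
have [tau [tau0 tau1 bt]] : exists tau : R, [/\ 0 < tau, tau < 1 & b * tau `^ (g - 1) = 1].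
  exists (b `^ (- (g - 1)^-1)); split; first exact: powR_gt0.
    rewrite powRN invf_lt1 ?powR_gt0//.
    rewrite -[ltLHS](powRr0 b) /powR gt_eqF// ltr_expR mul0r.
    by rewrite mulr_gt0 ?invr_gt0// ln_gt0.
  by rewrite -powRrM mulNr mulVf ?gt_eqF// powR_inv1 ?ltW// divff// gt_eqF.
have [eps [eps0 eps2 Heps]] : exists eps : R,
    [/\ 0 < eps, eps <= 2^-1 & H * eps `^ (g - 1) <= tau].
  exists (Num.min 2^-1 ((tau / H) `^ (g - 1)^-1)).
  have eps0 : 0 < Num.min 2^-1 ((tau / H) `^ (g - 1)^-1).
    by rewrite lt_min invr_gt0 ltr0n/= powR_gt0// divr_gt0.
  split => //; first by rewrite ge_min lexx.
  rewrite mulrC -ler_pdivlMr// -[leRHS](@powR_invK _ _ (g - 1))//; last first.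
    by rewrite divr_ge0// ltW.
  by rewrite powR_le ?(ltW g10) ?(ltW eps0)// ge_min lexx orbT.
exists eps, tau; split; [by []|by []|by rewrite tau0|].
move=> a a0 aS a0e; elim=> [|j IH]; first by rewrite expr0 mulr1.
have tj : 0 < tau ^+ j by rewrite exprn_gt0.
have etj : 0 < eps * tau ^+ j by rewrite mulr_gt0.
have aj2 : a j <= 2^-1.
  rewrite (le_trans IH)// (@le_trans _ _ (eps * 1))//.
    by rewrite ler_pM2l// exprn_ile1// ltW.
  by rewrite mulr1.
apply: le_trans (aS j aj2) _.
apply: (@le_trans _ _ (H * b ^+ j * (eps * tau ^+ j) `^ g)).
  by rewrite ler_pM2l ?mulr_gt0 ?exprn_gt0// powR_le// (le_trans _ (ltW g1)).
have -> : (eps * tau ^+ j) `^ g = eps * tau ^+ j * (eps `^ (g - 1) * (tau `^ (g - 1)) ^+ j).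
  have -> : (eps * tau ^+ j) `^ g = (eps * tau ^+ j) `^ (g - 1) * (eps * tau ^+ j).
    by rewrite [RHS]mulrC mulr_powRB1 ?(ltW etj)// (lt_trans _ g1).
  rewrite [LHS]mulrC; congr (_ * _).
  rewrite powRM ?(ltW eps0) ?(ltW tj)//; congr (_ * _).
  exact/powRX/ltW.
rewrite exprSr [leRHS]mulrA.
have -> : H * b ^+ j * (eps * tau ^+ j * (eps `^ (g - 1) * (tau `^ (g - 1)) ^+ j)) =
    eps * tau ^+ j * (H * eps `^ (g - 1) * (b * tau `^ (g - 1)) ^+ j).
  by rewrite exprMn; ring.
by rewrite bt expr1n mulr1 ler_pM2l.
Qed.

Section grad_measurable.
Context {R : realType} {n : nat}.
Implicit Types (D : set 'rV[R]_n) (u : 'rV[R]_n -> R).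

Lemma measurable_grad D u i : open D -> smooth_on D u ->
  measurable_fun D (fun y => grad u y 0 i).
Proof.
move=> oD su; rewrite (_ : (fun _ => _) = partial i u); last first.
  by apply/funext => y; rewrite mxE.
by apply: continuous_on_measurable_fun => // x /(su [:: i])[].
Qed.

Lemma measurable_enorm_grad D u p : open D -> smooth_on D u ->
  measurable_fun D (fun y => enorm (grad u y) `^ p).
Proof.
move=> oD su; apply/measurable_fun_powR/measurable_fun_enorm => i.
exact: measurable_grad.
Qed.

End grad_measurable.

Lemma integral_supported (d : measure_display) (T : measurableType d) (R : realType)
    (mu : {measure set T -> \bar R}) (A D : set T) (h : T -> R) (M : R) :
  measurable A -> measurable D -> A `<=` D -> measurable_fun D h -> 0 <= M ->
  (forall y, D y -> 0 <= h y) -> (forall y, A y -> h y <= M) ->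
  (forall y, ~ A y -> h y = 0) ->
  (\int[mu]_(y in D) (h y)%:E <= M%:E * mu A)%E.
Proof.
move=> mA mD AD mh M0 h0 hM hA.
apply: (@le_trans _ _ (\int[mu]_(y in D) (M * \1_A y)%:E)%E).
  apply: le_integral_EFin => //.
    by apply: measurable_funM => //; exact: measurable_indic.
  move=> y Dy; rewrite h0//= indicE.
  have [/set_mem Ay|/negP Ay] := boolP (y \in A); first by rewrite mulr1 hM.
  by rewrite mulr0 hA// => /mem_set.
under eq_integral do rewrite EFinM.
have mI : measurable_fun D (fun y => (\1_A y : R)%:E).
  by apply/measurable_EFinP; exact: measurable_indic.
by rewrite ge0_integralZl_EFin// integral_indic// setIidl.
Qed.

Section poincare_doubling.
Context {R : realType} {n : nat}.
Variable mu : {measure set 'rV[R]_n -> \bar R}.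
Hypothesis mu_gt0 : forall (x : 'rV[R]_n) (r : R), 0 < r -> (0 < mu (eball x r))%E.
Hypothesis mu_fin : forall (x : 'rV[R]_n) (r : R), (mu (eball x r) < +oo)%E.
Implicit Types (x y z : 'rV[R]_n) (r s lam : R) (u : 'rV[R]_n -> R).

(** [norm_ineqP] on every ball. All later arguments use or prove the inequality in this form. *)
Lemma sobolev_poincareP p q C sigma : 0 < p -> 0 < q -> 0 < C -> 0 < sigma ->
  sobolev_poincare_ineq p q C sigma mu <->
  forall x r u, 0 < r -> smooth_on (eball x (sigma * r)) u ->
    mu.-integrable (eball x r) (EFin \o u) ->
    forall lam, 0 < lam ->
    (\int[mu]_(y in eball x (sigma * r)) (enorm (grad u y) `^ p)%:E <=
      (lam `^ p * mass mu x (sigma * r))%:E)%E ->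
    (\int[mu]_(y in eball x r) (`|u y - mean mu (eball x r) u| `^ q)%:E <=
      ((C * r * lam) `^ q * mass mu x r)%:E)%E.
Proof.
move=> p0 q0 C0 s0.
have ig (D : set 'rV[R]_n) (f : 'rV[R]_n -> R) s :
    (0 <= \int[mu]_(y in D) (f y `^ s)%:E)%E.
  by apply: integral_ge0 => y _; rewrite lee_fin powR_ge0.
have N x r u (r0 : 0 < r) := @norm_ineqP R (mass mu x (sigma * r)) (mass mu x r) (C * r) p q
   (\int[mu]_(y in eball x (sigma * r)) (enorm (grad u y) `^ p)%:E)%E
   (\int[mu]_(y in eball x r) (`|u y - mean mu (eball x r) u| `^ q)%:E)%E
   (mass_gt0 mu_gt0 mu_fin x (mulr_gt0 s0 r0)) (mass_gt0 mu_gt0 mu_fin x r0)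
   (mulr_gt0 C0 r0) p0 q0
   (ig _ _ _) (ig _ _ _).
split=> H x r u r0 su ui.
  apply/(N x r u r0); have := H x r u r0 su ui.
  by rewrite /emean !massE.
have /(N x r u r0) := H x r u r0 su ui.
by rewrite /emean !massE.
Qed.

Variables (p q C sigma : R).
Hypotheses (p_gt1 : 1 < p) (pq : p < q) (C_ge1 : 1 <= C) (sigma_ge1 : 1 <= sigma).
Hypothesis SP : sobolev_poincare_ineq p q C sigma mu.

Let p0 : 0 < p. Proof. exact: lt_trans p_gt1. Qed.
Let q0 : 0 < q. Proof. exact: lt_trans pq. Qed.
Let C0 : 0 < C. Proof. exact: lt_le_trans C_ge1. Qed.
Let s0 : 0 < sigma. Proof. exact: lt_le_trans sigma_ge1. Qed.

(** As eta is supported on at most half of the mass, its mean is at most 1/2. Where eta = 1 it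
    therefore deviates from the mean by at least 1/2, and the inequality bounds the mass of that
    set. Passing from the p-th power of lam to its q-th power yields the exponent q / p. *)
Lemma cutoff_decay K x r (b a : R) (eta : 'rV[R]_n -> R) : 0 < K -> 0 < b -> b < a -> a <= r ->
  smooth_on setT eta -> (forall y, 0 <= eta y <= 1) ->
  (forall y, enorm (y - x) <= b -> eta y = 1) ->
  (forall y, a <= enorm (y - x) -> eta y = 0 /\ grad eta y = 0) ->
  (forall y, enorm (grad eta y) <= K) ->
  mass mu x a / mass mu x r <= 2^-1 ->
  mass mu x b / mass mu x r <=
    (2 * C * r * K) `^ q * (mass mu x a / mass mu x r) `^ (q / p).
Proof.
move=> K0 b0 ba ar seta eta01 eta1 eta0 etaK a2.
have a0 := lt_trans b0 ba; have r0 := lt_le_trans a0 ar.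
have ma := mass_gt0 mu_gt0 mu_fin x a0.
have mr := mass_gt0 mu_gt0 mu_fin x r0.
set B := eball x r; have mB : measurable B by exact: measurable_eball.
have meta : measurable_fun B eta.
  by apply: smooth_on_measurable_fun; [exact: open_eball|exact: smooth_on_sub seta].
have eta_i : mu.-integrable B (EFin \o eta).
  apply: (bounded_integrable mB (massE mu_fin x r) meta (M := 1)) => y _.
  by rewrite ger0_norm; case/andP: (eta01 y).
have sr : r <= sigma * r by rewrite ler_peMl// ltW.
have Bs : eball x (sigma * r) `<=` setT by [].
have ser := smooth_on_sub Bs seta.
set t := mass mu x a / mass mu x r in a2 *.
have t0 : 0 < t by rewrite divr_gt0.
have tE : mass mu x a = t * mass mu x r by rewrite divfK// gt_eqF.
clearbody t.
(* Chosen so that the energy bound K^p * mass x a equals lam^p * mass x r, which is at most lam^p *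
   mass x (sigma * r). *)
pose lam := K * t `^ p^-1.
have lam0 : 0 < lam by rewrite mulr_gt0// powR_gt0.
have notin y : ~ eball x a y -> a <= enorm (y - x).
  by move=> /negP; rewrite -leNgt.
have main := (sobolev_poincareP p0 q0 C0 s0).1 SP x r eta r0 ser eta_i lam lam0 _.
have {}main : (\int[mu]_(y in B) (`|eta y - mean mu B eta| `^ q)%:E <=
      ((C * r * lam) `^ q * mass mu x r)%:E)%E.
  apply: main; apply: (@le_trans _ _ ((K `^ p)%:E * mu (eball x a))%E).
    apply: integral_supported; [exact: measurable_eball|exact: measurable_eball| | | | | |].
    - by apply: le_eball; exact: le_trans sr.
    - by apply: measurable_enorm_grad; [exact: open_eball|].
    - exact: powR_ge0.
    - by move=> y _; exact: powR_ge0.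
    - by move=> y _; rewrite powR_le ?enorm_ge0// ltW.
    - by move=> y /notin/eta0[_ ->]; rewrite enorm0 powR0// gt_eqF.
  rewrite massE// -EFinM lee_fin powRM ?powR_ge0 ?(ltW K0)// powR_invK ?(ltW t0)//.
  rewrite -mulrA ler_pM2l ?powR_gt0// tE ler_pM2l//.
  by apply: mass_le => //; exact: le_eball.
have M2 : mean mu B eta <= 2^-1.
  rewrite -(ler_pM2r mr) -lee_fin (average_mass mB mr (massE mu_fin x r) eta_i).
  apply: (@le_trans _ _ (1%:E * mu (eball x a))%E).
    apply: integral_supported; [exact: measurable_eball|exact: mB| |exact: meta|exact: ler01| | |].
    - exact: le_eball.
    - by move=> y _; case/andP: (eta01 y).
    - by move=> y _; case/andP: (eta01 y).
    - by move=> y /notin/eta0[].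
  by rewrite mul1e massE// lee_fin tE ler_pM2r.
have low : ((2^-1 `^ q)%:E * mu (eball x b) <= ((C * r * lam) `^ q * mass mu x r)%:E)%E.
  apply: le_trans main.
  rewrite -integral_cst; last exact: measurable_eball.
  apply: (@le_trans _ _ (\int[mu]_(y in eball x b) (`|eta y - mean mu B eta| `^ q)%:E)%E).
    apply: le_integral_EFin; [exact: measurable_eball|exact: measurable_cst| |].
      apply/measurable_fun_powR/measurable_fun_normB.
      by apply: smooth_on_measurable_fun; [exact: open_eball|exact: smooth_on_sub seta].
    move=> y yb; rewrite powR_ge0/= powR_le ?(ltW q0) ?invr_ge0//.
    rewrite (eta1 y (ltW yb)) ger0_norm; lra.
  apply: ge0_subset_integral; [exact: measurable_eball|exact: mB| | |].
  - exact/measurable_EFinP/measurable_fun_powR/measurable_fun_normB.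
  - by move=> y _; rewrite lee_fin powR_ge0.
  - by apply: le_eball; rewrite (le_trans (ltW ba)).
move: low; rewrite massE// -EFinM lee_fin => low.
rewrite ler_pdivrMr// mulrAC.
have -> : (2 * C * r * K) `^ q * mass mu x r * t `^ (q / p) =
   2 `^ q * ((C * r * lam) `^ q * mass mu x r).
  rewrite /lam -!mulrA !powRM ?mulr_ge0 ?powR_ge0 ?(ltW C0) ?(ltW r0) ?(ltW K0)//.
  rewrite -[(t `^ _) `^ q]powRrM [p^-1 * q]mulrC; ring.
rewrite -ler_pdivrMl ?powR_gt0// -powRN.
by move: low; rewrite -powR_inv1// -powRrM mulN1r.
Qed.

Lemma poincare_doubling : exists2 D : R, 0 < D &
  forall x r, 0 < r -> mass mu x (2 * r) <= D * mass mu x r.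
Proof.
have [K K0 KP] := @cutoff_exists R n.
pose H := (16 * C * K) `^ q.
have H0 : 0 < H by rewrite powR_gt0// !mulr_gt0.
have b1 : 1 < 2 `^ q :> R.
  by rewrite -[ltLHS](powRr0 2) /powR pnatr_eq0/= ltr_expR mul0r mulr_gt0// ln_gt0// ltr1n.
have g1 : 1 < q / p by rewrite ltr_pdivlMr// mul1r.
have [eps [tau [eps0 eps2 /andP[tau0 tau1] small]]] := iteration_small H0 b1 g1.
exists eps^-1 => [|x r' r'0]; first by rewrite invr_gt0.
set r := 2 * r'; have r0 : 0 < r by rewrite mulr_gt0.
have -> : r' = r / 2 by rewrite /r; field.
(* The radii decrease from r / 2 towards r / 4 with gaps r / 8 * 2^-j, so the j-th cutoff has slope
   at most 8 K 2^j / r. Inserted in [cutoff_decay] with its factor 2 * C * r, this gives the 16 in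
   [H] and the base 2^q. *)
pose rho j : R := r / 4 * (1 + 2^-1 ^+ j).
have rho0 : rho 0%N = r / 2 by rewrite /rho expr0; field.
have rhoS j : rho j - rho j.+1 = r / 8 * 2^-1 ^+ j.
  by rewrite /rho exprS; field.
have h0 j : 0 < 2^-1 ^+ j :> R by rewrite exprn_gt0// invr_gt0.
have h1 j : 2^-1 ^+ j <= 1 :> R by rewrite exprn_ile1 ?invr_ge0// invf_le1// ler1n.
have rho4 j : r / 4 < rho j by rewrite /rho ltr_pMr ?divr_gt0// ltrDl.
have r4 : 0 < r / 4 by rewrite divr_gt0.
have rhor j : rho j <= r by have := h1 j; rewrite /rho; nra.
have rhoj0 j : 0 < rho j by exact: lt_trans (rho4 j).
pose a j := mass mu x (rho j) / mass mu x r.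
have mr := mass_gt0 mu_gt0 mu_fin x r0.
have aS j : a j <= 2^-1 -> a j.+1 <= H * (2 `^ q) ^+ j * a j `^ (q / p).
  move=> aj; have rS : rho j.+1 < rho j.
    by rewrite -subr_gt0 rhoS mulr_gt0// divr_gt0.
  have [eta [e1 e2 e3 e4 e5]] := KP x (rho j) (rho j.+1) (rhoj0 _) rS.
  have Kj : 0 < K / (rho j - rho j.+1) by rewrite divr_gt0// subr_gt0.
  apply: le_trans (cutoff_decay Kj (rhoj0 _) rS (rhor j) e1 e2 e3 e4 e5 aj) _.
  rewrite ler_wpM2r ?powR_ge0//.
  have -> : 2 * C * r * (K / (rho j - rho j.+1)) = 16 * C * K * 2 ^+ j.
    rewrite rhoS exprVn; field.
    by rewrite expf_neq0 ?gt_eqF.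
  rewrite powRM ?mulr_ge0 ?exprn_ge0 ?(ltW C0) ?(ltW K0)//.
  by rewrite powRX.
have a0 j : 0 <= a j by rewrite divr_ge0// ltW// mass_gt0.
have [aeps|aeps] := leP (a 0%N) eps; last first.
  have := ltW aeps; rewrite /a rho0 ler_pdivlMr// => h.
  by rewrite -ler_pdivrMl ?invr_gt0// invrK.
exfalso; have sm := small a a0 aS aeps.
pose delta := mass mu x (r / 4) / mass mu x r.
have delta0 : 0 < delta by rewrite divr_gt0// mass_gt0.
have aj j : delta <= a j.
  rewrite ler_pM2r ?invr_gt0//; apply: mass_le => //; apply: le_eball; exact: ltW.
have := cvg_geometric eps (_ : `|tau| < 1); rewrite gtr0_norm// => /(_ tau1).
move=> /cvgrPdist_lt/(_ _ delta0)[j _ /(_ j (leqnn _))].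
rewrite sub0r normrN ger0_norm; last by rewrite mulr_ge0 ?exprn_ge0// ltW.
by rewrite ltNge (le_trans (aj j))// sm.
Qed.

End poincare_doubling.

(** * Sobolev inequality *)

Lemma integral_supp_eq (d : measure_display) (T : measurableType d) (R : realType)
    (mu : {measure set T -> \bar R}) (A D : set T) (h : T -> \bar R) :
  A `<=` D -> (forall y, D y -> ~ A y -> h y = 0%E) ->
  (\int[mu]_(y in D) h y = \int[mu]_(y in A) h y)%E.
Proof.
move=> AD hA; rewrite integral_mkcond [RHS]integral_mkcond.
apply: eq_integral => y _; rewrite !patchE.
have [/set_mem Ay|/negP Ay] := boolP (y \in A); first by rewrite mem_set//; exact: AD.
case: ifPn => // /set_mem Dy; apply: hA => //.
by move=> /mem_set.
Qed.

Section sobolev.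
Context {R : realType} {n : nat}.
Variable mu : {measure set 'rV[R]_n -> \bar R}.
Hypothesis mu_gt0 : forall (x : 'rV[R]_n) (r : R), 0 < r -> (0 < mu (eball x r))%E.
Hypothesis mu_fin : forall (x : 'rV[R]_n) (r : R), (mu (eball x r) < +oo)%E.
Implicit Types (x y z : 'rV[R]_n) (r s lam : R) (u : 'rV[R]_n -> R).

Variables (p q C sigma : R).
Hypotheses (n_gt0 : (0 < n)%N).
Hypotheses (p_gt1 : 1 < p) (pq : p < q) (C_ge1 : 1 <= C) (sigma_ge1 : 1 <= sigma).
Hypothesis SP : sobolev_poincare_ineq p q C sigma mu.

Let p0 : 0 < p. Proof. exact: lt_trans p_gt1. Qed.
Let q0 : 0 < q. Proof. exact: lt_trans pq. Qed.
Let C0 : 0 < C. Proof. exact: lt_le_trans C_ge1. Qed.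
Let s0 : 0 < sigma. Proof. exact: lt_le_trans sigma_ge1. Qed.

Lemma notin_supp u y : ~ supp u y -> u y = 0.
Proof.
by move=> uy; apply/eqP/negPn/negP => u0; apply: uy; apply: subset_closure.
Qed.

Lemma grad_notin_supp u y : ~ supp u y -> grad u y = 0.
Proof.
move=> uy; apply/rowP => i; rewrite !mxE.
have oS : open (~` supp u) by apply: closed_openC; exact: closed_closure.
have [_ _ H] := @eq_on_partial R n (~` supp u) u (fun=> 0) oS
  (fun z => @notin_supp u z) y uy.
by rewrite /partial H derive_cst.
Qed.

Lemma continuous_compact_supp_bounded u : smooth_on setT u -> compact (supp u) ->
  exists M, forall y, `|u y| <= M.
Proof.
move=> su cu.
have cu' : compact ((fun y => `|u y|) @` supp u).
  apply: continuous_compact => //; apply: continuous_subspaceT => y.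
  apply: continuous_comp; last exact: norm_continuous.
  by have [] := su [::] y Logic.I.
have [M [_ MP]] := compact_bounded cu'.
exists (`|M| + 1) => y; have [yS|yS] := pselect (supp u y); last first.
  by rewrite notin_supp// normr0 addr_ge0.
have M1 : M < `|M| + 1 by rewrite ltr_pwDr ?ler_norm.
have := MP _ M1 _ (imageP (fun y => `|u y|) yS).
by rewrite /= normr_id.
Qed.

(** The ball of radius r / 2 around z lies in B(x, 2 r) and misses B(x, r), so a function supported
    in B(x, r) vanishes on it. The point z is found along a coordinate axis, for which n > 0 is
    used. *)
Lemma exists_outer_ball x r : 0 < r -> exists z, enorm (x - z) = 3 / 2 * r.
Proof.
move=> r0; case: n n_gt0 x => // m _ x.
exists (x + (3 / 2 * r) *: delta_mx 0 ord0).
rewrite opprD addrA subrr add0r enormN enormZ enorm_delta mulr1 gtr0_norm//.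
by rewrite mulr_gt0// divr_gt0.
Qed.

Lemma poincare_sobolev : sobolev_ineq p mu.
Proof.
have [D D0 dbl] := poincare_doubling mu_gt0 mu_fin p_gt1 pq C_ge1 sigma_ge1 SP.
(* The ball of radius 2 r at x is compared with one of radius r / 2 at distance 3 / 2 * r, and 3 / 2
   + 2 = 7 * (1 / 2). In [C'], the 4 is the 2 of [powRD_le] times the 2 of the radius 2 r; D
   accounts for the deviation of phi from its mean, K for the mean itself. *)
have [K K0 KP] := mass_comparable mu_fin D0 dbl 7.
pose C' := 4 * C * (D + K) `^ q^-1.
exists (q / p), C'; split; first by rewrite ltr_pdivlMr// mul1r.
  by rewrite /C' !mulr_gt0// powR_gt0// addr_gt0.
move=> x r phi r0 [sphi cphi phiB].
have mr := mass_gt0 mu_gt0 mu_fin x r0.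
rewrite divfK ?gt_eqF// /emean !massE//.
apply/norm_ineqP => //.
- by rewrite mulr_gt0// /C' !mulr_gt0// powR_gt0// addr_gt0.
- by apply: integral_ge0 => y _; rewrite lee_fin powR_ge0.
- by apply: integral_ge0 => y _; rewrite lee_fin powR_ge0.
move=> lam lam0 H.
have r20 : 0 < 2 * r by rewrite mulr_gt0.
have m2r := mass_gt0 mu_gt0 mu_fin x r20.
have rs : r <= sigma * (2 * r).
  by apply: (@le_trans _ _ (2 * r)); [lra|rewrite ler_peMl// ltW].
have mphi A : measurable_fun (A : set 'rV[R]_n) phi.
  apply: (measurable_funS (E := setT)); [exact: measurableT|exact: subsetT|].
  by apply: smooth_on_measurable_fun; [exact: openT|].
have [M phiM] := continuous_compact_supp_bounded sphi cphi.
have phi_i : mu.-integrable (eball x (2 * r)) (EFin \o phi).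
  apply: (bounded_integrable (measurable_eball _ _) (massE mu_fin x _) (mphi _) (M := M)) => y _.
  exact: phiM.
have notB y : ~ eball x r y -> ~ supp phi y by move=> yB /phiB.
have H2 : (\int[mu]_(y in eball x (sigma * (2 * r))) (enorm (grad phi y) `^ p)%:E <=
      (lam `^ p * mass mu x (sigma * (2 * r)))%:E)%E.
  rewrite (@integral_supp_eq _ _ _ mu (eball x r)).
  - apply: le_trans H _; rewrite lee_fin ler_pM2l ?powR_gt0//.
    by apply: mass_le => //; exact: le_eball.
  - exact: le_eball.
  - by move=> y _ /notB/grad_notin_supp ->; rewrite enorm0 powR0// gt_eqF.
have := (sobolev_poincareP mu_gt0 mu_fin p0 q0 C0 s0).1 SP x (2 * r) phi r20
   (smooth_on_sub (@subsetT _ _) sphi) phi_i lam lam0 H2.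
set m := mean _ _ _; set L := C * (2 * r) * lam => main.
have L0 : 0 < L by rewrite !mulr_gt0.
have [z xz] := exists_outer_ball x r0.
have r20' : 0 < r / 2 by rewrite divr_gt0.
have mz := mass_gt0 mu_gt0 mu_fin z r20'.
have mdev A : measurable_fun (A : set 'rV[R]_n) (fun y => `|phi y - m| `^ q).
  exact/measurable_fun_powR/measurable_fun_normB.
have sub A : measurable A -> A `<=` eball x (2 * r) ->
    (\int[mu]_(y in A) (`|phi y - m| `^ q)%:E <= (L `^ q * mass mu x (2 * r))%:E)%E.
  move=> mA AB; apply: le_trans main.
  apply: ge0_subset_integral; [exact: mA|exact: measurable_eball| | |exact: AB].
  - exact/measurable_EFinP.
  - by move=> y _; rewrite lee_fin powR_ge0.
(* On the ball around z the deviation |phi - m| is the constant |m|, so the inequality on the ball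
   of radius 2 r bounds the mean. *)
have mL : `|m| `^ q <= K * L `^ q.
  have : ((`|m| `^ q)%:E * mu (eball z (r / 2)) <= (L `^ q * mass mu x (2 * r))%:E)%E.
    apply: le_trans (sub (eball z (r / 2)) _ _); last 2 first.
    - exact: measurable_eball.
    - by apply: subset_eball; rewrite enormB xz; lra.
    rewrite -integral_cst; last exact: measurable_eball.
    apply: le_integral_EFin; [exact: measurable_eball|exact: measurable_cst|exact: mdev|].
    move=> y yz; rewrite powR_ge0/= notin_supp ?sub0r ?normrN//.
    apply: notB; rewrite /eball/= => yx.
    by have := enorm_triangle y x z; rewrite xz enormB; move: yz; rewrite /eball/=; lra.
  rewrite massE// -EFinM lee_fin => h.
  rewrite -(ler_pM2r mz); apply: le_trans h _.
  rewrite [K * _]mulrC -mulrA ler_pM2l ?powR_gt0//.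
  by apply: KP => //; rewrite xz; lra.
apply: (@le_trans _ _ ((2 `^ q * `|m| `^ q)%:E * mu (eball x r) +
    (2 `^ q)%:E * \int[mu]_(y in eball x r) (`|phi y - m| `^ q)%:E)%E).
  apply: le_integral_affine; [exact: measurable_eball|exact: mdev| | |exact: powR_ge0| |].
  - by apply/measurable_fun_powR; apply: measurableT_comp => //.
  - by rewrite mulr_ge0 ?powR_ge0.
  - by move=> y _; exact: powR_ge0.
  - move=> y _; rewrite powR_ge0/= -mulrDr -[X in `|X| `^ _](subrK m) addrC.
    by rewrite (le_trans _ (powRD_le _ _ _)) ?(ltW q0)// powR_le ?(ltW q0)// ler_normD.
rewrite massE// (@le_trans _ _ ((2 `^ q * (K * L `^ q))%:E * (mass mu x r)%:E +
    (2 `^ q)%:E * (L `^ q * mass mu x (2 * r))%:E)%E)//.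
  apply: leeD.
    by rewrite -!EFinM lee_fin ler_pM2r// ler_pM2l ?powR_gt0.
  rewrite lee_wpmul2l ?lee_fin ?powR_ge0//; apply: sub; first exact: measurable_eball.
  by apply: le_eball; nra.
rewrite -!EFinM -EFinD lee_fin.
have -> : (C' * r * lam) `^ q = 2 `^ q * L `^ q * (D + K).
  rewrite (_ : C' * r * lam = 2 * L * (D + K) `^ q^-1); last by rewrite /C' /L; ring.
  rewrite powRM ?powR_ge0//; last by rewrite mulr_ge0// ltW.
  have DK : 0 <= D + K by rewrite addr_ge0// ltW.
  by rewrite powR_invK// powRM ?(ltW L0).
have h := dbl x r r0.
have t0 : 0 < 2 `^ q * L `^ q by rewrite mulr_gt0 ?powR_gt0.
nra.
Qed.

End sobolev.

(** * Poincare inequality *)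

Section closure_lemmas.
Context {R : realType}.
Implicit Types (k g t m p eta : R) (Y : \bar R).

(** Turns a bound in terms of lam back into one in terms of g. As g may be 0 while lam must be
    positive, lam^p is g plus a small amount, which then tends to 0. *)
Lemma le_powR_closure p k g m Y : 0 < p -> 0 < k -> 0 <= g -> 0 < m ->
  (forall lam, 0 < lam -> g <= lam `^ p -> (Y <= ((k * lam) `^ p * m)%:E)%E) ->
  (Y <= (k `^ p * g * m)%:E)%E.
Proof.
move=> p0 k0 g0 m0 H; apply/lee_addgt0Pr => e e0.
have km : 0 < k `^ p * m by rewrite mulr_gt0// powR_gt0.
have e1 : 0 < e / (k `^ p * m) by rewrite divr_gt0.
have ge : 0 < g + e / (k `^ p * m) by rewrite ltr_wpDl.
have := H ((g + e / (k `^ p * m)) `^ p^-1) (powR_gt0 _ ge).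
rewrite powR_invK ?(ltW ge)// lerDl (ltW e1) => /(_ isT).
rewrite powRM ?powR_ge0 ?(ltW k0)// powR_invK ?(ltW ge)// => /le_trans; apply.
rewrite -EFinD lee_fin mulrDr mulrDl lerD2l mulrAC.
by rewrite mulrC divfK// gt_eqF.
Qed.

Lemma le_powR_closure1 p k g t : 0 < p -> 0 < k -> 0 <= g -> 0 <= t ->
  (forall lam, 0 < lam -> g <= lam `^ p -> t <= k * lam) -> t `^ p <= k `^ p * g.
Proof.
move=> p0 k0 g0 t0 H; rewrite -lee_fin -[k `^ p * g]mulr1.
apply: le_powR_closure => // lam lam0 /(H _ lam0) h.
by rewrite mulr1 lee_fin powR_le// ltW.
Qed.

(* Used in place of Jensen's inequality: each increment is at most [eta ^+ l * S `^ p^-1],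
   where [S] is the sum on the right. *)
Lemma telescoping_powR (a : nat -> R) p eta L : 0 < p -> 0 < eta < 1 ->
  `|a L - a 0%N| `^ p <=
  ((1 - eta)^-1) `^ p * \sum_(l < L) (`|a l - a l.+1| / eta ^+ l) `^ p.
Proof.
move=> p0 /andP[e0 e1].
set S := \sum_(l < L) _.
have S0 : 0 <= S by rewrite sumr_ge0// => l _; exact: powR_ge0.
have Sl (l : 'I_L) : `|a l - a l.+1| <= eta ^+ l * S `^ p^-1.
  rewrite mulrC -ler_pdivrMr ?exprn_gt0//.
  rewrite -[leLHS](@powRK_inv _ _ p)//; last by rewrite divr_ge0 ?exprn_ge0// ltW.
  rewrite powR_le ?powR_ge0 ?invr_ge0 ?(ltW p0)//.
  by rewrite /S (bigD1 l)//= lerDl sumr_ge0// => i _; exact: powR_ge0.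
have aL : `|a L - a 0%N| <= (1 - eta)^-1 * S `^ p^-1.
  rewrite -(telescope_sumr a (leq0n L)) big_mkord.
  rewrite (le_trans (ler_norm_sum _ _ _))//.
  apply: (@le_trans _ _ (\sum_(l < L) eta ^+ l * S `^ p^-1)).
    by apply: ler_sum => l _; rewrite distrC Sl.
  rewrite -mulr_suml ler_wpM2r ?powR_ge0//.
  have := @geometric_le_lim R L 1 eta ler01 e0; rewrite gtr0_norm// => /(_ e1).
  rewrite mul1r seriesEord/=; apply: le_trans; apply: ler_sum => l _.
  by rewrite mul1r.
rewrite (le_trans (powR_le (ltW p0) (normr_ge0 _) aL))//.
rewrite powRM ?powR_ge0 ?invr_ge0 ?subr_ge0 ?(ltW e1)//.
by rewrite powR_invK.
Qed.

End closure_lemmas.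

Lemma average_limit (d : measure_display) (T : measurableType d) (R : realType)
    (mu : {measure set T -> \bar R}) (D : set T) (m : R) (u : T -> R) (c e : R) :
  measurable D -> 0 < m -> mu D = m%:E -> mu.-integrable D (EFin \o u) -> 0 <= e ->
  (forall y, D y -> `|u y - c| <= e) -> `|average mu D u - c| <= e.
Proof.
move=> mD m0 mDm ui e0 ue.
have mf : measurable_fun D u by apply/measurable_EFinP/measurable_int/ui.
rewrite -(ler_pM2r m0) -lee_fin; apply: le_trans (average_dev mD m0 mDm c ui) _.
apply: (@le_trans _ _ (\int[mu]_(y in D) (e%:E))%E).
  apply: le_integral_EFin => //; first exact: measurable_fun_normB.
  by move=> y /ue; rewrite normr_ge0.
by rewrite integral_cst// mDm.
Qed.

Section poincare.
Context {R : realType} {n : nat}.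
Variable mu : {measure set 'rV[R]_n -> \bar R}.
Hypothesis mu_gt0 : forall (x : 'rV[R]_n) (r : R), 0 < r -> (0 < mu (eball x r))%E.
Hypothesis mu_fin : forall (x : 'rV[R]_n) (r : R), (mu (eball x r) < +oo)%E.
Implicit Types (x y z : 'rV[R]_n) (r s lam : R) (u : 'rV[R]_n -> R).

Variables (p q C sigma : R).
Hypotheses (p_gt1 : 1 < p) (pq : p < q) (C_ge1 : 1 <= C) (sigma_ge1 : 1 <= sigma).
Hypothesis SP : sobolev_poincare_ineq p q C sigma mu.

Let p0 : 0 < p. Proof. exact: lt_trans p_gt1. Qed.
Let q0 : 0 < q. Proof. exact: lt_trans pq. Qed.
Let q1 : 1 <= q. Proof. exact/ltW/(lt_trans p_gt1). Qed.
Let C0 : 0 < C. Proof. exact: lt_le_trans C_ge1. Qed.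
Let s0 : 0 < sigma. Proof. exact: lt_le_trans sigma_ge1. Qed.

(** One link of a chain: B(z, t') lies in B(y, 2 t) and has comparable mass, so the two means differ
    by at most a multiple of the mean oscillation on the larger ball. *)
Lemma mean_step : exists2 K : R, 0 < K & forall u y z t t' lam,
  0 < t -> t / 2 <= t' -> enorm (z - y) + t' <= 2 * t ->
  smooth_on (eball y (sigma * (2 * t))) u ->
  mu.-integrable (eball y (2 * t)) (EFin \o u) -> 0 < lam ->
  (\int[mu]_(v in eball y (sigma * (2 * t))) (enorm (grad u v) `^ p)%:E <=
     (lam `^ p * mass mu y (sigma * (2 * t)))%:E)%E ->
  `|mean mu (eball z t') u - mean mu (eball y (2 * t)) u| <= K * t * lam.
Proof.
have [D D0 dbl] := poincare_doubling mu_gt0 mu_fin p_gt1 pq C_ge1 sigma_ge1 SP.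
(* The centers are at distance at most 2 t, so |y - z| + 2 t <= 4 t <= 8 t'. *)
have [K K0 KP] := mass_comparable mu_fin D0 dbl 8.
exists (4 * C * K) => [|u y z t t' lam t0 tt' yz su ui lam0 H].
  by rewrite !mulr_gt0.
have t20 : 0 < 2 * t by rewrite mulr_gt0.
have t'0 : 0 < t' by apply: lt_le_trans tt'; rewrite divr_gt0.
have mz := mass_gt0 mu_gt0 mu_fin z t'0.
have my := mass_gt0 mu_gt0 mu_fin y t20.
have main := (sobolev_poincareP mu_gt0 mu_fin p0 q0 C0 s0).1 SP y (2 * t) u t20 su ui lam lam0 H.
set c := mean mu (eball y (2 * t)) u in main *.
set L := C * (2 * t) * lam in main.
have L0 : 0 < L by rewrite !mulr_gt0.
have zy : eball z t' `<=` eball y (2 * t) by apply: subset_eball.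
have mB : measurable (eball y (2 * t)) by exact: measurable_eball.
have mB' : measurable (eball z t') by exact: measurable_eball.
have ui' : mu.-integrable (eball z t') (EFin \o u) by exact: integrableS ui.
have mu' : measurable_fun (eball y (2 * t)) u by apply/measurable_EFinP/measurable_int/ui.
have h1 := average_dev mB' mz (massE mu_fin z t') c ui'.
have h2 : (\int[mu]_(v in eball y (2 * t)) (`|u v - c|)%:E <= (2 * L * mass mu y (2 * t))%:E)%E.
  have := integral_powR_exponent_le mB (massE mu_fin y (2 * t)) (measurable_fun_normB c mu')
    (fun _ _ => normr_ge0 _) ltr01 q1 L0 main.
  by under eq_integral do rewrite powRr1//; rewrite (powRr1 (ltW L0)).
have h3 : (\int[mu]_(v in eball z t') (`|u v - c|)%:E <=
    \int[mu]_(v in eball y (2 * t)) (`|u v - c|)%:E)%E.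
  apply: ge0_subset_integral; [exact: mB'|exact: mB| | |exact: zy].
  - exact/measurable_EFinP/measurable_fun_normB.
  - by move=> v _; rewrite lee_fin.
have := le_trans h1 (le_trans h3 h2); rewrite lee_fin => h.
have h4 : mass mu y (2 * t) <= K * mass mu z t'.
  by apply: KP => //; rewrite enormB; lra.
rewrite -(ler_pM2r mz); apply: le_trans h _.
have -> : 4 * C * K * t * lam * mass mu z t' = 2 * L * (K * mass mu z t').
  by rewrite /L; ring.
by rewrite ler_pM2l// mulr_gt0.
Qed.

Variable KA : R.
Hypotheses (KA_gt0 : 0 < KA) (avg : averaging_bound mu KA).

(** The mean is taken over the small central ball because every chain starts there: for l = 0 the
    ball does not depend on x. The energy is given as a real number; the infinite case is trivial
    and treated by the caller. *)
Lemma poincare_chain : exists K c : R, [/\ 0 < K, 0 < c, c <= 1 &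
  forall u x0 rho M (I : R), 0 < rho -> smooth_on (eball x0 rho) u ->
    (forall y, eball x0 rho y -> `|u y| <= M) ->
    (\int[mu]_(y in eball x0 rho) (enorm (grad u y) `^ p)%:E = I%:E)%E ->
    (\int[mu]_(y in eball x0 rho) (`|u y - mean mu (eball x0 (c * rho)) u| `^ p)%:E
      <= (K * (rho `^ p * I))%:E)%E].
Proof.
have [K K0 KP] := mean_step.
(* The ball of radius 2 * c * th^l * rho around a center [X l x] then has a [sigma]-dilation of
   radius exactly th^l * rho, which stays in B. *)
pose c := (2 * sigma)^-1.
have c0 : 0 < c by rewrite invr_gt0 mulr_gt0.
have c2 : c <= 2^-1 by rewrite lef_pV2 ?posrE ?mulr_gt0// ler_peMr.
have csig : sigma * (2 * c) = 1 by rewrite /c; field; rewrite gt_eqF.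
(* [th] is eta^2, so that the factor th^l of a link splits: one eta^l makes the telescoping sum
   converge, the other makes the averages summable over l. The bound 1 - th <= c keeps consecutive
   centers within c * th^l * rho of each other, and eta >= 3 / 4 gives th >= 1 / 2, the least ratio
   of radii that [mean_step] admits. *)
have [eta [eta34 eta1 etac]] : exists eta : R, [/\ 3 / 4 <= eta, eta < 1 & 1 - eta * eta <= c].
  by exists (1 - c / 2); split; [lra|lra|nra].
have eta0 : 0 < eta by lra.
have etaX l : 0 < eta ^+ l by rewrite exprn_gt0.
pose th := eta * eta.
have th0 : 0 < th by rewrite mulr_gt0.
have th1 : th < 1 by rewrite /th; nra.
have thX l : 0 < th ^+ l by rewrite exprn_gt0.
have thX1 l : th ^+ l <= 1 by rewrite exprn_ile1// ltW.
have th12 : 2^-1 <= th by rewrite /th; nra.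
have thE l : th ^+ l = eta ^+ l * eta ^+ l by rewrite /th exprMn.
have thc : 1 - th <= c by [].
clearbody c th.
have zp0 : 0 < eta `^ p by exact: powR_gt0.
have zp1 : eta `^ p < 1.
  by rewrite (le_lt_trans _ eta1)// ge1r_powR ?eta0 ?ltW.
pose k0 := 2 * K * c.
have k00 : 0 < k0 by rewrite !mulr_gt0.
have e10 : 0 < 1 - eta by rewrite subr_gt0.
exists ((((1 - eta)^-1) * k0) `^ p * (KA / (1 - eta `^ p))), c; split => //.
- by rewrite mulr_gt0 ?powR_gt0 ?mulr_gt0 ?invr_gt0// subr_gt0.
- by rewrite (le_trans c2)// invf_le1// ler1n.
move=> u x0 rho M I rho0 su uM IE.
set B := eball x0 rho in su uM IE *.
have mB : measurable B by exact: measurable_eball.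
have oB : open B by exact: open_eball.
have mu_ : measurable_fun B u by exact: smooth_on_measurable_fun.
have ui : mu.-integrable B (EFin \o u).
  exact: (bounded_integrable mB (massE mu_fin x0 rho) mu_ uM).
have I0 : 0 <= I.
  by rewrite -lee_fin -IE; apply: integral_ge0 => y _; rewrite lee_fin powR_ge0.
pose g := (fun y => (enorm (grad u y) `^ p)%:E) \_ B.
have g0 y : (0 <= g y)%E.
  by rewrite /g patchE; case: ifP => // _; rewrite lee_fin powR_ge0.
have mg : measurable_fun setT g.
  apply/(measurable_restrictT _ mB)/measurable_EFinP.
  exact: measurable_enorm_grad.
have gI : (\int[mu]_y g y = I%:E)%E by rewrite -IE /g -integral_mkcond.
have srho l : 0 < th ^+ l * rho by rewrite mulr_gt0.
have /choice[G GP] := fun l => avg (srho l) mg g0.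
(* The centers run along the segment from x0, at l = 0, towards x. Since |X l x - x| = th^l * |x -
   x0| <= th^l * rho, the energy over the ball of radius th^l * rho around [X l x] is controlled by
   [G l] at x itself. *)
pose X l x : 'rV[R]_n := x0 + (1 - th ^+ l) *: (x - x0).
pose a x l := mean mu (eball (X l x) (c * (th ^+ l * rho))) u.
have Xx l x : enorm (X l x - x) = th ^+ l * enorm (x - x0).
  rewrite /X (_ : _ - x = - (th ^+ l *: (x - x0))) ?enormN ?enormZ ?gtr0_norm//.
  by apply/rowP => i; rewrite !mxE; ring.
have Xx0 l x : enorm (X l x - x0) = (1 - th ^+ l) * enorm (x - x0).
  by rewrite /X addrAC subrr add0r enormZ ger0_norm ?subr_ge0.
have XS l x : enorm (X l.+1 x - X l x) = th ^+ l * (1 - th) * enorm (x - x0).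
  rewrite /X (_ : _ - _ = (th ^+ l * (1 - th)) *: (x - x0)).
    by rewrite enormZ ger0_norm// mulr_ge0 ?subr_ge0// ltW.
  by apply/rowP => i; rewrite !mxE exprS; ring.
have XB l x : B x -> eball (X l x) (th ^+ l * rho) `<=` B.
  move=> Bx; apply: subset_eball; rewrite Xx0.
  by have := thX1 l; have := thX l; move: Bx; rewrite /B/eball/=; nra.
have tdiv l : sigma * (2 * (c * (th ^+ l * rho))) = th ^+ l * rho.
  by rewrite !mulrA -[sigma * 2 * c]mulrA csig !mul1r.
have stepl x l : B x ->
    (((`|a x l - a x l.+1| / eta ^+ l) `^ p)%:E <=
     ((k0 * rho) `^ p)%:E * (((eta `^ p) ^+ l)%:E * G l x))%E.
  move=> Bx; have [mG G0 IG GB] := GP l.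
  have [Gy|Gfin] := eqVneq (G l x) +oo%E.
    rewrite Gy gt0_muley ?lte_fin ?exprn_gt0// gt0_muley ?leey// lte_fin.
    by rewrite powR_gt0// mulr_gt0.
  have {}Gfin : G l x \is a fin_num by rewrite ge0_fin_numE// ltey.
  rewrite -(fineK Gfin) -!EFinM lee_fin.
  have G0' : 0 <= fine (G l x) by rewrite fine_ge0.
  have h : forall lam, 0 < lam -> fine (G l x) <= lam `^ p ->
      `|a x l - a x l.+1| / eta ^+ l <= k0 * rho * eta ^+ l * lam.
    move=> lam lam0 Gl.
    set t := c * (th ^+ l * rho).
    have t0 : 0 < t by rewrite mulr_gt0.
    have sul : smooth_on (eball (X l x) (sigma * (2 * t))) u.
      by rewrite /t tdiv; apply: smooth_on_sub su; exact: XB.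
    have t2 : 2 * t <= th ^+ l * rho.
      by rewrite /t mulrA ger_pMl//; lra.
    have uil : mu.-integrable (eball (X l x) (2 * t)) (EFin \o u).
      apply: integrableS ui; [exact: mB|exact: measurable_eball|].
      by apply: subset_trans (XB l x Bx); exact: le_eball.
    have Hl : (\int[mu]_(v in eball (X l x) (sigma * (2 * t))) (enorm (grad u v) `^ p)%:E <=
       (lam `^ p * mass mu (X l x) (sigma * (2 * t)))%:E)%E.
      rewrite /t tdiv.
      rewrite (eq_integral g); last first.
        move=> y /set_mem yE; rewrite /g patchE mem_set//.
        exact: (XB l x Bx).
      apply: le_trans (GB x (X l x) _) _.
        by rewrite Xx ler_pM2l// ltW.
      rewrite -(fineK Gfin) -EFinM lee_fin mulrC ler_pM2r//.
      exact: mass_gt0.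
    (* Both [a x l] and [a x l.+1] are compared with the mean over the ball of radius 2 t around
       [X l x], which contains both of their balls. *)
    have h1 := KP u (X l x) (X l x) t t lam t0.
    have {}h1 : `|mean mu (eball (X l x) t) u - mean mu (eball (X l x) (2 * t)) u| <= K * t * lam.
      by apply: h1; [lra|rewrite subrr enorm0; lra|exact: sul|exact: uil|exact: lam0|exact: Hl].
    have h2 : `|mean mu (eball (X l.+1 x) (c * (th ^+ l.+1 * rho))) u -
        mean mu (eball (X l x) (2 * t)) u| <= K * t * lam.
      apply: KP; [exact: t0| | |exact: sul|exact: uil|exact: lam0|exact: Hl].
        rewrite exprS /t (_ : c * (th * th ^+ l * rho) = th * (c * (th ^+ l * rho))).
          by rewrite mulrC ler_pM2r.
        ring.
      rewrite XS; apply: (@le_trans _ _ (th ^+ l * (1 - th) * rho + c * (th ^+ l.+1 * rho))).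
        by rewrite lerD2r ler_pM2l ?ltW// mulr_gt0// subr_gt0.
      have -> : th ^+ l * (1 - th) * rho + c * (th ^+ l.+1 * rho) =
          (1 - th + c * th) * (th ^+ l * rho) by rewrite exprS; ring.
      rewrite /t [leRHS]mulrA ler_pM2r//.
      by have : c * th <= c; [rewrite ger_pMr// ltW|lra].
    rewrite ler_pdivrMr//.
    have -> : k0 * rho * eta ^+ l * lam * eta ^+ l = K * t * lam + K * t * lam.
      by rewrite /t thE /k0; ring.
    rewrite -[a x l - _](subrKA (mean mu (eball (X l x) (2 * t)) u)).
    by rewrite (le_trans (ler_normD _ _))// lerD// distrC.
  have kr : 0 < k0 * rho * eta ^+ l by rewrite !mulr_gt0.
  have := le_powR_closure1 p0 kr G0' _ h.
  rewrite divr_ge0 ?(ltW (etaX l))// => /(_ isT) /le_trans; apply.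
  rewrite powRM ?(ltW (etaX l))//; last by rewrite ltW// mulr_gt0.
  by rewrite powRX ?(ltW eta0)// mulrA.
pose T x := (\sum_(l <oo) (((eta `^ p) ^+ l)%:E * G l x))%E.
have TG0 l x : (0 <= ((eta `^ p) ^+ l)%:E * G l x)%E.
  by rewrite mule_ge0//; [rewrite lee_fin exprn_ge0// ltW|have [_] := GP l].
have T0 x : (0 <= T x)%E by apply: nneseries_ge0 => l _ _; exact: TG0.
have aT x : B x -> ((`|u x - a x 0%N| `^ p)%:E <=
   (((1 - eta)^-1 * (k0 * rho)) `^ p)%:E * T x)%E.
  move=> Bx; have cpos : 0 < ((1 - eta)^-1 * (k0 * rho)) `^ p.
    by rewrite powR_gt0// !mulr_gt0// invr_gt0.
  have [Ty|Tfin] := eqVneq (T x) +oo%E.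
    by rewrite Ty gt0_muley ?lte_fin// leey.
  have {}Tfin : T x \is a fin_num by rewrite ge0_fin_numE// ltey.
  rewrite -(fineK Tfin) -EFinM lee_fin.
  set Y := _ * fine (T x).
  have Y0 : 0 <= Y by rewrite mulr_ge0 ?powR_ge0 ?fine_ge0.
  have aL L : `|a x L - a x 0%N| <= Y `^ p^-1.
    rewrite -[leLHS](@powRK_inv _ _ p)// powR_le ?powR_ge0 ?invr_ge0 ?(ltW p0)//.
    have e01 : 0 < eta < 1 by rewrite eta0.
    apply: le_trans (telescoping_powR (a x) L p0 e01) _.
    rewrite /Y powRM ?invr_ge0 ?(ltW e10)//; last by rewrite ltW// mulr_gt0.
    rewrite -mulrA ler_pM2l; last by rewrite powR_gt0// invr_gt0.
    rewrite -lee_fin -sumEFin EFinM (fineK Tfin).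
    apply: (@le_trans _ _ (\sum_(l < L) ((k0 * rho) `^ p)%:E * (((eta `^ p) ^+ l)%:E * G l x))%E).
      by apply: lee_sum => l _; exact: stepl.
    rewrite -ge0_sume_distrr; last by move=> l _; exact: TG0.
    rewrite lee_wpmul2l ?lee_fin ?powR_ge0//.
    rewrite -(big_mkord xpredT (fun l => ((eta `^ p) ^+ l)%:E * G l x)%E).
    by apply: nneseries_lim_ge => l _ _; exact: TG0.
  have : `|u x - a x 0%N| <= Y `^ p^-1.
    apply/ler_addgt0Pr => e e0.
    (* The balls of the chain shrink to x, where u is continuous, so [a x L] comes arbitrarily close
       to u x and the bound valid for all L passes to u x. *)
    have [L uL] : exists L, `|a x L - u x| <= e.
      have cu : {for x, continuous u} by have [] := su [::] x Bx.
      have /nbhs_eball[d d0 dP] : \forall y \near x, `|u x - u y| <= e.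
        exact: (@cvgr_dist_le _ _ _ (nbhs x) _ _ _ cu).
      have [L thL] : exists L, th ^+ L * rho * 2 <= d.
        have d1 : 0 < d / (rho * 2) by rewrite divr_gt0// mulr_gt0.
        have := @cvg_geometric R 1 th; rewrite gtr0_norm// => /(_ th1).
        move=> /cvgrPdist_lt/(_ _ d1)[L _ /(_ L (leqnn _))].
        rewrite sub0r normrN /= mul1r gtr0_norm// ltr_pdivlMr ?mulr_gt0// mulrA.
        by move=> /ltW; exists L.
      exists L.
      have rL : 0 < c * (th ^+ L * rho) by rewrite mulr_gt0.
      have c1' : c * (th ^+ L * rho) <= th ^+ L * rho by rewrite ger_pMl// (le_trans c2)// invf_le1// ler1n.
      apply: (average_limit (measurable_eball _ _) (mass_gt0 mu_gt0 mu_fin _ rL) (massE mu_fin _ _)).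
      - apply: integrableS ui; [exact: mB|exact: measurable_eball|].
        by apply: subset_trans (XB L x Bx); exact: le_eball.
      - exact: ltW.
      - move=> y yX; rewrite distrC; apply: dP; move: y yX; apply: subset_eball.
        rewrite Xx; move: Bx thL c1'; rewrite /B/eball/= => /ltW Bx.
        have : th ^+ L * enorm (x - x0) <= th ^+ L * rho by rewrite ler_pM2l.
        lra.
    rewrite -(subrKA (a x L)) (le_trans (ler_normD _ _))// addrC lerD//.
    by rewrite distrC.
  by rewrite -[X in _ -> _ <= X](@powR_invK _ Y p)// => /(powR_le (ltW p0) (normr_ge0 _)).
have mGl l : measurable_fun setT (fun x => ((eta `^ p) ^+ l)%:E * G l x)%E.
  by have [mG _ _ _] := GP l; apply: emeasurable_funM; [exact: measurable_cst|exact: mG].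
have mT : measurable_fun setT T.
  by apply: ge0_emeasurable_sum => [l x _ _|l _]; [exact: TG0|exact: mGl].
have z10 : 0 < 1 - eta `^ p by rewrite subr_gt0.
(* Each [G l] has integral at most KA * I whatever its radius, so the weights (eta^p)^l leave a
   geometric series. *)
have intT : (\int[mu]_x T x <= (KA / (1 - eta `^ p) * I)%:E)%E.
  rewrite integral_nneseries; [|exact: measurableT|exact: mGl|by move=> l x _; exact: TG0].
  apply: lime_le.
    by apply: is_cvg_nneseries => l _ _; apply: integral_ge0 => x _; exact: TG0.
  apply: nearW => L.
  apply: (@le_trans _ _ (\sum_(0 <= l < L) ((KA * I) * (eta `^ p) ^+ l)%:E)%E).
    apply: lee_sum => l _; have [mG G0 IG _] := GP l.
    rewrite ge0_integralZl_EFin; [|exact: measurableT|by move=> x _; exact: G0|exact: mG|exact/exprn_ge0/ltW].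
    rewrite [leRHS]EFinM muleC; apply: lee_wpmul2r; first by rewrite lee_fin exprn_ge0// ltW.
    by rewrite EFinM -gI.
  rewrite sumEFin lee_fin.
  have KI : 0 <= KA * I by rewrite mulr_ge0// ltW.
  have := @geometric_le_lim R L (KA * I) (eta `^ p) KI zp0; rewrite gtr0_norm// => /(_ zp1).
  by rewrite mulrAC; apply: le_trans; rewrite /series/=.
have aE x : a x 0%N = mean mu (eball x0 (c * rho)) u.
  by rewrite /a /X expr0 mul1r subrr scale0r addr0.
set k1 := ((1 - eta)^-1 * (k0 * rho)) `^ p in aT.
have k10 : 0 <= k1 by exact: powR_ge0.
apply: (@le_trans _ _ (\int[mu]_(y in B) (k1%:E * T y))%E).
  apply: ge0_le_integral; [exact: mB| | | |].
  - by move=> y _; rewrite lee_fin powR_ge0.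
  - exact/measurable_EFinP/measurable_fun_powR/measurable_fun_normB.
  - by apply: measurable_funTS; apply: emeasurable_funM; [exact: measurable_cst|exact: mT].
  - by move=> y By; rewrite -(aE y); exact: aT.
rewrite ge0_integralZl_EFin; [|exact: mB|by move=> y _; exact: T0|exact: measurable_funTS|exact: k10].
apply: (@le_trans _ _ (k1%:E * \int[mu]_x T x)%E).
  rewrite lee_wpmul2l ?lee_fin//.
  apply: ge0_subset_integral; [exact: mB|exact: measurableT|exact: mT|by move=> y _; exact: T0|exact: subsetT].
apply: (@le_trans _ _ (k1%:E * (KA / (1 - eta `^ p) * I)%:E)%E).
  by rewrite lee_wpmul2l ?lee_fin.
rewrite -EFinM lee_fin /k1 mulrA [X in X `^ p]mulrA.
rewrite [(_ * _ * rho) `^ p]powRM ?(ltW rho0)//; last first.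
  by rewrite ltW// mulr_gt0// invr_gt0.
by rewrite le_eqVlt; apply/orP; left; apply/eqP; ring.
Qed.

(** [average_deviation] replaces the mean over the small central ball by the mean over B, at the
    cost of the factor 8^p. *)
Lemma poincare_strong : poincare_ineq p mu.
Proof.
have [K [c [K0 c0 c1 KP]]] := poincare_chain.
exists (8 `^ p * K) => [|x r phi r0 sphi [M phiM]].
  by rewrite mulr_gt0// powR_gt0.
have mr := mass_gt0 mu_gt0 mu_fin x r0.
set B := eball x r in sphi phiM *.
have mB : measurable B by exact: measurable_eball.
have mphi : measurable_fun B phi.
  by apply: smooth_on_measurable_fun; [exact: open_eball|].
have phi_i : mu.-integrable B (EFin \o phi).
  exact: (bounded_integrable mB (massE mu_fin x r) mphi phiM).
have I0 : (0 <= \int[mu]_(y in B) (enorm (grad phi y) `^ p)%:E)%E.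
  by apply: integral_ge0 => y _; rewrite lee_fin powR_ge0.
have K8 : 0 < 8 `^ p * K * r `^ p by rewrite !mulr_gt0 ?powR_gt0.
have [Iy|Ifin] := eqVneq (\int[mu]_(y in B) (enorm (grad phi y) `^ p)%:E)%E +oo%E.
  by rewrite Iy gt0_muley ?lte_fin// leey.
have {}Ifin : (\int[mu]_(y in B) (enorm (grad phi y) `^ p)%:E)%E \is a fin_num.
  by rewrite ge0_fin_numE// ltey.
set I := fine (\int[mu]_(y in B) (enorm (grad phi y) `^ p)%:E)%E.
have IE : (\int[mu]_(y in B) (enorm (grad phi y) `^ p)%:E = I%:E)%E by rewrite fineK.
have I0' : 0 <= I by rewrite -lee_fin -IE.
have main := KP phi x r M I r0 sphi phiM IE.
rewrite IE -EFinM.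
have g0 : 0 <= K * (r `^ p * I) / mass mu x r.
  by rewrite divr_ge0 ?(ltW mr)// mulr_ge0 ?(ltW K0)// mulr_ge0// powR_ge0.
have -> : 8 `^ p * K * r `^ p * I = 8 `^ p * (K * (r `^ p * I) / mass mu x r) * mass mu x r.
  by rewrite -[in RHS]mulrA divfK ?gt_eqF// !mulrA.
apply: le_powR_closure => // lam lam0 hl.
apply: (average_deviation mB mr (massE mu_fin x r) phi_i (ltW p_gt1) lam0).
apply: le_trans main _; rewrite lee_fin -ler_pdivrMr//.
Qed.

End poincare.

(** * Uniqueness of gradients *)

Lemma measurable_fun_limn_einf (d : measure_display) (T : measurableType d)
    (R : realType) (D : set T) (f : (T -> \bar R)^nat) :
  (forall n, measurable_fun D (f n)) ->
  measurable_fun D (fun x => limn_einf (f ^~ x)).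
Proof.
move=> mf; have mo n : measurable_fun D (fun x => - f n x)%E.
  by apply: measurableT_comp.
by apply: measurableT_comp => //; exact: measurable_fun_limn_esup mo.
Qed.

Section unique_gradient.
Context {R : realType} {n : nat}.
Variable mu : {measure set 'rV[R]_n -> \bar R}.
Hypothesis mu_gt0 : forall (x : 'rV[R]_n) (r : R), 0 < r -> (0 < mu (eball x r))%E.
Hypothesis mu_fin : forall (x : 'rV[R]_n) (r : R), (mu (eball x r) < +oo)%E.
Implicit Types (x y z : 'rV[R]_n) (r s lam : R) (u phi : 'rV[R]_n -> R).
Implicit Types (D : set 'rV[R]_n).

Lemma smooth_on_ecball_bounded D u x s : smooth_on D u -> ecball x s `<=` D ->
  exists M, forall y, ecball x s y -> `|u y| <= M.
Proof.
move=> su sD.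
have cu' : compact ((fun y => `|u y|) @` ecball x s).
  apply: continuous_compact; last exact: compact_ecball.
  apply: continuous_in_subspaceT => y /set_mem ys.
  apply: continuous_comp; last exact: norm_continuous.
  by have [] := su [::] y (sD _ ys).
have [M [_ MP]] := compact_bounded cu'.
have M1 : M < `|M| + 1 by rewrite ltr_pwDr ?ler_norm.
exists (`|M| + 1) => y yS.
by have := MP _ M1 _ (imageP (fun y => `|u y|) yS); rewrite /= normr_id.
Qed.

Lemma gradB D u v x : smooth_on D u -> smooth_on D v -> D x ->
  grad (fun y => u y - v y) x = grad u x - grad v x.
Proof.
move=> su sv Dx; apply/rowP => i; rewrite !mxE /partial.
have [_ /(_ i) du] := su [::] x Dx; have [_ /(_ i) dv] := sv [::] x Dx.
exact: (deriveB du dv).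
Qed.

(** With A = |grad phi x| > 0 and e the direction of the gradient, phi is affine near x up to A / 8
    per unit of distance. On the balls of radius r / 8 around x + (r / 2) e and x - (r / 2) e it
    therefore differs from phi x by at least A r / 4, with the expected sign, as 1/2 - 1/8 - 5/64 >=
    1/4. Given c, the ball is chosen on which phi - phi x has the sign of phi x - c. The 12 is (1/2
    + 1) / (1/8). *)
Lemma oscillation_ge_grad p K : 0 < p -> 0 < K ->
  (forall x y r s, 0 < s -> enorm (x - y) + r <= 12 * s -> mass mu x r <= K * mass mu y s) ->
  forall D phi x, open D -> smooth_on D phi -> D x ->
  exists2 d, 0 < d & forall r (c : R), 0 < r -> r < d ->
    (((r * enorm (grad phi x) / 4) `^ p * (mass mu x r / K))%:E <=
     \int[mu]_(y in eball x r) (`|phi y - c| `^ p)%:E)%E.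
Proof.
move=> p0 K0 KP D phi x oD sphi Dx.
set a := grad phi x; set A := enorm a.
have [A0|A0] := eqVneq A 0.
  exists 1 => // r c r0 _; rewrite A0 mulr0 mul0r powR0 ?gt_eqF// mul0r.
  by apply: integral_ge0 => y _; rewrite lee_fin powR_ge0.
have {}A0 : 0 < A by rewrite lt_neqAle eq_sym A0 enorm_ge0.
have A8 : 0 < A / 8 by rewrite divr_gt0.
have [d1 d10 dP] := first_order_expansion oD Dx sphi A8.
have [d2 d20 dD] := nbhs_eball (open_nbhs_nbhs (conj oD Dx)).
exists (Num.min d1 d2) => [|r c r0]; first by rewrite lt_min d10.
rewrite lt_min => /andP[rd1 rd2].
pose e := A^-1 *: a.
have e1 : enorm e = 1 by rewrite /e enormZ gtr0_norm ?invr_gt0// mulVf// gt_eqF.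
have ae : dot a e = A by rewrite /e dotZr dotrr expr2 mulrA mulVf ?mul1r// gt_eqF.
clearbody e.
have rD : eball x r `<=` D by apply: subset_trans dD; apply: le_eball; exact: ltW.
have key (sg : R) y : `|sg| = 1 -> enorm (y - (x + (sg * (r / 2)) *: e)) < r / 8 ->
    eball x r y /\ sg * (phi y - phi x) >= A * r / 4.
  move=> sg1 yz; set z := (sg * (r / 2)) *: e in yz.
  have zn : enorm z = r / 2.
    by rewrite enormZ e1 mulr1 normrM sg1 mul1r gtr0_norm// divr_gt0.
  have yxz : y - x = (y - (x + z)) + z by rewrite opprD addrA subrK.
  have yx : enorm (y - x) < 5 / 8 * r.
    by rewrite yxz (le_lt_trans (enormD _ _))// zn; lra.
  split; first by rewrite /eball/=; lra.
  have := dP y _; rewrite -/a => /(_ _)H.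
  have {}H : `|phi y - phi x - dot a (y - x)| <= A / 8 * (5 / 8 * r).
    apply: le_trans (H _) _; first by lra.
    by rewrite ler_pM2l// ltW.
  have dz : dot a (y - x) = dot a (y - (x + z)) + sg * (r / 2) * A.
    by rewrite {1}yxz [LHS]dotDr dotZr ae.
  have h1 : `|dot a (y - (x + z))| <= A * (r / 8).
    by rewrite (le_trans (normr_dot_le _ _))// ler_pM2l// ltW.
  have sg2 : sg * sg = 1 by rewrite -expr2 -real_normK ?num_real// sg1 expr1n.
  have h2 : `|sg * (phi y - phi x - dot a (y - x))| <= A / 8 * (5 / 8 * r).
    by rewrite normrM sg1 mul1r.
  have h3 : `|sg * dot a (y - (x + z))| <= A * (r / 8).
    by rewrite normrM sg1 mul1r.
  have -> : sg * (phi y - phi x) = sg * (phi y - phi x - dot a (y - x)) +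
      sg * dot a (y - (x + z)) + (sg * sg) * (r / 2 * A) by rewrite dz; ring.
  rewrite sg2 mul1r.
  move: h2 h3; rewrite !ler_norml => /andP[h2 _] /andP[h3 _].
  have : 0 < A * r by rewrite mulr_gt0.
  lra.
have [sg [sg1 sgc]] : exists sg : R, `|sg| = 1 /\ 0 <= sg * (phi x - c).
  have [xc|xc] := leP 0 (phi x - c).
    by exists 1; rewrite normr1 mul1r.
  by exists (-1); rewrite normrN1 mulN1r oppr_ge0; split => //; exact: ltW.
set z := x + (sg * (r / 2)) *: e in key *.
have r8 : 0 < r / 8 by rewrite divr_gt0.
have xz : enorm (x - z) = r / 2.
  rewrite /z opprD addrA subrr add0r enormN enormZ e1 mulr1 normrM sg1 mul1r.
  by rewrite gtr0_norm// divr_gt0.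
have mKz : mass mu x r / K <= mass mu z (r / 8).
  by rewrite ler_pdivrMr// mulrC; apply: KP => //; rewrite xz; lra.
have mz : measurable (eball z (r / 8)) by exact: measurable_eball.
have mB : measurable (eball x r) by exact: measurable_eball.
have zB : eball z (r / 8) `<=` eball x r by move=> y yz; have [] := key sg y sg1 yz.
have mphi : measurable_fun (eball x r) (fun y => `|phi y - c| `^ p).
  apply/measurable_fun_powR/measurable_fun_normB.
  by apply: smooth_on_measurable_fun; [exact: open_eball|exact: smooth_on_sub sphi].
apply: (@le_trans _ _ (\int[mu]_(y in eball z (r / 8)) (`|phi y - c| `^ p)%:E)%E); last first.
  apply: ge0_subset_integral; [exact: mz|exact: mB| | |exact: zB].
  - exact/measurable_EFinP.
  - by move=> y _; rewrite lee_fin powR_ge0.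
apply: (@le_trans _ _ (((r * A / 4) `^ p)%:E * mu (eball z (r / 8)))%E).
  by rewrite massE// -EFinM lee_fin ler_wpM2l ?powR_ge0.
rewrite -integral_cst; last exact: mz.
apply: le_integral_EFin; [exact: mz|exact: measurable_cst|exact: (measurable_funS mB zB mphi)|].
move=> y yz; rewrite powR_ge0/=; have [_ h] := key sg y sg1 yz.
have rA0 : 0 <= r * A / 4 by rewrite divr_ge0// mulr_ge0// ltW.
rewrite powR_le ?(ltW p0)//.
have -> : `|phi y - c| = `|sg * (phi y - c)| by rewrite normrM sg1 mul1r.
apply: le_trans (ler_norm _).
have -> : sg * (phi y - c) = sg * (phi y - phi x) + sg * (phi x - c) by ring.
by rewrite [r * A]mulrC; lra.
Qed.

Variables (p q C sigma : R).
Hypotheses (p_gt1 : 1 < p) (pq : p < q) (C_ge1 : 1 <= C) (sigma_ge1 : 1 <= sigma).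
Hypothesis SP : sobolev_poincare_ineq p q C sigma mu.
Variable KA : R.
Hypotheses (KA_gt0 : 0 < KA) (avg : averaging_bound mu KA).

Let p0 : 0 < p. Proof. exact: lt_trans p_gt1. Qed.
Let q0 : 0 < q. Proof. exact: lt_trans pq. Qed.
Let C0 : 0 < C. Proof. exact: lt_le_trans C_ge1. Qed.
Let s0 : 0 < sigma. Proof. exact: lt_le_trans sigma_ge1. Qed.

Lemma measurable_gradB D phi (v : 'rV[R]_n -> 'rV[R]_n) : open D -> smooth_on D phi ->
  (forall i, measurable_fun D (fun x => v x ord0 i)) ->
  measurable_fun D (fun x => enorm (grad phi x - v x)).
Proof.
move=> oD sphi mv; apply: measurable_fun_enorm => i.
rewrite (_ : (fun _ => _) = fun x => grad phi x 0 i - v x 0 i); last first.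
  by apply/funext => y; rewrite !mxE.
by apply: measurable_funB; [exact: measurable_grad|exact: mv].
Qed.

(* Comparing [phi] with [phi - psi], where [psi] is small, makes [grad phi - v] act
   as a gradient of [phi]. *)
Lemma grad_le_average : exists2 K : R, 0 < K &
  forall D phi (v : 'rV[R]_n -> 'rV[R]_n) x, open D -> smooth_on D phi -> D x ->
  (forall i, measurable_fun D (fun x => v x ord0 i)) ->
  (forall e : R, 0 < e -> exists psi, [/\ smooth_on D psi,
     (\int[mu]_(y in D) (`|psi y| `^ p)%:E <= e%:E)%E &
     (\int[mu]_(y in D) (enorm (grad psi y - v y) `^ p)%:E <= e%:E)%E]) ->
  exists2 d, 0 < d & forall s g, 0 < s -> s < d -> 0 < g ->
    (\int[mu]_(y in eball x s) (enorm (grad phi y - v y) `^ p)%:E <= (g * mass mu x s)%:E)%E ->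
    enorm (grad phi x) `^ p <= K * g.
Proof.
have [Cd Cd0 dbl] := poincare_doubling mu_gt0 mu_fin p_gt1 pq C_ge1 sigma_ge1 SP.
have [K K0 KP] := mass_comparable mu_fin Cd0 dbl 12.
have t0 : 0 < 2 `^ p :> R by exact: powR_gt0.
have f0 : 0 < 4 `^ p :> R by exact: powR_gt0.
have Cp0 : 0 < C `^ p by exact: powR_gt0.
exists (K * 4 `^ p * (2 `^ p * (2 * (C `^ p * (2 `^ p * 2)) + 1))).
  by rewrite !mulr_gt0// addr_gt0// !mulr_gt0.
move=> D phi v x oD sphi Dx mv psiP.
have [d1 d10 osc] := oscillation_ge_grad p0 K0 KP oD sphi Dx.
have [d2 d20 dD] := nbhs_eball (open_nbhs_nbhs (conj oD Dx)).
exists (Num.min d1 d2) => [|s g s0' ]; first by rewrite lt_min d10.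
rewrite lt_min => /andP[sd1 sd2] g0 Hg.
have cD : ecball x s `<=` D by apply: subset_trans dD; exact: ecball_eball.
have sD : eball x s `<=` D by apply: subset_trans cD; exact: eball_ecball.
(* The inequality is applied on radius r, so that its right-hand side lives on the given ball of
   radius s. *)
pose r := s / sigma.
have r0 : 0 < r by rewrite divr_gt0.
have rs : r <= s by rewrite ler_pdivrMr// ler_peMr// ltW.
have sr : sigma * r = s by rewrite /r mulrC divfK// gt_eqF.
clearbody r.
have rB : eball x r `<=` eball x s by exact: le_eball.
have mr := mass_gt0 mu_gt0 mu_fin x r0.
have ms := mass_gt0 mu_gt0 mu_fin x s0'.
have mBs : measurable (eball x s) by exact: measurable_eball.
have mBr : measurable (eball x r) by exact: measurable_eball.
have mD : measurable D by exact: open_measurable_rV.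
(* [psi] may depend on the ball, so its errors are made negligible at this scale: the first term
   serves the gradient on B(x, s), the second the function on B(x, r), where r^p matches the scaling
   of the inequality. *)
pose e := Num.min (g * mass mu x s) (r `^ p * g * mass mu x r).
have e0 : 0 < e by rewrite lt_min !mulr_gt0// powR_gt0.
have [psi [spsi psi1 psi2]] := psiP e e0.
pose f y := phi y - psi y.
have sf : smooth_on D f by exact: smooth_onB.
have [M fM] := smooth_on_ecball_bounded sf cD.
have mf A : A `<=` D -> measurable A -> measurable_fun A f.
  move=> AD mA; apply: (measurable_funS mD AD); exact: smooth_on_measurable_fun.
have f_i : mu.-integrable (eball x r) (EFin \o f).
  apply: (bounded_integrable mBr (massE mu_fin x r) (mf _ (subset_trans rB sD) mBr) (M := M)).
  by move=> y yr; apply: fM; exact/eball_ecball/rB.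
pose lam := (2 `^ p * 2 * g) `^ p^-1.
have lam0 : 0 < lam by rewrite powR_gt0// !mulr_gt0.
have lamE : lam `^ p = 2 `^ p * 2 * g by rewrite powR_invK// !mulr_ge0// ltW.
have mgB h : smooth_on D h -> measurable_fun D (fun y => enorm (grad h y - v y) `^ p).
  by move=> sh; apply: measurable_fun_powR; exact: measurable_gradB.
have Hf : (\int[mu]_(y in eball x (sigma * r)) (enorm (grad f y) `^ p)%:E <=
      (lam `^ p * mass mu x (sigma * r))%:E)%E.
  rewrite sr lamE.
  apply: (@le_trans _ _ ((2 `^ p)%:E * \int[mu]_(y in eball x s) (enorm (grad phi y - v y) `^ p)%:E +
    (2 `^ p)%:E * \int[mu]_(y in eball x s) (enorm (grad psi y - v y) `^ p)%:E)%E).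
    apply: le_integral_lincomb; [exact: mBs| | | |exact: ltW|exact: ltW| | |].
    - exact: (measurable_funS mD sD (mgB _ sphi)).
    - exact: (measurable_funS mD sD (mgB _ spsi)).
    - by apply: (measurable_funS mD sD); exact: measurable_enorm_grad.
    - by move=> y _; exact: powR_ge0.
    - by move=> y _; exact: powR_ge0.
    - move=> y ys; rewrite powR_ge0/= (gradB sphi spsi (sD _ ys)) -mulrDr.
      apply: le_trans (powRD_le (ltW p0) (enorm_ge0 _) (enorm_ge0 _)).
      rewrite powR_le ?enorm_ge0 ?(ltW p0)//.
      rewrite [X in _ <= _ + X]enormB; apply: le_trans (enormD _ _).
      by rewrite addrA subrK.
  apply: (@le_trans _ _ ((2 `^ p)%:E * (g * mass mu x s)%:E + (2 `^ p)%:E * (g * mass mu x s)%:E)%E).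
    have t0' : (0 <= (2 `^ p)%:E :> \bar R)%E by rewrite lee_fin ltW.
    apply: leeD; apply: (lee_wpmul2l t0'); first exact: Hg.
    apply: (@le_trans _ _ e%:E); last by rewrite lee_fin ge_min lexx.
    apply: le_trans psi2; apply: ge0_subset_integral; [exact: mBs|exact: mD| | |exact: sD].
    - exact/measurable_EFinP/mgB.
    - by move=> y _; rewrite lee_fin powR_ge0.
  by rewrite -!EFinM -EFinD lee_fin le_eqVlt; apply/orP; left; apply/eqP; ring.
have sfr : smooth_on (eball x (sigma * r)) f by rewrite sr; exact: smooth_on_sub sf.
have := (sobolev_poincareP mu_gt0 mu_fin p0 q0 C0 s0).1 SP x r f r0 sfr f_i lam lam0 Hf.
set c := mean _ _ _ => main.
have crl : 0 < C * r * lam by rewrite !mulr_gt0.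
have mfr := mf _ (subset_trans rB sD) mBr.
have := integral_powR_exponent_le mBr (massE mu_fin x r) (measurable_fun_normB c mfr)
  (fun _ _ => normr_ge0 _) p0 (ltW pq) crl main.
move=> {}main.
have hphi : (\int[mu]_(y in eball x r) (`|phi y - c| `^ p)%:E <=
   (2 `^ p * (2 * (C * r * lam) `^ p * mass mu x r) + 2 `^ p * (r `^ p * g * mass mu x r))%:E)%E.
  have mpsi : measurable_fun D (fun y => `|psi y| `^ p).
    apply: measurable_fun_powR; apply: measurableT_comp => //.
    exact: smooth_on_measurable_fun.
  apply: (@le_trans _ _ ((2 `^ p)%:E * \int[mu]_(y in eball x r) (`|f y - c| `^ p)%:E +
    (2 `^ p)%:E * \int[mu]_(y in eball x r) (`|psi y| `^ p)%:E)%E).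
    apply: le_integral_lincomb; [exact: mBr| | | |exact: ltW|exact: ltW| | |].
    - exact/measurable_fun_powR/measurable_fun_normB.
    - exact: (measurable_funS mD (subset_trans rB sD) mpsi).
    - apply/measurable_fun_powR/measurable_fun_normB.
      by apply: (measurable_funS mD (subset_trans rB sD)); exact: smooth_on_measurable_fun.
    - by move=> y _; exact: powR_ge0.
    - by move=> y _; exact: powR_ge0.
    - move=> y yr; rewrite powR_ge0/= -mulrDr.
      apply: le_trans (powRD_le (ltW p0) (normr_ge0 _) (normr_ge0 _)).
      rewrite powR_le ?(ltW p0)//; apply: le_trans (ler_normD _ _).
      by rewrite /f addrAC subrK.
  have t0' : (0 <= (2 `^ p)%:E :> \bar R)%E by rewrite lee_fin ltW.
  rewrite EFinD [X in (_ <= X + _)%E]EFinM [X in (_ <= _ + X)%E]EFinM.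
  apply: leeD; apply: (lee_wpmul2l t0'); first exact: main.
  apply: (@le_trans _ _ e%:E); last by rewrite lee_fin ge_min lexx orbT.
  apply: le_trans psi1; apply: ge0_subset_integral; [exact: mBr|exact: mD| | |exact: (subset_trans rB sD)].
  - exact/measurable_EFinP.
  - by move=> y _; rewrite lee_fin powR_ge0.
have rd : r < d1 by exact: le_lt_trans sd1.
have := le_trans (osc r c r0 rd) hphi; rewrite lee_fin.
set A := enorm (grad phi x) => fin.
have A0 : 0 <= A by exact: enorm_ge0.
have rp : 0 < r `^ p by exact: powR_gt0.
move: fin; rewrite !powRM ?invr_ge0 ?mulr_ge0 ?(ltW C0) ?(ltW r0) ?(ltW lam0)//.
rewrite lamE -powR_inv1// -powRrM mulN1r powRN.
set m := mass mu x r in mr *.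
(* Both sides carry the factor r^p * m; cancelling it leaves a constant independent of the
   radius. *)
have -> : r `^ p * A `^ p * (4 `^ p)^-1 * (m / K) = (r `^ p * m) * (A `^ p / (K * 4 `^ p)).
  by field; rewrite !gt_eqF.
have -> : 2 `^ p * (2 * (C `^ p * r `^ p * (2 `^ p * 2 * g)) * m) + 2 `^ p * (r `^ p * g * m) =
  (r `^ p * m) * (2 `^ p * (2 * (C `^ p * (2 `^ p * 2)) + 1) * g) by ring.
rewrite ler_pM2l ?mulr_gt0// ler_pdivrMr ?mulr_gt0// => /le_trans; apply.
by rewrite le_eqVlt; apply/orP; left; apply/eqP; ring.
Qed.

Lemma limn_einf_ge (h : nat -> \bar R) (y : \bar R) N :
  (forall l, (N <= l)%N -> (y <= h l)%E) -> (y <= limn_einf h)%E.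
Proof.
move=> yh; rewrite limn_einf_lim; apply: lime_ge; first exact: is_cvg_einfs.
exists N => // k /= Nk; apply: le_ereal_inf_tmp => _ [l /= kl <-].
exact/yh/(leq_trans Nk).
Qed.

Lemma limn_einf_le (h : nat -> \bar R) (y : \bar R) :
  (forall l, (h l <= y)%E) -> (limn_einf h <= y)%E.
Proof.
move=> yh; rewrite limn_einf_lim; apply: lime_le; first exact: is_cvg_einfs.
apply: nearW => k; apply: le_trans (yh k).
by apply: ereal_inf_lbound; exists k => /=.
Qed.

(** [grad_le_average] holds at every point of D for all small radii. With radii 1 / (l + 1) it
    bounds |grad phi x|^p by a multiple of the lower limit of [G l x], and Fatou's lemma keeps the
    L^1 bound, which is uniform in l. *)
Lemma integral_grad_le : exists2 K : R, 0 < K &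
  forall D phi (v : 'rV[R]_n -> 'rV[R]_n), open D -> smooth_on D phi ->
  (forall i, measurable_fun D (fun x => v x ord0 i)) ->
  (forall e : R, 0 < e -> exists psi, [/\ smooth_on D psi,
     (\int[mu]_(y in D) (`|psi y| `^ p)%:E <= e%:E)%E &
     (\int[mu]_(y in D) (enorm (grad psi y - v y) `^ p)%:E <= e%:E)%E]) ->
  (\int[mu]_(y in D) (enorm (grad phi y) `^ p)%:E <=
    K%:E * \int[mu]_(y in D) (enorm (grad phi y - v y) `^ p)%:E)%E.
Proof.
have [K K0 KP] := grad_le_average.
exists (K * KA) => [|D phi v oD sphi mv psiP]; first by rewrite mulr_gt0.
have mD : measurable D by exact: open_measurable_rV.
pose g := (fun y => (enorm (grad phi y - v y) `^ p)%:E) \_ D.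
have g0 y : (0 <= g y)%E.
  by rewrite /g patchE; case: ifP => // _; rewrite lee_fin powR_ge0.
have mg : measurable_fun setT g.
  apply/(measurable_restrictT _ mD)/measurable_EFinP/measurable_fun_powR.
  exact: measurable_gradB.
have gE : (\int[mu]_(y in D) (enorm (grad phi y - v y) `^ p)%:E = \int[mu]_y g y)%E.
  by rewrite /g -integral_mkcond.
rewrite gE.
have l1 (l : nat) : 0 < l.+1%:R^-1 :> R by rewrite invr_gt0 ltr0n.
have /choice[G GP] := fun l => avg (l1 l) mg g0.
have mG l : measurable_fun D (G l) by have [mG _ _ _] := GP l; exact: measurable_funTS.
have G0 l x : (0 <= G l x)%E by have [_] := GP l.
have pt x : D x -> ((enorm (grad phi x) `^ p)%:E <= K%:E * limn_einf (G^~ x))%E.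
  move=> Dx; have [d d0 dP] := KP D phi v x oD sphi Dx mv psiP.
  have [d2 d20 dD] := nbhs_eball (open_nbhs_nbhs (conj oD Dx)).
  have dd : 0 < Num.min d d2 by rewrite lt_min d0.
  have [N Nd] : exists N : nat, forall l, (N <= l)%N -> l.+1%:R^-1 < Num.min d d2.
    exists (Num.truncn (Num.min d d2)^-1) => l Nl.
    rewrite invf_plt ?posrE ?ltr0n//.
    by apply: lt_le_trans (truncnS_gt _) _; rewrite ler_nat ltnS.
  have : ((K^-1 * enorm (grad phi x) `^ p)%:E <= limn_einf (G^~ x))%E.
    apply: (@limn_einf_ge _ _ N) => l Nl.
    have := Nd l Nl; rewrite lt_min => /andP[ld ld2].
    have [Gy|Gfin] := eqVneq (G l x) +oo%E; first by rewrite Gy leey.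
    have {}Gfin : G l x \is a fin_num by rewrite ge0_fin_numE// ltey.
    rewrite -(fineK Gfin) lee_fin ler_pdivrMl//.
    have Gf0 : 0 <= fine (G l x) by rewrite fine_ge0.
    apply/ler_addgt0Pr => e e0.
    have ge0 : 0 < fine (G l x) + e / K by rewrite ltr_wpDl// divr_gt0.
    have -> : K * fine (G l x) + e = K * (fine (G l x) + e / K).
      by rewrite mulrDr mulrCA divff ?mulr1// gt_eqF.
    apply: (dP _ _ (l1 l) ld ge0).
    have [_ _ _ GB] := GP l.
    rewrite (eq_integral g); last first.
      move=> y /set_mem yx; rewrite /g patchE mem_set//.
      by apply: dD; apply: le_eball yx; exact: ltW.
    apply: le_trans (GB x x _) _; first by rewrite subrr enorm0 ltW.
    rewrite -{1}(fineK Gfin) -EFinM lee_fin mulrC ler_pM2r; last exact: mass_gt0.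
    by rewrite lerDl divr_ge0// ltW.
  by rewrite EFinM lee_pdivrMl.
have einf0 x : (0 <= limn_einf (G^~ x))%E by apply: (@limn_einf_ge _ _ 0%N) => l _.
have mlim : measurable_fun D (fun x => limn_einf (G^~ x)).
  exact: measurable_fun_limn_einf.
apply: (@le_trans _ _ (\int[mu]_(x in D) (K%:E * limn_einf (G^~ x)))%E).
  apply: ge0_le_integral; [exact: mD| | | |exact: pt].
  - by move=> y _; rewrite lee_fin powR_ge0.
  - exact/measurable_EFinP/measurable_enorm_grad.
  - by apply: emeasurable_funM; [exact: measurable_cst|exact: mlim].
rewrite ge0_integralZl_EFin; [|exact: mD|by move=> x _; exact: einf0|exact: mlim|exact: ltW].
rewrite EFinM -muleA; apply: lee_wpmul2l; first by rewrite lee_fin ltW.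
apply: le_trans (fatou mu mD mG (fun l x _ => G0 l x)) _.
apply: limn_einf_le => l; have [mGl _ IG _] := GP l.
apply: le_trans IG; apply: ge0_subset_integral; [exact: mD|exact: measurableT|exact: mGl| |exact: subsetT].
by move=> x _; exact: G0.
Qed.

Lemma poincare_unique_gradient : unique_gradient p mu.
Proof.
move=> D phi v oD sphi mv _ phi0 gphi0.
have [K K0 KP] := integral_grad_le.
have mD : measurable D by exact: open_measurable_rV.
have small e : 0 < e -> exists k, (\int[mu]_(x in D) (`|phi k x| `^ p)%:E <= e%:E)%E /\
    (\int[mu]_(x in D) (enorm (grad (phi k) x - v x) `^ p)%:E <= e%:E)%E.
  move=> e0.
  have e0' : (0 < e%:E)%E by rewrite lte_fin.
  have near_le (h : nat -> \bar R) : h @ \oo --> 0%E -> \forall k \near \oo, (h k <= e%:E)%E.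
    move=> h0; have := h0 [set y | (y < e%:E)%E]; rewrite /nbhs/= => H.
    apply: filterS (H _); first by move=> k /ltW.
    by apply: open_nbhs_nbhs; split; first exact: open_ereal_lt.
  have [N1 _ N1P] := near_le _ phi0; have [N2 _ N2P] := near_le _ gphi0.
  exists (maxn N1 N2); split; first by apply: N1P => /=; exact: leq_maxl.
  by apply: N2P => /=; exact: leq_maxr.
(* The terms of the sequence serve as comparison functions for each other, so [integral_grad_le]
   applies to every [phi k]. *)
have psiP e : 0 < e -> exists psi, [/\ smooth_on D psi,
     (\int[mu]_(y in D) (`|psi y| `^ p)%:E <= e%:E)%E &
     (\int[mu]_(y in D) (enorm (grad psi y - v y) `^ p)%:E <= e%:E)%E].
  by move=> /small[k [k1 k2]]; exists (phi k).
have mv' : measurable_fun D (fun x => enorm (v x) `^ p).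
  exact/measurable_fun_powR/measurable_fun_enorm.
have v0 : (\int[mu]_(x in D) (enorm (v x) `^ p)%:E = 0)%E.
  apply/eqP; rewrite eq_le integral_ge0 ?andbT; last first.
    by move=> x _; rewrite lee_fin powR_ge0.
  apply/lee_addgt0Pr => e e0; rewrite add0e.
  have t0 : 0 < 2 `^ p :> R by exact: powR_gt0.
  (* The integral of |v|^p is at most 2^p times those of |grad (phi k)|^p and |grad (phi k) - v|^p
     together, and the first of these is at most K times the second. *)
  have e1 : 0 < e / (2 `^ p * (K + 1)) by rewrite divr_gt0// mulr_gt0// addr_gt0.
  have [k [_ k2]] := small _ e1.
  have mg1 := measurable_enorm_grad p oD (sphi k).
  have mg2 : measurable_fun D (fun x => enorm (grad (phi k) x - v x) `^ p).
    by apply: measurable_fun_powR; exact: measurable_gradB.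
  apply: (@le_trans _ _ ((2 `^ p)%:E * \int[mu]_(y in D) (enorm (grad (phi k) y) `^ p)%:E +
    (2 `^ p)%:E * \int[mu]_(y in D) (enorm (grad (phi k) y - v y) `^ p)%:E)%E).
    apply: le_integral_lincomb; [exact: mD|exact: mg1|exact: mg2|exact: mv'|exact: ltW|exact: ltW| | |].
    - by move=> y _; exact: powR_ge0.
    - by move=> y _; exact: powR_ge0.
    - move=> y ys; rewrite powR_ge0/= -mulrDr.
      apply: le_trans (powRD_le (ltW p0) (enorm_ge0 _) (enorm_ge0 _)).
      rewrite powR_le ?enorm_ge0 ?(ltW p0)//.
      rewrite [X in _ <= _ + X]enormB; apply: le_trans (enormD _ _).
      by rewrite addrC subrK.
  apply: (@le_trans _ _ ((2 `^ p)%:E * (K%:E * (e / (2 `^ p * (K + 1)))%:E) +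
     (2 `^ p)%:E * (e / (2 `^ p * (K + 1)))%:E)%E).
    have t0' : (0 <= (2 `^ p)%:E :> \bar R)%E by rewrite lee_fin ltW.
    apply: leeD; apply: (lee_wpmul2l t0'); last exact: k2.
    apply: le_trans (KP D (phi k) v oD (sphi k) mv psiP) _.
    by apply: lee_wpmul2l k2; rewrite lee_fin ltW.
  rewrite -!EFinM -EFinD lee_fin le_eqVlt; apply/orP; left; apply/eqP.
  by field; rewrite !gt_eqF// addr_gt0.
have : (\int[mu]_(x in D) `|(enorm (v x) `^ p)%:E| = 0)%E.
  by under eq_integral do rewrite gee0_abs ?lee_fin ?powR_ge0//.
have mv2 : measurable_fun D (fun x => (enorm (v x) `^ p)%:E) by exact/measurable_EFinP.
move/(ae_eq_integral_abs mu mD mv2).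
apply: filterS => x H Dx; have := H Dx => /= -[] /powR_eq0_eq0.
exact: enorm_eq0.
Qed.

End unique_gradient.

(** * The converse *)

Section admissible_sobolev_poincare.
Context {R : realType} {n : nat}.
Variable mu : {measure set 'rV[R]_n -> \bar R}.
Hypothesis mu_gt0 : forall (x : 'rV[R]_n) (r : R), 0 < r -> (0 < mu (eball x r))%E.
Hypothesis mu_fin : forall (x : 'rV[R]_n) (r : R), (mu (eball x r) < +oo)%E.
Implicit Types (x y z : 'rV[R]_n) (r s lam : R) (u : 'rV[R]_n -> R).

(** The values of u outside the ball of radius b are arbitrary. The product is smooth on that ball
    and is 0 off the closed ball of radius a; as a < b, these two open sets cover the space. *)
Lemma smooth_on_mul_cutoff u x a b (eta : 'rV[R]_n -> R) : a < b ->
  smooth_on (eball x b) u -> smooth_on setT eta ->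
  (forall y, a <= enorm (y - x) -> eta y = 0) ->
  smooth_on setT (fun y => u y * eta y).
Proof.
move=> ab su se e0.
have oU : open (~` ecball x a) by apply: closed_openC; exact: closed_ecball.
have s1 : smooth_on (eball x b) (fun y => u y * eta y).
  by apply: smooth_onM; [exact: open_eball|exact: su|exact: smooth_on_sub se].
have s2 : smooth_on (~` ecball x a) (fun y => u y * eta y).
  apply: (smooth_on_eq oU _ (@smooth_on_cst _ _ _ 0)) => y /negP.
  by rewrite -ltNge => /ltW/e0 ->; rewrite mulr0.
apply: smooth_on_sub (smooth_onU s1 s2) => y _.
by have [ya|ya] := pselect (ecball x a y); [left; exact: ecball_eball ya|right].
Qed.

Lemma gradM D u v y : smooth_on D u -> smooth_on D v -> D y ->
  grad (fun z => u z * v z) y = u y *: grad v y + v y *: grad u y.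
Proof.
move=> su sv Dy; apply/rowP => i; rewrite !mxE.
have [_ /(_ i) du] := su [::] y Dy; have [_ /(_ i) dv] := sv [::] y Dy.
exact: (partialM du dv).
Qed.

Lemma admissible_sobolev_poincare p : 1 < p -> doubling mu ->
  sobolev_ineq p mu -> poincare_ineq p mu ->
  exists q C sigma : R, [/\ p < q, 1 <= C, 1 <= sigma &
    sobolev_poincare_ineq p q C sigma mu].
Proof.
move=> p1 /(doublingP mu_fin)[D D0 dbl] [kappa [C3 [kappa1 C30 III]]] [C4 C40 IV].
have p0 : 0 < p by exact: lt_trans p1.
set q := kappa * p in III.
have pq : p < q by rewrite /q ltr_pMl.
have q0 : 0 < q by exact: lt_trans pq.
have q1 : 1 <= q by exact/ltW/(lt_trans p1).
clearbody q.
have [K K0 KP] := @cutoff_exists R n.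
have t0 : 0 < 2 `^ p :> R by exact: powR_gt0.
have k40 : 0 < (4 * K) `^ p by rewrite powR_gt0// mulr_gt0.
(* For phi = (u - M) * eta one has |grad phi| <= (2 K / r) * |u - M| + |grad u|. (IV) on radius 2 r
   turns the first term into C4 * (4 K)^p times the energy of u; D compares the masses for radii 3 r
   and 2 r, and 2^p comes from [powRD_le]. *)
pose kp := 2 `^ p * D * (C4 * (4 * K) `^ p + 1).
have kp0 : 0 < kp by rewrite !mulr_gt0// addr_gt0// mulr_gt0.
pose k := kp `^ p^-1.
have k0 : 0 < k by rewrite powR_gt0.
have kE : k `^ p = kp by rewrite powR_invK// ltW.
have Dq : 0 < D `^ q^-1 by rewrite powR_gt0.
clearbody k.
(* The 16 is the 8 of [average_deviation] times the 2 of the radius 2 r, and D^(1/q) comes from the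
   masses for 2 r and r. The summand 1 ensures C >= 1. *)
pose C := 1 + 16 * C3 * k * D `^ q^-1.
have C16 : 0 < 16 * C3 * k * D `^ q^-1 by rewrite !mulr_gt0.
have C0 : 0 < C by rewrite addr_gt0.
(* (IV) concerns bounded functions. With sigma = 3, u is smooth on a neighborhood of the closed ball
   of radius 2 r, hence bounded on the open one. *)
exists q, C, 3; split; [by []|by rewrite lerDl ltW|by rewrite ler1n|].
apply/(sobolev_poincareP mu_gt0 mu_fin p0 q0 C0) => [//|].
move=> x r u r0 su ui lam lam0 H.
have r20 : 0 < 2 * r by rewrite mulr_gt0.
have mr := mass_gt0 mu_gt0 mu_fin x r0.
have m2 := mass_gt0 mu_gt0 mu_fin x r20.
set B2 := eball x (2 * r).
have mB2 : measurable B2 by exact: measurable_eball.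
have mB : measurable (eball x r) by exact: measurable_eball.
have mB3 : measurable (eball x (3 * r)) by exact: measurable_eball.
have B23 : B2 `<=` eball x (3 * r) by apply: le_eball; lra.
have BB2 : eball x r `<=` B2 by apply: le_eball; lra.
have su2 : smooth_on B2 u by exact: smooth_on_sub su.
have muB2 : measurable_fun B2 u by apply: smooth_on_measurable_fun; [exact: open_eball|].
have [M0 uM0] : exists M, forall y, ecball x (2 * r) y -> `|u y| <= M.
  by apply: smooth_on_ecball_bounded su _; apply: ecball_eball; lra.
have uM y : B2 y -> `|u y| <= M0 by move=> /ltW; exact: uM0.
set M := mean mu B2 u.
have [eta [eta1 eta2 eta3 eta4 eta5]] : exists eta : 'rV[R]_n -> R,
  [/\ smooth_on setT eta, (forall y, 0 <= eta y <= 1),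
     (forall y, enorm (y - x) <= r -> eta y = 1),
     (forall y, 3 / 2 * r <= enorm (y - x) -> eta y = 0 /\ grad eta y = 0) &
     (forall y, enorm (grad eta y) <= 2 * K / r)].
  (* The cutoff ends strictly inside the ball of radius 2 r, which gives compact support there, as
     (III) demands. *)
  have r1 : r < 3 / 2 * r by lra.
  have [eta [e1 e2 e3 e4 e5]] := KP x (3 / 2 * r) r r0 r1.
  exists eta; split => // y; apply: le_trans (e5 y) _.
  rewrite le_eqVlt; apply/orP; left; apply/eqP.
  have -> : 3 / 2 * r - r = r / 2 by field.
  by field; rewrite gt_eqF.
pose v y := u y - M.
have o3 : open (eball x (3 * r)) by exact: open_eball.
have sv : smooth_on (eball x (3 * r)) v.
  by apply: smooth_onB; [|exact: su|exact: smooth_on_cst].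
pose phi y := v y * eta y.
have sphi : smooth_on setT phi.
  apply: (@smooth_on_mul_cutoff v x (3 / 2 * r) (3 * r)) => //; first by lra.
  by move=> y /eta4[].
have suppB : supp phi `<=` ecball x (3 / 2 * r).
  rewrite /supp ((closure_id _).1 (@closed_ecball R n x (3 / 2 * r))).
  apply: closure_subset => y /=; apply: contraNP => /negP; rewrite -ltNge => ya.
  by have [e0 _] := eta4 y (ltW ya); rewrite /phi e0 mulr0.
have cphi : smooth_compact_supp B2 phi.
  split; [exact: sphi| |].
    apply: subclosed_compact (@compact_ecball R n x (3 / 2 * r)) suppB.
    exact: closed_closure.
  by apply: subset_trans suppB _; apply: ecball_eball; lra.
have gradv y : eball x (3 * r) y -> grad v y = grad u y.
  move=> yB; rewrite (gradB su (@smooth_on_cst _ _ _ M) yB).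
  rewrite (_ : grad (fun=> M) y = 0) ?subr0//.
  by apply/rowP => i; rewrite !mxE partial_cst.
have mgu : measurable_fun B2 (fun y => enorm (grad u y) `^ p).
  by apply: measurable_enorm_grad; [exact: open_eball|].
have Iu : (\int[mu]_(y in B2) (enorm (grad u y) `^ p)%:E <= (lam `^ p * D * mass mu x (2 * r))%:E)%E.
  apply: (@le_trans _ _ (lam `^ p * mass mu x (3 * r))%:E).
    apply: le_trans H; apply: ge0_subset_integral; [exact: mB2|exact: mB3| | |exact: B23].
    - by apply/measurable_EFinP/measurable_enorm_grad.
    - by move=> y _; rewrite lee_fin powR_ge0.
  rewrite lee_fin -mulrA ler_pM2l ?powR_gt0//.
  apply: le_trans (dbl _ _ r20); apply: mass_le => //.
  by apply: le_eball; lra.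
have Iv : (\int[mu]_(y in B2) (`|v y| `^ p)%:E <=
    (C4 * (2 * r) `^ p * (lam `^ p * D * mass mu x (2 * r)))%:E)%E.
  apply: le_trans (IV x (2 * r) u r20 su2 (ex_intro _ M0 uM)) _.
  by rewrite [leRHS]EFinM lee_wpmul2l// lee_fin mulr_ge0 ?powR_ge0// ltW.
have mv : measurable_fun B2 (fun y => `|v y| `^ p).
  exact/measurable_fun_powR/measurable_fun_normB.
have Iphi : (\int[mu]_(y in B2) (enorm (grad phi y) `^ p)%:E <=
    ((k * lam) `^ p * mass mu x (2 * r))%:E)%E.
  apply: (@le_trans _ _ ((2 `^ p * (2 * K / r) `^ p)%:E * \int[mu]_(y in B2) (`|v y| `^ p)%:E +
    (2 `^ p)%:E * \int[mu]_(y in B2) (enorm (grad u y) `^ p)%:E)%E).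
    apply: le_integral_lincomb; [exact: mB2|exact: mv|exact: mgu| | |exact: ltW| | |].
    - apply: measurable_enorm_grad; [exact: open_eball|exact: smooth_on_sub sphi].
    - by rewrite mulr_ge0 ?powR_ge0.
    - by move=> y _; exact: powR_ge0.
    - by move=> y _; exact: powR_ge0.
    - move=> y yB; rewrite powR_ge0/= -[X in X + _]mulrA -mulrDr.
      rewrite -powRM//; last by rewrite divr_ge0 ?mulr_ge0 ?(ltW K0) ?(ltW r0).
      have h0 : 0 <= 2 * K / r * `|v y| by rewrite mulr_ge0// divr_ge0 ?mulr_ge0 ?(ltW K0) ?(ltW r0).
      apply: le_trans (powRD_le (ltW p0) h0 (enorm_ge0 _)).
      rewrite powR_le ?enorm_ge0 ?(ltW p0)//.
      have y3 := B23 _ yB.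
      rewrite /phi (gradM sv (smooth_on_sub (@subsetT _ _) eta1) y3) gradv//.
      apply: le_trans (enormD _ _) _; rewrite !enormZ; apply: lerD.
        by rewrite mulrC ler_wpM2r.
      have /andP[ey0 ey1] := eta2 y.
      by rewrite ger0_norm// ler_piMl ?enorm_ge0.
  apply: (@le_trans _ _ ((2 `^ p * (2 * K / r) `^ p)%:E * (C4 * (2 * r) `^ p * (lam `^ p * D * mass mu x (2 * r)))%:E +
    (2 `^ p)%:E * (lam `^ p * D * mass mu x (2 * r))%:E)%E).
    apply: leeD; apply: lee_wpmul2l; [|exact: Iv| |exact: Iu].
      by rewrite lee_fin mulr_ge0 ?powR_ge0.
    by rewrite lee_fin ltW.
  rewrite -!EFinM -EFinD lee_fin le_eqVlt; apply/orP; left; apply/eqP.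
  rewrite (powRM _ (ltW k0) (ltW lam0)) kE /kp.
  have -> : (4 * K) `^ p = (2 * K / r) `^ p * (2 * r) `^ p.
    rewrite -powRM; [|by rewrite divr_ge0 ?mulr_ge0 ?(ltW K0) ?(ltW r0)|exact: ltW].
    by congr (_ `^ _); field; rewrite gt_eqF.
  ring.
have Iq : (\int[mu]_(y in B2) (`|phi y| `^ q)%:E <=
    ((C3 * (2 * r) * (k * lam)) `^ q * mass mu x (2 * r))%:E)%E.
  have ig (f : 'rV[R]_n -> R) t : (0 <= \int[mu]_(y in B2) (f y `^ t)%:E)%E.
    by apply: integral_ge0 => y _; rewrite lee_fin powR_ge0.
  have := III x (2 * r) phi r20 cphi; rewrite /emean !massE//.
  move=> /(norm_ineqP m2 m2 (mulr_gt0 C30 r20) p0 q0 (ig _ _) (ig _ _)) => h.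
  exact: h (mulr_gt0 k0 lam0) Iphi.
pose L := C3 * (2 * r) * (k * lam) * D `^ q^-1.
have L0 : 0 < L by rewrite !mulr_gt0.
have IB : (\int[mu]_(y in eball x r) (`|u y - M| `^ q)%:E <= (L `^ q * mass mu x r)%:E)%E.
  rewrite (eq_integral (fun y => (`|phi y| `^ q)%:E)); last first.
    by move=> y /set_mem yB; rewrite /phi eta3 ?mulr1//; exact: ltW.
  apply: (@le_trans _ _ (\int[mu]_(y in B2) (`|phi y| `^ q)%:E)%E).
    apply: ge0_subset_integral; [exact: mB|exact: mB2| | |exact: BB2].
    - apply/measurable_EFinP/measurable_fun_powR; apply: measurableT_comp => //.
      by apply: smooth_on_measurable_fun; [exact: open_eball|exact: smooth_on_sub sphi].
    - by move=> y _; rewrite lee_fin powR_ge0.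
  apply: le_trans Iq _; rewrite lee_fin /L [leRHS](_ : _ =
     (C3 * (2 * r) * (k * lam)) `^ q * (D * mass mu x r)); last first.
    rewrite powRM ?powR_ge0//; last by rewrite ltW// !mulr_gt0.
    by rewrite (powR_invK q0 (ltW D0)) [RHS]mulrA.
  by rewrite ler_pM2l ?dbl// powR_gt0// !mulr_gt0.
apply: le_trans (average_deviation mB mr (massE mu_fin x r) ui q1 L0 IB) _.
rewrite lee_fin ler_pM2r//; apply: powR_le; [exact: ltW|by rewrite mulr_ge0// ltW|].
have -> : 8 * L = 16 * C3 * k * D `^ q^-1 * r * lam by rewrite /L; ring.
by rewrite ler_pM2r// ler_pM2r// lerDr.
Qed.

End admissible_sobolev_poincare.

(** * The weighted measure *)

Section weighted_measure.
Context {R : realType} {n : nat} (w : 'rV[R]_n -> \bar R).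
Hypothesis w_loc : locally_integrable_rV w.
Hypothesis w_gt0 : forall x, (0 < w x)%E.
Local Open Scope ereal_scope.

Let w_meas : measurable_fun setT w.
Proof. by case: w_loc. Qed.

Let w_ge0 x : 0 <= w x.
Proof. exact/ltW/w_gt0. Qed.

Let weighted0 : weighted w set0 = 0.
Proof. exact: integral_set0. Qed.

Let weighted_ge0 A : 0 <= weighted w A.
Proof. by apply: integral_ge0 => x _; exact: w_ge0. Qed.

Let weighted_sigma_additive : semi_sigma_additive (weighted w).
Proof.
move=> F mF tF mUF; rewrite /weighted ge0_integral_bigcup//; last first.
  exact: measurable_funS w_meas.
by apply: is_cvg_nneseries => k _ _; exact: weighted_ge0.
Qed.

Lemma weighted_eball_fin x r : weighted w (eball x r) < +oo.
Proof.
have [_ /(_ _ (@compact_ecball R n x r))] := w_loc; apply: le_lt_trans.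
under [leRHS]eq_integral do rewrite gee0_abs//.
apply: ge0_subset_integral => //.
- exact: measurable_eball.
- rewrite -[ecball x r]setCK; apply/measurableC/open_measurable_rV/closed_openC.
  exact: closed_ecball.
- exact: measurable_funS w_meas.
- exact: eball_ecball.
Qed.

(** If the integral vanished, w would be 0 almost everywhere on the ball; as w > 0, the ball would
    be a Lebesgue null set. *)
Lemma weighted_eball_gt0 x r : (0 < r)%R -> 0 < weighted w (eball x r).
Proof.
move=> r0; rewrite lt_neqAle weighted_ge0 andbT eq_sym; apply/eqP => w0.
have mB := measurable_eball x r.
have : \int[lebesgue_rV]_(y in eball x r) `|w y| = 0.
  by under eq_integral do rewrite gee0_abs//.
move=> /(ae_eq_integral_abs _ mB (measurable_funS measurableT (@subsetT _ _) w_meas)).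
move=> [N [mN N0 NP]].
have : lebesgue_rV (eball x r) <= lebesgue_rV N.
  apply: le_measure; rewrite ?inE// => y By; apply: NP => /= /(_ By) wy.
  by have := w_gt0 y; rewrite wy ltxx.
by rewrite N0 leNgt lebesgue_eball_gt0.
Qed.

Lemma ae_weight_fin_gt0 : {ae lebesgue_rV, forall x, 0 < w x < +oo}.
Proof.
have : {ae lebesgue_rV, forall x, forall k : nat, eball 0 k%:R x -> w x \is a fin_num}.
  apply/ae_foralln => k; apply: integrable_ae; first exact: measurable_eball.
  apply/integrableP; split; first exact: measurable_funS w_meas.
  under eq_integral do rewrite gee0_abs//.
  exact: weighted_eball_fin.
apply: filterS => x xk; rewrite w_gt0/=.
have [k kx] : exists k : nat, (enorm (x - 0) < k%:R)%R.
  by exists (Num.truncn (enorm (x - 0))).+1; exact: truncnS_gt.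
by rewrite -ge0_fin_numE// (xk k).
Qed.

(** [weighted w] is a bare set function. Here it becomes a measure, with the sigma-finiteness that
    Tonelli's theorem requires in [doubling_averaging]. *)
Lemma weighted_measure : exists mu : {sigma_finite_measure set 'rV[R]_n -> \bar R},
  weighted w = mu :> (set 'rV[R]_n -> \bar R).
Proof.
pose m0 := isMeasure.Build _ _ _ (weighted w) weighted0 weighted_ge0 weighted_sigma_additive.
pose m : {measure set 'rV[R]_n -> \bar R} := HB.pack (weighted w) m0.
have sf : sigma_finite setT m.
  exists (fun k => eball 0 k%:R).
    apply/seteqP; split => // x _.
    by exists (Num.truncn (enorm (x - 0))).+1 => //; exact: truncnS_gt.
  by move=> k; split; [exact: measurable_eball|exact: weighted_eball_fin].
pose s0 := Measure_isSigmaFinite.Build _ _ _ m sf.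
pose s : {sigma_finite_measure set 'rV[R]_n -> \bar R} := HB.pack (weighted w) m m0 s0.
by exists s.
Qed.

End weighted_measure.

Unset Implicit Arguments.

Theorem corollary3 (R : realType) (n : nat) (p : R) (w : 'rV[R]_n -> \bar R)
    (n_gt0 : (0 < n)%N) (p_gt1 : 1 < p)
    (w_loc : locally_integrable_rV w) (w_gt0 : forall x, (0 < w x)%E) :
  p_admissible p w <->
  exists q C sigma : R, [/\ p < q, 1 <= C, 1 <= sigma &
    sobolev_poincare_ineq p q C sigma (weighted w)].
Proof.
have [nu nuE] := weighted_measure w_loc w_gt0.
have mu_gt0 x r : 0 < r -> (0 < nu (eball x r))%E.
  by rewrite -nuE; exact: weighted_eball_gt0.
have mu_fin x r : (nu (eball x r) < +oo)%E.
  by rewrite -nuE; exact: weighted_eball_fin.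
rewrite /p_admissible nuE.
pose mu : {measure set 'rV[R]_n -> \bar R} := nu.
split=> [[_ [[_ dbl] _ sob poi]]|[q [C [sigma [pq C1 s1 SP]]]]].
  exact: (@admissible_sobolev_poincare R n mu mu_gt0 mu_fin p p_gt1 dbl sob poi).
(* Doubling comes first: the proofs of (II) and (IV) take the averaging bound as a hypothesis, and
   that bound rests on doubling. *)
have [D D0 dbl] := @poincare_doubling R n mu mu_gt0 mu_fin p q C sigma p_gt1 pq C1 s1 SP.
have DD0 : 0 < D * D by exact: mulr_gt0.
have avg := doubling_averaging mu_gt0 mu_fin D0 dbl.
split; first by split => // x; exact: ltW.
split.
- split; first exact: ae_weight_fin_gt0.
  by apply/(@doublingP R n mu mu_fin); exists D.
- exact: (@poincare_unique_gradient R n mu mu_gt0 mu_fin p q C sigma p_gt1 pq C1 s1 SP _ DD0 avg).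
- exact: (@poincare_sobolev R n mu mu_gt0 mu_fin p q C sigma n_gt0 p_gt1 pq C1 s1 SP).
- exact: (@poincare_strong R n mu mu_gt0 mu_fin p q C sigma p_gt1 pq C1 s1 SP _ DD0 avg).
Qed.
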